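(* Let $W:[0,1]^2\to[0,1]$ be a symmetric function (graphon) that is Lipschitz continuous with Lipschitz constant $L_W>0$ and satisfies $|\lambda_1(W)-\lambda_2(W)|>0$, and let $\phi_1$ be the normalized eigenfunction for $\lambda_1(W)$. Let $U_1,U_2,\dots$ be i.i.d. $\mathrm{Unif}[0,1]$, $\mathbf U_n=(U_1,\dots,U_n)$; let $\mathbf W_n$ be the $n\times n$ matrix with entries $W(U_i,U_j)$ for $i\neq j$ and zero diagonal; and, conditionally on $\mathbf U_n$, let $\mathbf A_n$ be the random symmetric $n\times n$ matrix with zero diagonal and independent entries $\mathbf A_n(i,j)\sim\mathrm{Ber}(W(U_i,U_j))$ for $1\le i<j\le n$. Then there exists a set $\mathcal A$ of sequences $(U_1,U_2,U_3,\dots)$ with $\mathbb P(\mathcal A)=1$ such that on $\mathcal A$, as $n\to\infty$, $$\left(\lambda_1(\mathbf A_n)-\lambda_1(\mathbf W_n)\right)\,\big|\,\mathbf U_n\ \xrightarrow{D}\ \mathcal N(\alpha,\sigma^2),$$ where $$\alpha=\frac1{\lambda_1(W)}\int_{[0,1]^2}\frac{\phi_1^2(x)+\phi_1^2(y)}{2}W(x,y)(1-W(x,y))\,dx\,dy,$$ $$\sigma^2=2\int_{[0,1]^2}\phi_1^2(x)\phi_1^2(y)W(x,y)(1-W(x,y))\,dx\,dy.$$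
   Context: $T_W:L^2[0,1]\to L^2[0,1]$, $T_Wg(x)=\int_0^1W(x,y)g(y)\,dy$; $\lambda_1(W)\ge\lambda_2(W)\ge\cdots\ge0$ are its nonnegative eigenvalues counted with multiplicity (padded with zeros if finitely many are positive). For a symmetric matrix $M$, $\lambda_1(M)$ is its largest eigenvalue. The displayed convergence means that for every sequence in $\mathcal A$ the conditional distribution of $\lambda_1(\mathbf A_n)-\lambda_1(\mathbf W_n)$ given $\mathbf U_n$ converges weakly to $\mathcal N(\alpha,\sigma^2)$, the Gaussian law with mean $\alpha$ and variance $\sigma^2$. *)

(* Defs.v *)
From HB Require Import structures.
From mathcomp Require Import all_boot all_order all_algebra.
From mathcomp Require Import all_classical all_reals all_analysis.

Set Implicit Arguments.
Unset Strict Implicit.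
Unset Printing Implicit Defensive.
Import Order.TTheory GRing.Theory Num.Theory.
Import numFieldNormedType.Exports.
Local Open Scope classical_set_scope.
Local Open Scope ring_scope.

Section Graphon.
Context {R : realType}.
Implicit Types (W : R -> R -> R) (g phi : R -> R) (lam : nat -> R).

Definition unit_itv : set R := `[0, 1]%classic.

Definition unit_square : set (R * R) := unit_itv `*` unit_itv.

(* Only the values of W on the unit square are constrained, and only those
   values are used. *)
Definition graphon W :=
  (forall x y, unit_itv x -> unit_itv y -> W x y = W y x) /\
  (forall x y, unit_itv x -> unit_itv y -> 0 <= W x y <= 1).

(* The norm on R * R is the max norm. *)
Definition graphon_lipschitz (L : R) W :=
  L.-lipschitz_unit_square (fun z : R * R => W z.1 z.2).

Definition leb01 : {measure set (measurableTypeR R) -> \bar R} :=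
  mrestr lebesgue_measure (measurable_itv `[0, 1] : measurable unit_itv).

(* Elements of L^2[0,1] are handled through representatives. *)
Definition L2_01 g := g \in Lfun leb01 2%:E.

Definition L2_norm g : \bar R := 'N[leb01]_2%:E [EFin \o g].

Definition ae01 (Q : R -> Prop) :=
  {ae lebesgue_measure, forall x : measurableTypeR R, unit_itv x -> Q x}.

Definition graphon_op W g (x : R) : R :=
  \int[lebesgue_measure]_(y in unit_itv) (W x y * g y).

Definition graphon_eigenspace W (mu : R) g :=
  L2_01 g /\ ae01 (fun x => graphon_op W g x = mu * g x).

Definition L2_free m (g : 'I_m -> R -> R) :=
  forall c : 'I_m -> R, ae01 (fun x => \sum_i c i * g i x = 0) ->
  forall i, c i = 0.

(* The eigenspace of mu has dimension at least m. *)
Definition multiplicity_ge W (mu : R) (m : nat) :=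
  exists g : 'I_m -> R -> R,
    (forall i, graphon_eigenspace W mu (g i)) /\ L2_free g.

(* lam k is the (k+1)-st largest nonnegative eigenvalue: lam is nonincreasing
   and nonnegative, and each mu > 0 occurs in it exactly as often as its
   multiplicity; this leaves only zeros as padding. *)
Definition nonneg_eigenvalues W lam :=
  (forall k, 0 <= lam k.+1 <= lam k) /\
  (forall mu, 0 < mu -> forall m : nat,
     multiplicity_ge W mu m <->
     exists s : seq nat,
       [/\ uniq s, size s = m & forall k, k \in s -> lam k = mu]).

Definition normalized_eigenfunction W (mu : R) phi :=
  graphon_eigenspace W mu phi /\ L2_norm phi = 1%E.

Definition limit_mean W (mu : R) phi : R :=
  mu^-1 * \int[(lebesgue_measure \x lebesgue_measure)%E]_(z in unit_square)
    ((phi z.1 ^+ 2 + phi z.2 ^+ 2) / 2 * W z.1 z.2 * (1 - W z.1 z.2)).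

Definition limit_var W phi : R :=
  2 * \int[(lebesgue_measure \x lebesgue_measure)%E]_(z in unit_square)
    (phi z.1 ^+ 2 * phi z.2 ^+ 2 * W z.1 z.2 * (1 - W z.1 z.2)).

Definition lambda_max n (M : 'M[R]_n) : R := sup [set a | eigenvalue M a].

Definition kernel_matrix W n (u : n.-tuple R) : 'M[R]_n :=
  \matrix_(i, j) (if i == j then 0 else W (tnth u i) (tnth u j)).

End Graphon.

Section Probability.
Context {R : realType}.

(* The library's normal_prob takes the standard deviation, and at standard
   deviation 0 it is a uniform law instead of a point mass. *)
Definition gaussian (m v : R) : probability (measurableTypeR R) R :=
  if v == 0 then [the probability _ _ of @dirac _ (measurableTypeR R) m R]
  else [the probability _ _ of normal_prob m (Num.sqrt v)].

Definition weak_cvg (mu : nat -> {measure set (measurableTypeR R) -> \bar R})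
    (nu : {measure set (measurableTypeR R) -> \bar R}) :=
  forall f : R -> R, continuous f -> bounded_fun f ->
    (fun n => \int[mu n]_x f x) @ \oo --> (\int[nu]_x f x : R).

Context d {T : measurableType d} {P : probability T R}.

Definition mutually_independent (U : nat -> {RV P >-> measurableTypeR R}) :=
  forall (s : seq nat) (B : nat -> set (measurableTypeR R)),
    uniq s -> (forall i, measurable (B i)) ->
    P [set w | forall i, i \in s -> B i (U i w)] =
      (\prod_(i <- s) P (U i @^-1` B i))%E.

Definition iid_uniform (U : nat -> {RV P >-> measurableTypeR R}) :=
  [/\ forall i w, unit_itv (U i w),
      mutually_independent U &
      forall i (B : set (measurableTypeR R)), measurable B ->
        distribution P (U i) B = uniform_prob (@ltr01 R) B].

Definition initial_segment (u : nat -> R) n :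
    n.-tuple (measurableTypeR R) := [tuple u i | i < n].

Definition sample (U : nat -> {RV P >-> measurableTypeR R}) n (w : T) :
    n.-tuple (measurableTypeR R) := initial_segment (fun i => U i w) n.

(* k is a version of the conditional distribution of X given Y. *)
Definition cond_distribution d1 (T1 : measurableType d1)
    d2 (T2 : measurableType d2) (X : T -> T2) (Y : T -> T1)
    (k : R.-pker T1 ~> T2) :=
  forall (B : set T1) (C : set T2), measurable B -> measurable C ->
    P (Y @^-1` B `&` X @^-1` C) = (\int[P]_(w in Y @^-1` B) k (Y w) C)%E.

(* Conditionally on Y, the edges a i j with i < j are independent and
   a i j has law Ber(W(Y_i, Y_j)). *)
Definition cond_random_graph (W : R -> R -> R) n
    (Y : T -> n.-tuple (measurableTypeR R)) (a : 'I_n -> 'I_n -> {RV P >-> bool}) :=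
  [/\ forall i j w, a i j w = a j i w,
      forall i w, a i i w = false &
      forall (B : set (n.-tuple (measurableTypeR R)))
             (S : 'I_n -> 'I_n -> set bool), measurable B ->
        P (Y @^-1` B `&`
           [set w | forall i j : 'I_n, (i < j)%N -> S i j (a i j w)]) =
        (\int[P]_(w in Y @^-1` B)
           \prod_(i < n) \prod_(j < n | (i < j)%N)
             bernoulli_prob (W (tnth (Y w) i) (tnth (Y w) j)) (S i j))%E].

Definition adjacency_matrix n (a : 'I_n -> 'I_n -> {RV P >-> bool}) (w : T) :
    'M[R]_n := \matrix_(i, j) (a i j w)%:R.

End Probability.

(* Main.v *)
Require Import Defs.
From HB Require Import structures.
From mathcomp Require Import all_boot all_order all_algebra.
From mathcomp Require Import all_classical all_reals all_analysis.
From mathcomp Require Import measurable_realfun.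
From mathcomp Require Import ring lra.

Set Implicit Arguments.
Unset Strict Implicit.
Unset Printing Implicit Defensive.
Import Order.TTheory GRing.Theory Num.Theory.
Import numFieldNormedType.Exports.
Local Open Scope classical_set_scope.
Local Open Scope ring_scope.

(** Fix the sample and write M for its zero-diagonal kernel matrix, E for the
    centered noise A - M, and v, l for the top unit eigenvector and eigenvalue
    of M, which has spectral gap of order n.  Second order perturbation theory
    gives lambda_max(A) = l + v E v^T + (v E^2 v^T) / l + o(1) in probability.
    By Efron-Stein the quadratic term concentrates at its mean; the linear
    term is a sum of independent variables, to which Lindeberg's replacement
    method is applied with the heat kernel as test function, so that no
    Gaussian variables are needed: each replacement advances the time of the
    kernel by the variance of the replaced term.  Convergence on translated
    heat kernels, uniformly in the translation, implies weak convergence.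

    For the spectral limits, the eigenvector equation extends v to an
    equi-Lipschitz function on [0, 1] (Nystrom extension); along every
    ultrafilter these converge uniformly to an eigenfunction of T_W, and the
    simplicity of the top eigenvalue identifies the limit.  All that is needed
    of the sample is that it is equidistributed, which holds almost surely by
    a fourth moment bound and Borel-Cantelli.  Finally a version kappa of the
    conditional law agrees almost surely with the explicit finite law of the
    random graph, by comparing both on rational rays. *)

(** * Products of Bernoulli variables *)

(** All errors are measured in the unit 1/k, with k the sixteenth root of n: each size in the
    perturbation argument is then bounded by an integer power of k, and Markov's inequality can give
    away a factor k every time. The operator norm of E is controlled only through the trace of E^4,
    of mean O(n^3). The bound n^(13/16) so obtained is far above the true order sqrt n but below the
    gap of order n; it suffices because v E v^T, v E^2 v^T and v E M are bounded by moments of their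
    own. The kernel is extended to the whole plane by clamping its arguments, and the given L^2
    eigenfunction is replaced by its Lipschitz version, so that the analysis concerns functions
    defined everywhere. The sign of v may vary with n, but mean and variance see only the squares of
    its entries. Testing against heat kernels, a limit of variance 0 obeys the same formula as the
    others. The version kappa is fixed only up to null sets of n-tuples; one null set per n and
    rational ray is removed, so [calA] depends on kappa too. *)

Section BernoulliProduct.
Context {R : realType} {I : finType}.
Variable p : I -> R.
Hypothesis p01 : forall i, 0 <= p i <= 1.
Implicit Types (w : {ffun I -> bool}) (f g : {ffun I -> bool} -> R).

Definition bern_wt w := \prod_i (if w i then p i else 1 - p i).

Definition bexp f := \sum_w bern_wt w * f w.

Definition upd i b w : {ffun I -> bool} := [ffun j => if j == i then b else w j].

Definition free_of i f := forall b w, f (upd i b w) = f w.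

Definition eps i w : R := (w i)%:R - p i.

Lemma upd_same i b w : upd i b w i = b.
Proof. by rewrite ffunE eqxx. Qed.

Lemma upd_other i j b w : j != i -> upd i b w j = w j.
Proof. by rewrite ffunE => /negPf ->. Qed.

Lemma updK i b b' w : upd i b (upd i b' w) = upd i b w.
Proof. by apply/ffunP => j; rewrite !ffunE; case: eqP. Qed.

Lemma upd_id i w : upd i (w i) w = w.
Proof. by apply/ffunP => j; rewrite !ffunE; case: eqP => [->|]. Qed.

Lemma updC i j b b' w : i != j -> upd i b (upd j b' w) = upd j b' (upd i b w).
Proof.
move=> ij; apply/ffunP => k; rewrite !ffunE.
by have [->|//] := eqVneq k i; rewrite (negPf ij).
Qed.

Lemma bern_wt_ge0 w : 0 <= bern_wt w.
Proof.
apply: prodr_ge0 => i _; have /andP[? ?] := p01 i.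
by case: (w i) => //; rewrite subr_ge0.
Qed.

Lemma bern_wt_sum : \sum_w bern_wt w = 1.
Proof.
rewrite /bern_wt -(bigA_distr_bigA (fun i b => if b then p i else 1 - p i)).
by apply: big1 => i _; rewrite big_bool/=; ring.
Qed.

Lemma eq_bexp f g : f =1 g -> bexp f = bexp g.
Proof. by move=> fg; apply: eq_bigr => w _; rewrite fg. Qed.

Lemma bexpD f g : bexp (fun w => f w + g w) = bexp f + bexp g.
Proof. by rewrite -big_split; apply: eq_bigr => w _; rewrite mulrDr. Qed.

Lemma bexpZ c f : bexp (fun w => c * f w) = c * bexp f.
Proof. by rewrite /bexp mulr_sumr; apply: eq_bigr => w _; rewrite mulrCA. Qed.

Lemma bexpB f g : bexp (fun w => f w - g w) = bexp f - bexp g.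
Proof. by rewrite /bexp -sumrB; apply: eq_bigr => w _; rewrite mulrBr. Qed.

Lemma bexp_cst c : bexp (fun=> c) = c.
Proof. by rewrite /bexp -mulr_suml bern_wt_sum mul1r. Qed.

Lemma bexp_sum (J : Type) (r : seq J) (P : pred J) (F : J -> {ffun I -> bool} -> R) :
  bexp (fun w => \sum_(j <- r | P j) F j w) = \sum_(j <- r | P j) bexp (F j).
Proof. by rewrite /bexp exchange_big/=; apply: eq_bigr => w _; rewrite mulr_sumr. Qed.

Lemma ler_bexp f g : (forall w, f w <= g w) -> bexp f <= bexp g.
Proof.
by move=> fg; apply: ler_sum => w _; rewrite ler_wpM2l ?bern_wt_ge0.
Qed.

Lemma bexp_ge0 f : (forall w, 0 <= f w) -> 0 <= bexp f.
Proof. by move=> f0; rewrite -(bexp_cst 0); exact: ler_bexp. Qed.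

Lemma ler_norm_bexp f : `|bexp f| <= bexp (fun w => `|f w|).
Proof.
rewrite (le_trans (ler_norm_sum _ _ _))//; apply: ler_sum => w _.
by rewrite normrM (ger0_norm (bern_wt_ge0 w)).
Qed.

Lemma bexp_markov f (a : R) : 0 < a -> (forall w, 0 <= f w) ->
  bexp (fun w => (a < f w)%R%:R) <= bexp f / a.
Proof.
move=> a0 f0; rewrite mulrC -bexpZ; apply: ler_bexp => w.
rewrite mulrC ler_pdivlMr//; case: ltP => [/ltW|_]; first by rewrite mul1r.
by rewrite mul0r f0.
Qed.

(** Pairs each configuration in which [i] is set with its flip, so that identities in a single
    coordinate can be checked pair by pair. *)
Lemma sum_upd i (g : {ffun I -> bool} -> R) :
  \sum_w g w = \sum_(w : {ffun I -> bool} | w i) (g w + g (upd i false w)).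
Proof.
rewrite big_split/= (bigID (fun w : {ffun I -> bool} => w i))/=; congr (_ + _).
rewrite (reindex_onto (upd i false) (upd i true))/=; last first.
  by move=> w /negPf wi; rewrite updK -wi upd_id.
apply: eq_bigl => w; rewrite upd_same/= updK.
apply/eqP/idP => [<-|wi]; first by rewrite upd_same.
by rewrite -[X in upd _ X _]wi upd_id.
Qed.

Lemma bern_wt_upd i w : w i ->
  exists r, bern_wt w = p i * r /\ bern_wt (upd i false w) = (1 - p i) * r.
Proof.
move=> wi; exists (\prod_(j | j != i) (if w j then p j else 1 - p j)).
split; rewrite /bern_wt (bigD1 i)//= ?wi// upd_same; congr (_ * _).
by apply: eq_bigr => j ji; rewrite upd_other.
Qed.

Lemma bexp_indep i (h : bool -> R) g : free_of i g ->
  bexp (fun w => h (w i) * g w) = (p i * h true + (1 - p i) * h false) * bexp g.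
Proof.
move=> gi; rewrite /bexp 2!(sum_upd i) mulr_sumr; apply: eq_bigr => w wi.
have [r [-> ->]] := bern_wt_upd wi.
by rewrite upd_same wi (gi false); ring.
Qed.

(** Conditional expectation given all coordinates other than [i]. *)
Definition bavg i f w := p i * f (upd i true w) + (1 - p i) * f (upd i false w).

Lemma bavg_free i f : free_of i (bavg i f).
Proof. by move=> b w; rewrite /bavg !updK. Qed.

Lemma bexp_bavg i f : bexp (bavg i f) = bexp f.
Proof.
rewrite /bexp 2!(sum_upd i); apply: eq_bigr => w wi.
have [r [-> ->]] := bern_wt_upd wi; rewrite bavg_free /bavg.
have -> : upd i true w = w by rewrite -[X in upd _ X _]wi upd_id.
by ring.
Qed.

Lemma eps_free i j : j != i -> free_of i (eps j).
Proof. by move=> ji b w; rewrite /eps upd_other. Qed.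

Lemma eps_sum_free i (c : I -> R) s : i \notin s ->
  free_of i (fun w => \sum_(j <- s) c j * eps j w).
Proof.
move=> si b w; rewrite !big_seq; apply: eq_bigr => j js.
by rewrite eps_free//; apply: contraNneq si => <-.
Qed.

Lemma bexp_eps i g : free_of i g -> bexp (fun w => eps i w * g w) = 0.
Proof.
move=> gi; rewrite (bexp_indep (fun b : bool => b%:R - p i) gi)/=.
by ring.
Qed.

Lemma bexp_eps2 i g : free_of i g ->
  bexp (fun w => eps i w ^+ 2 * g w) = p i * (1 - p i) * bexp g.
Proof.
move=> gi; rewrite (bexp_indep (fun b : bool => (b%:R - p i) ^+ 2) gi)/=.
by congr (_ * _); ring.
Qed.

Lemma bexp_epsM i j : bexp (fun w => eps i w * eps j w) =
  (i == j)%:R * (p i * (1 - p i)).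
Proof.
have [<-|ij] := eqVneq i j; last first.
  by rewrite mul0r bexp_eps//; apply: eps_free; rewrite eq_sym.
rewrite mul1r -[RHS]mulr1 -{2}(bexp_cst 1) -bexp_eps2//.
by apply: eq_bexp => w; rewrite mulr1 expr2.
Qed.

Lemma bexp_linM (c d : I -> R) :
  bexp (fun w => (\sum_i c i * eps i w) * (\sum_i d i * eps i w)) =
  \sum_i c i * d i * (p i * (1 - p i)).
Proof.
under eq_bexp do rewrite mulr_suml.
rewrite bexp_sum; apply: eq_bigr => i _.
under eq_bexp do rewrite mulr_sumr.
rewrite bexp_sum (bigD1 i)//= big1 ?addr0.
  under eq_bexp do rewrite mulrACA.
  by rewrite bexpZ bexp_epsM eqxx mul1r.
move=> j ji; under eq_bexp do rewrite mulrACA.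
by rewrite bexpZ bexp_epsM eq_sym (negPf ji) mul0r mulr0.
Qed.

Lemma bern_var_le i : 0 <= p i * (1 - p i) <= 1.
Proof.
have /andP[? ?] := p01 i; rewrite mulr_ge0 ?subr_ge0//=.
by rewrite mulr_ile1 ?subr_ge0// lerBlDr lerDl.
Qed.

Lemma bexp_lin_sqr_le (c : I -> R) :
  bexp (fun w => (\sum_i c i * eps i w) ^+ 2) <= \sum_i c i ^+ 2.
Proof.
rewrite (bexp_linM c c); apply: ler_sum => i _.
rewrite -expr2 -[leRHS]mulr1 ler_wpM2l ?sqr_ge0//.
by case/andP: (bern_var_le i).
Qed.

Lemma eps_norm i w : `|eps i w| <= 1.
Proof.
rewrite /eps; have /andP[? ?] := p01 i.
by case: (w i); rewrite ler_norml /=; apply/andP; split; lra.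
Qed.

(** One variable is added at a time. In the fourth power of [eps i + S] the terms odd in [S] have
    mean 0 by independence, which leaves at most 1 + 6 m + 3 m^2 <= 3 (m + 1)^2, with m the number
    of earlier variables. Hence the induction carries the first two moments along. *)
Lemma bexp_sum4 : bexp (fun w => (\sum_i eps i w) ^+ 4) <= 3 * #|I|%:R ^+ 2.
Proof.
have key s : uniq s ->
  [/\ bexp (fun w => \sum_(i <- s) eps i w) = 0,
   bexp (fun w => (\sum_(i <- s) eps i w) ^+ 2) <= (size s)%:R &
   bexp (fun w => (\sum_(i <- s) eps i w) ^+ 4) <= 3 * (size s)%:R ^+ 2].
  elim: s => [_|i s IH /=/andP[si us]].
    split; under eq_bexp do rewrite big_nil ?expr0n.
    - by rewrite bexp_cst.
    - by rewrite bexp_cst.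
    - by rewrite bexp_cst/= expr0n mulr0.
  have [E1 E2 E4] := IH us.
  set S := fun w => \sum_(j <- s) eps j w in E1 E2 E4 *.
  have fS : free_of i S.
    move=> b w; have := @eps_sum_free i (fun=> 1) s si b w.
    by rewrite /S; under eq_bigr do rewrite mul1r; under [RHS]eq_bigr do rewrite mul1r.
  have fSk k : free_of i (fun w => S w ^+ k) by move=> b w; rewrite fS.
  have SE w : \sum_(j <- i :: s) eps j w = eps i w + S w by rewrite big_cons.
  have /andP[v0 v1] := bern_var_le i.
  have m4 : bexp (fun w => eps i w ^+ 4) <= 1.
    rewrite -(bexp_cst 1); apply: ler_bexp => w.
    by rewrite -[eps i w ^+ 4]ger0_norm ?exprn_even_ge0// normrX exprn_ile1 ?eps_norm.
  have m3 : bexp (fun w => eps i w ^+ 3 * S w) = 0.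
    by rewrite (bexp_indep (fun b : bool => (b%:R - p i) ^+ 3) fS) E1 mulr0.
  have E2' : bexp (fun w => (\sum_(j <- i :: s) eps j w) ^+ 2) <= (size s).+1%:R.
    rewrite (@eq_bexp _ (fun w => eps i w ^+ 2 * 1 +
      (eps i w * (2 * S w) + S w ^+ 2))); last by move=> w; rewrite SE; ring.
    rewrite !bexpD bexp_eps2// bexp_eps ?add0r; last by move=> b w; rewrite fS.
    rewrite bexp_cst mulr1 -nat1r lerD//.
  split=> //.
    rewrite (@eq_bexp _ (fun w => eps i w * 1 + S w)); last first.
      by move=> w; rewrite SE mulr1.
    by rewrite bexpD E1 addr0 bexp_eps.
  rewrite (@eq_bexp _ (fun w => eps i w ^+ 4 + (4 * (eps i w ^+ 3 * S w) +
      (6 * (eps i w ^+ 2 * S w ^+ 2) + (eps i w * (4 * S w ^+ 3) + S w ^+ 4)))));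
    last by move=> w; rewrite SE; ring.
  rewrite !bexpD !bexpZ m3 mulr0 add0r bexp_eps2// bexp_eps ?add0r; last first.
    by move=> b w; rewrite fS.
  have E20 : 0 <= bexp (fun w => S w ^+ 2) by apply: bexp_ge0 => w; exact: sqr_ge0.
  have hv : p i * (1 - p i) * bexp (fun w => S w ^+ 2) <= (size s)%:R.
    by apply: le_trans E2; rewrite ler_piMl.
  have n0 : 0 <= (size s)%:R :> R by [].
  rewrite -nat1r; set z := (size s)%:R in hv n0 E4 *.
  set y := _ * bexp _ in hv *; set e4 := bexp _ in m4 *; set s4 := bexp _ in E4 *.
  by nra.
have [_ _] := key (enum I) (enum_uniq I).
by rewrite -cardE; under eq_bexp do rewrite big_enum.
Qed.

Definition bdiff i f w := f (upd i true w) - f (upd i false w).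

(** Jensen's inequality; the defect is exactly [p i * (1 - p i)] times the squared difference. *)
Lemma bavg_sqr_le i f w : bavg i f w ^+ 2 <= bavg i (fun w => f w ^+ 2) w.
Proof.
rewrite /bavg -subr_ge0; have /andP[v0 v1] := bern_var_le i.
rewrite (_ : _ - _ = p i * (1 - p i) * bdiff i f w ^+ 2); last by rewrite /bdiff; ring.
by rewrite mulr_ge0 ?sqr_ge0.
Qed.

(** The coordinates are averaged out one after another. Each averaging lowers the second moment by
    at most the mean squared difference in that coordinate (a factor p (1 - p) is dropped), and by
    Jensen the averages already taken do not increase this difference. Once every coordinate is
    averaged out, the constant [bexp f] is left. *)
Lemma efron_stein f :
  bexp (fun w => f w ^+ 2) - bexp f ^+ 2 <=
  \sum_i bexp (fun w => bdiff i f w ^+ 2).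
Proof.
pose avgs s := foldr bavg f s.
have avgsS i s : avgs (i :: s) = bavg i (avgs s) by [].
have avgs_exp s : bexp (avgs s) = bexp f by elim: s => //= i s <-; rewrite bexp_bavg.
have avgs_free s i : i \in s -> free_of i (avgs s).
  elim: s => // j s IH; rewrite inE; have [->|ij /= si] := eqVneq i j.
    by move=> _ b w; exact: bavg_free.
  by move=> b w; rewrite /bavg -!(updC _ _ _ ij) !(IH si).
have diff_avgs s i : bexp (fun w => bdiff i (avgs s) w ^+ 2) <=
    bexp (fun w => bdiff i f w ^+ 2).
  elim: s => // j s; apply: le_trans; rewrite -(bexp_bavg j (fun w => bdiff i (avgs s) w ^+ 2)).
  apply: ler_bexp => w; apply: le_trans (bavg_sqr_le _ _ _).
  have [<-|ij] := eqVneq i j.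
    by rewrite avgsS {1}/bdiff !bavg_free subrr expr0n/= sqr_ge0.
  by rewrite avgsS /bdiff /bavg -!(updC _ _ _ ij) le_eqVlt; apply/orP; left; apply/eqP; congr (_ ^+ 2); ring.
have key s : bexp (fun w => f w ^+ 2) - bexp (fun w => avgs s w ^+ 2) <=
    \sum_(i <- s) bexp (fun w => bdiff i f w ^+ 2).
  elim: s => [|i s IH]; first by rewrite big_nil subrr.
  rewrite big_cons; apply: le_trans (lerD (diff_avgs s i) IH).
  rewrite addrCA lerD2l -lerBlDr -opprD addrC -subr_ge0 opprK addrC.
  rewrite -(bexp_bavg i (fun w => avgs s w ^+ 2)) -bexpB.
  rewrite -bexpD; apply: bexp_ge0 => w.
  rewrite avgsS /bavg /bdiff; have /andP[v0 v1] := bern_var_le i.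
  set x := avgs s _; set y := avgs s _.
  rewrite [leRHS](_ : _ = (1 - p i * (1 - p i)) * (x - y) ^+ 2); last by ring.
  by rewrite mulr_ge0 ?sqr_ge0// subr_ge0.
(* A function free of every coordinate is constant: [w'] is overwritten by the values of [w], one
   coordinate at a time. *)
have cst w w' : avgs (enum I) w = avgs (enum I) w'.
  have free i : free_of i (avgs (enum I)) by apply: avgs_free; rewrite mem_enum.
  pose u s := foldr (fun i v => upd i (w i) v) w' s.
  have uE s : avgs (enum I) (u s) = avgs (enum I) w'.
    by elim: s => //= i s IH; rewrite free.
  rewrite -(uE (enum I)); congr avgs; apply/ffunP => j.
  have : j \in enum I by rewrite mem_enum.
  elim: (enum I) => //= i s IH; rewrite inE ffunE; case: eqP => [->//|_ /=].
  exact: IH.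
have := key (enum I); rewrite big_enum/=; apply: le_trans; rewrite lerD2l lerN2.
pose w0 : {ffun I -> bool} := [ffun=> false].
rewrite -(avgs_exp (enum I)) (eq_bexp (fun w => cst w w0)) bexp_cst.
by under eq_bexp do rewrite (cst _ w0); rewrite bexp_cst.
Qed.

(** Conditioning on a fresh coordinate [i] produces two shifted base points; the induction
    hypothesis at these already moves the time to [t + V], and one use of [step] at that later time
    merges the two values. This is why [step] is required at all times past [t0] and all
    positions. *)
Lemma lindeberg_swap (F : R -> R -> R) (K t0 : R) (c : I -> R) :
  (forall i, `|c i| <= 1) ->
  (forall t x (a q : R), t0 <= t -> 0 <= q <= 1 -> `|a| <= 1 ->
    `|q * F t (x + a * (1 - q)) + (1 - q) * F t (x + a * (0 - q))
      - F (t + a ^+ 2 * (q * (1 - q))) x| <= K * `|a| ^+ 3) ->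
  forall t x, t0 <= t ->
  `|bexp (fun w => F t (x + \sum_i c i * eps i w))
    - F (t + \sum_i c i ^+ 2 * (p i * (1 - p i))) x| <= K * \sum_i `|c i| ^+ 3.
Proof.
move=> c1 step.
have key s : uniq s -> forall t x, t0 <= t ->
  `|bexp (fun w => F t (x + \sum_(i <- s) c i * eps i w))
    - F (t + \sum_(i <- s) c i ^+ 2 * (p i * (1 - p i))) x|
  <= K * \sum_(i <- s) `|c i| ^+ 3.
  elim: s => [_ t x _|i s IH /=/andP[si us] t x t0t].
    rewrite !big_nil; under eq_bexp do rewrite big_nil.
    by rewrite bexp_cst !addr0 subrr normr0 mulr0.
  have /andP[q0 q1] := p01 i.
  have fS := @eps_sum_free i c s si.
  rewrite -(bexp_bavg i) /bavg bexpD !bexpZ.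
  have E b : bexp (fun w => F t (x + \sum_(j <- i :: s) c j * eps j (upd i b w)))
      = bexp (fun w => F t (x + c i * (b%:R - p i) + \sum_(j <- s) c j * eps j w)).
    by apply: eq_bexp => w; rewrite big_cons {1}/eps upd_same fS addrA.
  rewrite !E !big_cons.
  set V := \sum_(j <- s) c j ^+ 2 * _.
  have V0 : 0 <= V.
    apply: sumr_ge0 => j _; rewrite mulr_ge0 ?sqr_ge0//.
    by case/andP: (bern_var_le j).
  have tV : t0 <= t + V by rewrite (le_trans t0t)// lerDl.
  have := step (t + V) x (c i) (p i) tV (p01 i) (c1 i).
  have := IH us t (x + c i * (1 - p i)) t0t.
  have := IH us t (x + c i * (0 - p i)) t0t.
  rewrite -/V (addrC (c i ^+ 2 * _) V) addrA.
  set G := F _ x; set e1 := bexp _; set e2 := bexp _.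
  set G1 := F _ _; set G2 := F _ _; set B := K * \sum_(j <- s) _.
  move=> h2 h1 h3.
  rewrite (_ : _ - G = p i * (e2 - G2) + (1 - p i) * (e1 - G1)
    + (p i * G2 + (1 - p i) * G1 - G)); last by ring.
  rewrite [leRHS]mulrDr [leRHS]addrC (le_trans (ler_normD _ _))// lerD//.
  rewrite (le_trans (ler_normD _ _))// !normrM (ger0_norm q0).
  rewrite (@ger0_norm _ (1 - p i)) ?subr_ge0//.
  rewrite [leRHS](_ : _ = p i * B + (1 - p i) * B); last by rewrite /B; ring.
  by rewrite lerD// ler_wpM2l// subr_ge0.
move=> t x t0t; have := key (enum I) (enum_uniq I) t x t0t.
by rewrite !big_enum; under eq_bexp do rewrite big_enum.
Qed.

End BernoulliProduct.

(** * Top eigenvalues of symmetric matrices *)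

Section RealSymmetric.
Context {R : realType}.

Lemma cvg_sumr (T I : Type) (F : set_system T) (r : seq I) (P : pred I)
    (f : I -> T -> R) (a : I -> R) : Filter F ->
  (forall i, P i -> f i x @[x --> F] --> a i) ->
  \sum_(i <- r | P i) f i x @[x --> F] --> \sum_(i <- r | P i) a i.
Proof. by move=> FF fa; apply: cvg_big => //; exact: add_continuous. Qed.

Definition dot n (x y : 'rV[R]_n) : R := \sum_i x 0 i * y 0 i.

Section Dot.
Variable n : nat.
Implicit Types (x y z : 'rV[R]_n) (M : 'M[R]_n).

Lemma dotC x y : dot x y = dot y x.
Proof. by apply: eq_bigr => i _; rewrite mulrC. Qed.

Lemma dotDl x y z : dot (x + y) z = dot x z + dot y z.
Proof. by rewrite -big_split; apply: eq_bigr => i _; rewrite mxE mulrDl. Qed.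

Lemma dotDr x y z : dot z (x + y) = dot z x + dot z y.
Proof. by rewrite dotC dotDl !(dotC z). Qed.

Lemma dotZl a x y : dot (a *: x) y = a * dot x y.
Proof. by rewrite mulr_sumr; apply: eq_bigr => i _; rewrite mxE mulrA. Qed.

Lemma dotZr a x y : dot x (a *: y) = a * dot x y.
Proof. by rewrite dotC dotZl dotC. Qed.

Lemma dotNl x y : dot (- x) y = - dot x y.
Proof. by rewrite -scaleN1r dotZl mulN1r. Qed.

Lemma dotNr x y : dot x (- y) = - dot x y.
Proof. by rewrite dotC dotNl dotC. Qed.

Definition dotE := (dotDl, dotDr, dotNl, dotNr, dotZl, dotZr).

Lemma dot_ge0 x : 0 <= dot x x.
Proof. by apply: sumr_ge0 => i _; rewrite -expr2 sqr_ge0. Qed.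

Lemma dot_eq0 x : (dot x x == 0) = (x == 0).
Proof.
apply/eqP/eqP => [x0|->]; last by apply: big1 => i _; rewrite mxE mul0r.
apply/rowP => i; rewrite mxE; apply/eqP; rewrite -sqrf_eq0 expr2.
move/eqP: x0; rewrite psumr_eq0; last by move=> j _; rewrite -expr2 sqr_ge0.
by move=> /allP/(_ i); rewrite mem_index_enum => /(_ isT).
Qed.

Lemma dot_mulmx x y M : dot (x *m M) y = \sum_i \sum_j x 0 i * M i j * y 0 j.
Proof.
rewrite exchange_big; apply: eq_bigr => j _.
by rewrite mxE mulr_suml.
Qed.

Lemma dot_sym M x y : M^T = M -> dot (x *m M) y = dot x (y *m M).
Proof.
move=> sM; rewrite [RHS]dotC !dot_mulmx exchange_big; apply: eq_bigr => i _.
apply: eq_bigr => j _; rewrite -[M in LHS]sM mxE; ring.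
Qed.

Lemma dot_AMGM (s : R) x y : 0 < s -> 2 * `|dot x y| <= s * dot x x + s^-1 * dot y y.
Proof.
move=> s0; have H (e : R) : e ^+ 2 = 1 -> 2 * e * dot x y <= s * dot x x + s^-1 * dot y y.
  move=> e1; have := dot_ge0 (s *: x - e *: y).
  rewrite !dotE (dotC y x) => h; rewrite -(ler_pM2l s0) [leRHS]mulrDr.
  rewrite [X in _ <= _ + X]mulrA mulfV ?gt_eqF// mul1r.
  have : e * (e * dot y y) = dot y y by rewrite mulrA -expr2 e1 mul1r.
  by move: h; lra.
have [d0|d0] := ger0P (dot x y).
  by have := H 1; rewrite expr1n mulr1; exact.
by have := H (-1); rewrite sqrrN expr1n mulrN1 mulNr -mulrN; exact.
Qed.

Lemma dot_CS x y : dot x y ^+ 2 <= dot x x * dot y y.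
Proof.
have [->|y0] := eqVneq y 0.
  by rewrite -(scale0r 0) !dotE !mul0r expr0n mulr0.
have yy : 0 < dot y y by rewrite lt_def dot_eq0 y0 dot_ge0.
rewrite -subr_ge0 -(pmulr_rge0 _ yy).
have := dot_ge0 (dot y y *: x - dot x y *: y).
by rewrite !dotE (dotC y x); congr (_ <= _); ring.
Qed.

End Dot.

Lemma dot_continuous n (f g : 'rV[R]_n -> 'rV[R]_n) :
  (forall i, continuous (fun x => f x 0 i)) ->
  (forall i, continuous (fun x => g x 0 i)) ->
  continuous (fun x => dot (f x) (g x)).
Proof.
move=> cf cg x; rewrite /dot; apply: (@cvg_sumr _ _ (nbhs x)) => i _.
by apply: cvgM; [exact: cf|exact: cg].
Qed.

(** Maximality is stated through the Rayleigh quotient, the form in which both perturbation bounds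
    use it. *)
Definition top_eigenpair n (M : 'M[R]_n) (m : R) (x : 'rV[R]_n) :=
  [/\ dot x x = 1, x *m M = m *: x & forall z, dot (z *m M) z <= m * dot z z].

(** A maximizer [x] of the quadratic form on the compact unit sphere makes [N], that is m - M,
    positive semidefinite with vanishing form at [x]; if [x *m N] were nonzero, moving from [x]
    against it would make the form negative. *)
Lemma ex_top_eigenpair n (M : 'M[R]_n.+1) : M^T = M ->
  exists m x, top_eigenpair M m x.
Proof.
move=> sM; pose S := [set x : 'rV[R]_n.+1 | dot x x = 1].
have cx i : continuous (fun x : 'rV[R]_n.+1 => x 0 i) by exact: coord_continuous.
have cxM i : continuous (fun x : 'rV[R]_n.+1 => (x *m M) 0 i).
  move=> x; under eq_fun do rewrite mxE.
  apply: (@cvg_sumr _ _ (nbhs x)) => j _.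
  by apply: cvgM; [exact: cx|exact: cvg_cst].
have S0 : S !=set0.
  exists (delta_mx 0 0); rewrite /S/= /dot (bigD1 0)//= big1 ?addr0.
    by rewrite mxE !eqxx mulr1.
  by move=> i i0; rewrite mxE (negPf i0) andbF mul0r.
have cS : compact S.
  apply: bounded_closed_compact.
    exists 1; split; first exact: num_real.
    move=> y y1 x /= Sx; apply: le_trans (ltW y1).
    rewrite [leLHS]mx_normrE; apply/bigmax_leP; split=> //= -[i j] _ /=.
    rewrite (ord1 i) -(ler_pXn2r (n := 2))// ?nnegrE// expr1n real_normK ?num_real//.
    rewrite -Sx /dot (bigD1 j)//= -expr2 lerDl sumr_ge0// => k _.
    by rewrite -expr2 sqr_ge0.
  have -> : S = (fun x => dot x x) @^-1` [set 1] by [].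
  apply: preimage_closed; last exact: closed_eq.
  by move=> x _; apply: dot_continuous.
have cf : {within S, continuous (fun x => dot (x *m M) x)}.
  by apply: continuous_subspaceT; apply: dot_continuous.
have [x Sx xmax] := EVT_max_rV S0 cS cf.
rewrite inE/= in Sx; set m := dot (x *m M) x in xmax.
have le_m z : dot (z *m M) z <= m * dot z z.
  have [->|z0] := eqVneq z 0.
    by rewrite mul0mx -(scale0r 0) !dotE !mul0r mulr0.
  have zz : 0 < dot z z by rewrite lt_def dot_eq0 z0 dot_ge0.
  pose a := (Num.sqrt (dot z z))^-1.
  have a2 : a ^+ 2 * dot z z = 1.
    by rewrite exprVn sqr_sqrtr ?ltW// mulVf// gt_eqF.
  have := xmax (a *: z); rewrite inE/= -scalemxAl !dotE !mulrA -expr2.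
  rewrite /S/= !dotE mulrA -expr2 => /(_ a2).
  rewrite -(ler_pM2l zz) mulrA (mulrC (dot z z)) a2 mul1r.
  by rewrite (mulrC m).
exists m, x; split=> //.
pose N := m%:M - M.
have sN : N^T = N by rewrite /N raddfB/= tr_scalar_mx sM.
have NE z : z *m N = m *: z - z *m M by rewrite mulmxBr mul_mx_scalar.
have Q z : 0 <= dot (z *m N) z by rewrite NE !dotE subr_ge0.
suff : x *m N = 0 by rewrite NE => /eqP; rewrite subr_eq0 => /eqP.
set y := x *m N; apply/eqP; rewrite -dot_eq0; set b := dot _ _.
have b0 : 0 <= b by exact: dot_ge0.
apply: contraT => bn0; have {bn0 b0} b0 : 0 < b by rewrite lt_def bn0.
(* At [x - t *: y] the form of [N] equals t (t q - 2 b), which is negative because t q < b. The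
   summand 1 in the denominator covers q = 0. *)
pose q := dot (y *m N) y; pose t := b / (q + 1).
have q0 : 0 <= q by exact: Q.
have q1 : 0 < q + 1 by rewrite ltr_wpDl.
have t0 : 0 < t by rewrite divr_gt0.
have := Q (x - t *: y).
have yx : dot y x = 0 by rewrite /y NE !dotE Sx mulr1 subrr.
have yNx : dot (y *m N) x = b by rewrite dot_sym.
rewrite mulmxBl -scalemxAl -/y !dotE yx yNx -/b -/q.
have tq : t * (q + 1) = b by rewrite /t divfK// gt_eqF.
by nra.
Qed.

Lemma ex_top_eigenpair_gt0 n (M : 'M[R]_n) : (0 < n)%N -> M^T = M ->
  exists m x, top_eigenpair M m x.
Proof. by case: n M => // n M _; exact: ex_top_eigenpair. Qed.

Lemma lambda_max_eq n (M : 'M[R]_n) m x : top_eigenpair M m x -> lambda_max M = m.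
Proof.
move=> [x1 xM mM]; rewrite /lambda_max; set A := [set a | _].
have Am : A m.
  apply/eigenvalueP; exists x => //; rewrite -dot_eq0 x1; exact: oner_neq0.
have ubA : ubound A m.
  move=> a /eigenvalueP[y yM y0].
  have yy : 0 < dot y y by rewrite lt_def dot_eq0 y0 dot_ge0.
  by have := mM y; rewrite yM dotZl ler_pM2r.
apply/eqP; rewrite eq_le ge_sup//=; last by exists m.
by apply: ub_le_sup => //; exists m.
Qed.

(** * Second order perturbation of the top eigenvalue *)

Section Perturbation.
Variables (n : nat) (M E : 'M[R]_n) (v y : 'rV[R]_n) (l g mu e : R).
Hypotheses (sM : M^T = M) (sE : E^T = E).
Hypotheses (v1 : dot v v = 1) (vM : v *m M = l *: v) (l0 : 0 < l) (g0 : 0 < g).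
Hypothesis gap : forall z, dot z v = 0 -> dot (z *m M) z <= (l - g) * dot z z.
Hypothesis topA : top_eigenpair (M + E) mu y.
Hypothesis e0 : 0 <= e.
Hypothesis opE : forall z, `|dot (z *m E) z| <= e * dot z z.

Variables (t : R) (w : 'rV[R]_n).
Hypotheses (wv : dot w v = 0) (vE : v *m E = t *: v + l *: w).

Local Notation q := (dot w w).
Local Notation b := `|dot (w *m M) w|.
Local Notation h := (dot (w *m M) (w *m M)).

Let tE : dot (v *m E) v = t.
Proof. by rewrite vE !dotE v1 wv mulr0 addr0 mulr1. Qed.

Let lw z : dot z v = 0 -> dot (v *m E) z = l * dot w z.
Proof. by move=> zv; rewrite vE !dotE (dotC v) zv mulr0 add0r. Qed.

Let q0 : 0 <= q. Proof. exact: dot_ge0. Qed.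

(** Here [w] is 1/l times the part of [v *m E] orthogonal to [v], the first order correction of the
    eigenvector. In the Rayleigh quotient of the trial vector [v + w] the cross terms gain 2 l q and
    the norm 1 + q costs l q, so l q is the net second order gain. *)
Lemma perturb_lower : l + t + l * q - mu <= b + (e + `|t|) * q + l * q ^+ 2.
Proof.
have [_ _ /(_ (v + w))] := topA.
have -> : dot (v + w) (v + w) = 1 + q.
  by rewrite !dotE v1 (dotC v w) wv add0r addr0.
have -> : dot ((v + w) *m (M + E)) (v + w) =
    l + t + 2 * (l * q) + dot (w *m M) w + dot (w *m E) w.
  rewrite mulmxDl !mulmxDr vM !dotE v1 (dotC v w) wv (lw wv) tE.
  rewrite (dot_sym _ _ sM) (dotC w) vM (dot_sym w v sE) (dotC w) (lw wv).
  by rewrite !dotE (dotC v w) wv; ring.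
have := opE w; rewrite ler_norml => /andP[+ _].
have : - b <= dot (w *m M) w by rewrite lerNnormlW.
have := ler_norm t; have := q0.
set B := dot _ _; set C := dot _ _; set T := `|t| => h0 h1 h2 h3 h4.
have h5 : t * B <= T * B by rewrite ler_wpM2r.
have h6 : (1 + B) * (l + t + l * B - mu) <= b + (e + T) * B + l * B ^+ 2 by lra.
have X0 : 0 <= b + (e + T) * B + l * B ^+ 2.
  by rewrite !addr_ge0// ?mulr_ge0 ?addr_ge0 ?sqr_ge0 ?normr_ge0// ltW.
have gen (X Y z : R) : 0 <= z -> 0 <= X -> (1 + z) * Y <= X -> Y <= X.
  by move=> z0 X0' YX; case: (leP Y 0) => Y0; nra.
exact: gen h0 X0 h6.
Qed.

(** Write the true eigenvector as a v + a w + r with [r] orthogonal to [v]. Measuring [r] from the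
    predicted correction a w makes the cross terms l a (w . r) cancel. What remains in |r|^2 is
    absorbed by the gap: half of [g] pays for the coupling of w M with [r], the other half for 2 (e
    + |t|) |r|^2, which is where the assumption on 4 (e + |t|) comes from. *)
Lemma perturb_upper : 4 * (e + `|t|) <= g ->
  mu - (l + t + l * q) <= b + 2 * h / g + 2 * (e + `|t|) * q.
Proof.
move=> eg; set eta := leRHS.
have [y1 yA _] := topA.
have eta0 : 0 <= eta.
  rewrite /eta !addr_ge0// ?normr_ge0 ?mulr_ge0 ?addr_ge0// ?invr_ge0 ?dot_ge0//.
  exact: ltW.
suff : dot (y *m (M + E)) y <= (l + t + (l * q + eta)) * dot y y.
  rewrite yA !dotE y1 !mulr1; lra.
have [a [z [yE zv]]] : exists a z, y = a *: v + z /\ dot z v = 0.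
  exists (dot y v), (y - dot y v *: v).
  by rewrite addrC subrK !dotE v1 mulr1 subrr.
have [r [zE rv]] : exists r, z = a *: w + r /\ dot r v = 0.
  by exists (z - a *: w); rewrite addrC subrK !dotE zv wv mulr0 subrr.
have yy : dot y y = a ^+ 2 + dot z z.
  by rewrite yE !dotE v1 (dotC v z) zv; ring.
have zz : dot z z = a ^+ 2 * q + 2 * a * dot w r + dot r r.
  by rewrite zE !dotE (dotC r w); ring.
have vMz : dot (z *m M) v = 0 by rewrite dot_sym// vM dotC dotZl dotC zv mulr0.
have -> : dot (y *m (M + E)) y =
    a ^+ 2 * (l + t) + 2 * a * (l * dot w z) + dot (z *m M) z + dot (z *m E) z.
  rewrite yE mulmxDl !mulmxDr -!scalemxAl vM !dotE v1 tE vMz (dotC v z) zv (lw zv).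
  by rewrite (dot_sym z v sE) (dotC z) (lw zv); ring.
have zMz : dot (z *m M) z =
    a ^+ 2 * dot (w *m M) w + 2 * a * dot (w *m M) r + dot (r *m M) r.
  by rewrite zE mulmxDl -!scalemxAl !dotE (dot_sym r w sM) (dotC r); ring.
have wz : dot w z = a * q + dot w r by rewrite zE !dotE.
have hr : 2 * (a * dot (w *m M) r) <= a ^+ 2 * (2 * h / g) + g / 2 * dot r r.
  have g20 : 0 < 2 / g by rewrite divr_gt0.
  have := dot_AMGM (a *: (w *m M)) r g20.
  rewrite !dotE invf_div; set X := a * dot _ _; have := ler_norm X.
  move=> h1 h2; apply: le_trans (_ : 2 * `|X| <= _); first by rewrite ler_pM2l.
  by apply: le_trans h2 _; rewrite le_eqVlt; apply/orP; left; apply/eqP; field; rewrite gt_eqF.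
have hb : dot (w *m M) w <= b by exact: ler_norm.
have hgap := gap rv.
have hE : dot (z *m E) z <= e * dot z z by apply: le_trans (opE z); exact: ler_norm.
have hzz : dot z z <= 2 * a ^+ 2 * q + 2 * dot r r.
  have := dot_ge0 (a *: w - r); rewrite zz !dotE (dotC r w); lra.
have hT : - `|t| <= t by rewrite lerNnormlW.
have rr := dot_ge0 r; have z0 := dot_ge0 z; have T0 := normr_ge0 t.
have a0 := sqr_ge0 a.
rewrite yy zMz wz.
have e1 : a ^+ 2 * eta = a ^+ 2 * b + a ^+ 2 * (2 * h / g) + 2 * (e + `|t|) * (a ^+ 2 * q).
  by rewrite /eta; ring.
have e2 : (e + `|t|) * dot z z <= (e + `|t|) * (2 * a ^+ 2 * q + 2 * dot r r).
  by rewrite ler_wpM2l// addr_ge0.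
have e3 : 4 * (e + `|t|) * dot r r <= g * dot r r by rewrite ler_wpM2r.
have e4 : 0 <= (l * q + eta) * dot z z.
  by rewrite mulr_ge0// addr_ge0// mulr_ge0// ltW.
have e5 : a ^+ 2 * dot (w *m M) w <= a ^+ 2 * b by rewrite ler_wpM2l.
have e6 : (t + `|t|) * dot z z >= 0 by rewrite mulr_ge0// -lerBlDr sub0r.
have e7 : l * dot z z = l * (a ^+ 2 * q + 2 * a * dot w r + dot r r) by rewrite zz.
by lra.
Qed.

End Perturbation.

(** With [l] and [g] of order k^16, the bounds k, k^17 and k^33 are the orders 1, n and n^2 of the
    three quadratic quantities with one factor k to spare, and k^13 is any operator bound well below
    the gap. The constant 17 only has to exceed the sum of the constants of the error terms. *)
Lemma top_eig_expansion n (M E : 'M[R]_n) (v y : 'rV[R]_n) (l g mu c k : R) :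
  M^T = M -> E^T = E -> dot v v = 1 -> v *m M = l *: v ->
  (forall z, dot z v = 0 -> dot (z *m M) z <= (l - g) * dot z z) ->
  top_eigenpair (M + E) mu y ->
  0 < c <= 1 -> 1 <= k -> 8 <= c * k ^+ 3 ->
  c * k ^+ 16 <= l <= k ^+ 16 -> c * k ^+ 16 <= g ->
  (forall z, `|dot (z *m E) z| <= k ^+ 13 * dot z z) ->
  dot (v *m E) v ^+ 2 <= k ->
  dot (v *m E) (v *m E) <= k ^+ 17 ->
  dot (v *m E *m M) (v *m E *m M) <= k ^+ 33 ->
  `|mu - (l + dot (v *m E) v + dot (v *m E) (v *m E) / l)| <= 17 / c ^+ 4 / k.
Proof.
move=> sM sE v1 vM gap topA /andP[c0 c1] k1 ck /andP[l1 l2] g1 opE.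
set t := dot (v *m E) v; set N1 := dot (v *m E) (v *m E) => t2 hN1 hN2.
have k0 : 0 < k by rewrite (lt_le_trans ltr01).
have kp j : 0 < k ^+ j by rewrite exprn_gt0.
have l0 : 0 < l by rewrite (lt_le_trans _ l1)// mulr_gt0.
have g0 : 0 < g by rewrite (lt_le_trans _ g1)// mulr_gt0.
have [w vE] : exists w, v *m E = t *: v + l *: w.
  exists (l^-1 *: (v *m E - t *: v)).
  by rewrite scalerA mulfV ?gt_eqF// scale1r addrC subrK.
have wv : dot w v = 0.
  have : t = t + l * dot w v by rewrite {1}/t vE !dotE v1 mulr1.
  by rewrite -[X in X = _]addr0 => /addrI/esym/eqP; rewrite mulf_eq0 gt_eqF//= => /eqP.
have lo := perturb_lower sM sE v1 vM l0 topA (ltW (kp 13%N)) opE wv vE.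
have tk : `|t| <= k.
  rewrite -ler_sqr ?nnegrE ?normr_ge0//; last exact: ltW.
  by rewrite real_normK ?num_real// (le_trans t2)// expr2 ler_peMl// ltW.
have eg : 4 * (k ^+ 13 + `|t|) <= g.
  apply: le_trans g1; apply: (@le_trans _ _ (8 * k ^+ 13)).
    have : `|t| <= k ^+ 13 by rewrite (le_trans tk)// ler_eXnr.
    lra.
  by rewrite (_ : 16 = 3 + 13)%N// exprD mulrA ler_wpM2r// ltW.
have up := perturb_upper sM sE v1 vM l0 g0 gap topA (ltW (kp 13%N)) opE wv vE eg.
set q := dot w w in lo up; set h := dot (w *m M) (w *m M) in lo up.
set b := `|dot (w *m M) w| in lo up.
have N1E : N1 = t ^+ 2 + l ^+ 2 * q.
  by rewrite /N1 vE !dotE v1 (dotC v) wv -/q; ring.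
have q0 : 0 <= q by exact: dot_ge0.
have h0 : 0 <= h by exact: dot_ge0.
(* In terms of [i] and [C] every error is bounded by a monomial; [kiE] cancels powers of k, and [CX]
   weakens all monomials to the common one [C ^+ 4 * i]. *)
pose i := k^-1; pose C := c^-1.
have i0 : 0 < i by rewrite invr_gt0.
have i1 : i <= 1 by rewrite invf_le1.
have C1 : 1 <= C by rewrite invf_ge1.
have C0 : 0 < C by rewrite (lt_le_trans ltr01).
have ki : k * i = 1 by rewrite mulfV// gt_eqF.
have cC : c * C = 1 by rewrite mulfV// gt_eqF.
have kiE a d : k ^+ a * i ^+ (a + d) = i ^+ d by rewrite exprD mulrA -exprMn ki expr1n mul1r.
have eqle (x z : R) : x = z -> x <= z by move=> ->.
have mon a : (0 < a)%N -> i ^+ a <= i by move=> a0; apply: ler_iXnr => //; exact: ltW.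
have ip a : 0 <= i ^+ a by rewrite exprn_ge0// ltW.
have Cp a : (a <= 4)%N -> 0 <= C ^+ a <= C ^+ 4.
  by move=> a4; rewrite exprn_ge0 ?(ltW C0)//= ler_weXn2l.
have CX a d x z : (a <= 4)%N -> (0 < d)%N -> 0 <= z -> x <= z * (C ^+ a * i ^+ d) ->
    x <= z * (C ^+ 4 * i).
  move=> a4 d0 z0 /le_trans; apply; rewrite ler_wpM2l//.
  have /andP[? ?] := Cp _ a4.
  by apply: ler_pM => //; exact: mon.
have inv_le x : 0 < x -> c * k ^+ 16 <= x -> x^-1 <= C * i ^+ 16.
  move=> x0 hx; rewrite /C /i exprVn -invfM lef_pV2// posrE// mulr_gt0//.
have L1 := inv_le _ l0 l1; have G1 := inv_le _ g0 g1.
have L0 : 0 <= l^-1 by rewrite invr_ge0 ltW.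
have qle : q <= C ^+ 2 * i ^+ 15.
  have qE : q = (N1 - t ^+ 2) * (l^-1 * l^-1) by rewrite N1E; field; rewrite gt_eqF.
  rewrite qE; apply: (@le_trans _ _ (k ^+ 17 * (C * i ^+ 16 * (C * i ^+ 16)))).
    apply: le_trans (_ : k ^+ 17 * (l^-1 * l^-1) <= _).
      by rewrite ler_wpM2r ?mulr_ge0// lerBlDr ler_wpDr ?sqr_ge0.
    by rewrite ler_wpM2l ?(ltW (kp _))// ler_pM.
  by rewrite -(kiE 17%N 15%N); apply: eqle; ring.
have hle : h <= 4 * (C ^+ 2 * k).
  have vEM : v *m E *m M = (t * l) *: v + l *: (w *m M).
    by rewrite vE mulmxDl -!scalemxAl vM scalerA.
  have hE : l ^+ 2 * h <= 2 * k ^+ 33 + 2 * (t ^+ 2 * l ^+ 2).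
    apply: (@le_trans _ _ (2 * dot (v *m E *m M) (v *m E *m M) + 2 * (t ^+ 2 * l ^+ 2)));
      last by rewrite lerD2r ler_pM2l.
    (* The vector is the sum of [v *m E *m M] and t l v, so this is |x - y|^2 <= 2 |x|^2 + 2
       |y|^2. *)
    have := dot_ge0 (2 * (t * l) *: v + l *: (w *m M)).
    rewrite vEM !dotE v1 (dotC (w *m M) v) -/h; lra.
  have : h <= 2 * (k ^+ 33 * (l^-1 * l^-1)) + 2 * t ^+ 2.
    rewrite -(ler_pM2l (exprn_gt0 2 l0)); apply: le_trans hE _.
    by rewrite le_eqVlt; apply/orP; left; apply/eqP; field; rewrite gt_eqF.
  move=> /le_trans; apply.
  apply: (@le_trans _ _ (2 * (k ^+ 33 * (C * i ^+ 16 * (C * i ^+ 16))) + 2 * k)).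
    by rewrite lerD// ler_pM2l// ler_wpM2l ?(ltW (kp _))// ler_pM.
  have -> : k ^+ 33 * (C * i ^+ 16 * (C * i ^+ 16)) = C ^+ 2 * k.
    by rewrite -[RHS]mulr1 -(expr0 i) -(kiE 32%N 0%N); ring.
  have : 1 * k <= C ^+ 2 * k by rewrite ler_pM2r// expr2 mulr_ege1.
  rewrite mul1r; lra.
have bq : b <= 5 / 2 * (C ^+ 2 * i ^+ 7).
  (* The weight k^8 balances |w|^2 of order k^-15 against |w M|^2 of order k: both products have
     order k^-7. *)
  have := dot_AMGM w (w *m M) (kp 8%N); rewrite (dotC w) -/b -/q -/h => hb.
  have : k ^+ 8 * q <= C ^+ 2 * i ^+ 7.
    by rewrite -(kiE 8%N 7%N) mulrCA ler_pM2l.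
  have : (k ^+ 8)^-1 * h <= 4 * (C ^+ 2 * i ^+ 7).
    rewrite -exprVn -/i mulrC; apply: (le_trans (ler_wpM2r (ip 8%N) hle)).
    by rewrite -!mulrA -(kiE 1%N 7%N) expr1.
  lra.
have hg : 2 * h / g <= 8 * (C ^+ 3 * i ^+ 15).
  apply: (@le_trans _ _ (2 * (4 * (C ^+ 2 * k)) * (C * i ^+ 16))).
    by rewrite ler_pM ?mulr_ge0 ?ler_pM2l// invr_ge0; exact: ltW.
  by rewrite -(kiE 1%N 15%N) expr1; apply: eqle; ring.
have he : (k ^+ 13 + `|t|) * q <= 2 * (C ^+ 2 * i ^+ 2).
  have : `|t| <= k ^+ 13 by rewrite (le_trans tk)// ler_eXnr.
  move=> tk13; apply: (@le_trans _ _ (2 * k ^+ 13 * (C ^+ 2 * i ^+ 15))).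
    by apply: ler_pM => //; [rewrite addr_ge0// ltW|lra].
  by rewrite -(kiE 13%N 2%N); apply: eqle; ring.
(* The only term with the fourth power of 1/c; it dictates the power of [c] in the conclusion. *)
have hlq : l * q ^+ 2 <= 1 * (C ^+ 4 * i ^+ 14).
  apply: (@le_trans _ _ (k ^+ 16 * (C ^+ 2 * i ^+ 15) ^+ 2)).
    apply: ler_pM => //; [exact: ltW|exact: sqr_ge0|].
    by rewrite !expr2 ler_pM.
  by rewrite -(kiE 16%N 14%N); apply: eqle; ring.
have htl : t ^+ 2 * l^-1 <= 1 * (C ^+ 1 * i ^+ 15).
  apply: (@le_trans _ _ (k * (C * i ^+ 16))); first by rewrite ler_pM ?sqr_ge0.
  by rewrite -(kiE 1%N 15%N); apply: eqle; ring.
have Xbq : b <= 5 / 2 * (C ^+ 4 * i) by apply: CX bq.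
have Xhg : 2 * h / g <= 8 * (C ^+ 4 * i) by apply: CX hg.
have Xhe : (k ^+ 13 + `|t|) * q <= 2 * (C ^+ 4 * i) by apply: CX he.
have Xhlq : l * q ^+ 2 <= 1 * (C ^+ 4 * i) by apply: CX hlq.
have Xhtl : t ^+ 2 * l^-1 <= 1 * (C ^+ 4 * i) by apply: CX htl.
have X0 : 0 <= C ^+ 4 * i by rewrite mulr_ge0 ?exprn_ge0 ?ltW.
have tl0 : 0 <= t ^+ 2 * l^-1 by rewrite mulr_ge0 ?sqr_ge0.
have lqE : N1 / l = l * q + t ^+ 2 * l^-1 by rewrite N1E; field; rewrite gt_eqF.
rewrite -(exprVn c) -/C -/i -mulrA lqE ler_norml.
by apply/andP; split; lra.
Qed.

End RealSymmetric.

(** * Fluctuation of the top eigenvalue of a random graph *)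

Section Noise.
Context {R : realType}.
Variables (n : nat) (S : 'M[R]_n).
Hypothesis sS : S^T = S.
Hypothesis S0 : forall i, S i i = 0.
Hypothesis S01 : forall i j, 0 <= S i j <= 1.

Notation edge := ('I_n * 'I_n)%type.
Implicit Types (w : {ffun edge -> bool}) (v z : 'rV[R]_n).

(** All ordered pairs serve as coordinates, so that the calculus on finite products applies
    directly; pairs that are not increasing get probability 0 and thus carry no randomness. *)
Definition edge_prob (e : edge) : R := if (e.1 < e.2)%N then S e.1 e.2 else 0.

Definition edge_of (i j : 'I_n) : edge := if (i < j)%N then (i, j) else (j, i).

Definition sym_mx (f : edge -> R) : 'M[R]_n :=
  \matrix_(i, j) (if i == j then 0 else f (edge_of i j)).

Definition noise w := sym_mx (fun e => eps edge_prob e w).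

Definition graph_mx w := sym_mx (fun e => (w e)%:R).

Local Notation bexp := (bexp edge_prob).

Lemma edge_prob01 e : 0 <= edge_prob e <= 1.
Proof. by rewrite /edge_prob; case: ifP => _ //; rewrite lexx ler01. Qed.

Lemma edge_ofC i j : edge_of i j = edge_of j i.
Proof.
rewrite /edge_of; case: ltngtP => //= ij.
by have -> : i = j by exact: val_inj.
Qed.

Lemma edge_of_eq i j k l : edge_of i j = edge_of k l ->
  (i = k /\ j = l) \/ (i = l /\ j = k).
Proof. by rewrite /edge_of; case: ifP; case: ifP => _ _ [-> ->]; auto. Qed.

Lemma sym_mx_sym f : (sym_mx f)^T = sym_mx f.
Proof. by apply/matrixP => i j; rewrite !mxE eq_sym edge_ofC. Qed.

Lemma edge_prob_of i j : i != j -> edge_prob (edge_of i j) = S i j.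
Proof.
move=> ij; rewrite /edge_of; case: ifP => [h|/negbT h]; rewrite /edge_prob/= ?h//.
have -> : (j < i)%N by rewrite ltn_neqAle leqNgt h andbT eq_sym.
by rewrite -[in LHS]sS mxE.
Qed.

Lemma graph_mx_noise w : graph_mx w = S + noise w.
Proof.
apply/matrixP => i j; rewrite !mxE; have [->|ij] := eqVneq i j.
  by rewrite S0 addr0.
by rewrite /eps edge_prob_of// addrC subrK.
Qed.

Lemma noise_norm w i j : `|noise w i j| <= 1.
Proof.
rewrite mxE; case: eqP => _; first by rewrite normr0 ler01.
exact: eps_norm edge_prob01 _ _.
Qed.

Lemma sum_edges (f : 'I_n -> 'I_n -> R) :
  \sum_(e : edge) (if (e.1 < e.2)%N then f e.1 e.2 + f e.2 e.1 else 0) =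
  \sum_i \sum_(j | j != i) f i j.
Proof.
have E : \sum_i \sum_(j | j != i) f i j =
  \sum_(i : 'I_n) \sum_(j : 'I_n | (i < j)%N) f i j +
  \sum_(i : 'I_n) \sum_(j : 'I_n | (j < i)%N) f i j.
  rewrite -big_split; apply: eq_bigr => i _ /=.
  rewrite (bigID (fun j : 'I_n => (i < j)%N))/=; congr (_ + _); apply: eq_bigl => j.
    by case: ltngtP; rewrite ?andbT ?andbF// => h; apply/eqP => ij; rewrite ij ltnn in h.
  case: (ltngtP i j) => h; rewrite ?andbT ?andbF//.
    by apply/eqP => ij; rewrite ij ltnn in h.
  by apply/eqP => /=; apply/val_inj.
rewrite E [X in _ + X](exchange_big_dep xpredT)//= -big_split/=.
rewrite -(pair_bigA _ (fun i j : 'I_n => if (i < j)%N then f i j + f j i else 0))/=.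
apply: eq_bigr => i _; rewrite -big_split/= [RHS]big_mkcond.
by apply: eq_bigr => j _.
Qed.

Lemma edge_of_lt i j : i != j -> ((edge_of i j).1 < (edge_of i j).2)%N.
Proof.
move=> ij; rewrite /edge_of; case: ifP => //= /negbT h.
by rewrite ltn_neqAle leqNgt h andbT eq_sym.
Qed.

Lemma noise_upd_free (e : edge) (b : bool) w : ~~ (e.1 < e.2)%N -> noise (upd e b w) = noise w.
Proof.
move=> ne; apply/matrixP => i j; rewrite !mxE; case: eqVneq => // ij.
rewrite /eps upd_other//; apply: contraNneq ne => <-; exact: edge_of_lt.
Qed.

Lemma noise_entry i j w : i != j -> noise w i j = eps edge_prob (edge_of i j) w.
Proof. by rewrite mxE => /negPf ->. Qed.

Lemma noise_diag i w : noise w i i = 0.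
Proof. by rewrite mxE eqxx. Qed.

Lemma noise_free e i j : edge_of i j != e -> free_of e (fun w => noise w i j).
Proof.
by move=> ije b w; rewrite !mxE; case: eqVneq => // _; rewrite /eps upd_other.
Qed.

(** The entry is a sum over paths a - k - b. Two distinct paths share no edge, since a and b differ,
    so their contributions are uncorrelated and only n squares bounded by 1 survive. Paths passing
    through a diagonal entry vanish. *)
Lemma bexp_noise_sqr_entry a b : a != b ->
  bexp (fun w => (noise w *m noise w) a b ^+ 2) <= n%:R.
Proof.
move=> ab; pose X k w := noise w a k * noise w k b.
have XE w : (noise w *m noise w) a b = \sum_k X k w by rewrite mxE.
have X2 k w : X k w ^+ 2 <= 1.
  rewrite -real_normK ?num_real// normrM exprn_ile1// ?mulr_ge0//.
  by rewrite mulr_ile1// noise_norm.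
have XX k l : k != l -> bexp (fun w => X k w * X l w) = 0.
  move=> kl.
  have Z : (forall w, X k w * X l w = 0) -> bexp (fun w => X k w * X l w) = 0.
    by move=> h; rewrite (eq_bexp _ h) bexp_cst.
  have [ka|ka] := eqVneq k a.
    by apply: Z => w; rewrite /X ka noise_diag !mul0r.
  have [kb|kb] := eqVneq k b.
    by apply: Z => w; rewrite /X kb noise_diag mulr0 mul0r.
  have [la|la] := eqVneq l a.
    by apply: Z => w; rewrite /X la noise_diag mul0r mulr0.
  have [lb|lb] := eqVneq l b.
    by apply: Z => w; rewrite /X lb noise_diag !mulr0.
  have ak : a != k by rewrite eq_sym.
  pose g w := noise w k b * X l w.
  rewrite (@eq_bexp _ _ edge_prob _ (fun w => eps edge_prob (edge_of a k) w * g w)).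
    apply: bexp_eps => // c w; rewrite /g /X !noise_free//.
    - by apply/eqP => /edge_of_eq[[h _]|[h _]]; [case/negP: la|case/negP: kl]; rewrite h.
    - by apply/eqP => /edge_of_eq[[_ h]|[_ h]]; [case/negP: kl|case/negP: la]; rewrite h.
    - by apply/eqP => /edge_of_eq[[h _]|[_ h]]; [case/negP: ka|case/negP: ab]; rewrite h.
  by move=> w; rewrite -(noise_entry w ak) /g /X !mulrA.
rewrite (@eq_bexp _ _ edge_prob _ (fun w => \sum_k \sum_l X k w * X l w)); last first.
  by move=> w; rewrite XE expr2 mulr_suml; apply: eq_bigr => k _; rewrite mulr_sumr.
rewrite bexp_sum; apply: (@le_trans _ _ (\sum_(k < n) 1)); last first.
  by rewrite sumr_const card_ord.
apply: ler_sum => k _; rewrite bexp_sum (bigD1 k)//= big1 ?addr0.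
  rewrite -[leRHS](bexp_cst edge_prob) ler_bexp//; first exact: edge_prob01.
  by move=> w; rewrite -expr2.
by move=> l lk; apply: XX; rewrite eq_sym.
Qed.

(** The sum is the trace of the fourth power of the noise. The n diagonal entries of the square are
    at most n in absolute value, the others have mean square at most n: each kind contributes
    n^3. *)
Lemma bexp_noise_sqr :
  bexp (fun w => \sum_a \sum_b (noise w *m noise w) a b ^+ 2) <= 2 * n%:R ^+ 3.
Proof.
have [n0|n0] := posnP n.
  rewrite (@eq_bexp _ _ edge_prob _ (fun=> 0)); first by rewrite bexp_cst mulr_ge0.
  by move=> w; apply: big1 => -[a an]; exfalso; rewrite n0 in an.
rewrite bexp_sum.
have diag a : bexp (fun w => (noise w *m noise w) a a ^+ 2) <= n%:R ^+ 2.
  rewrite -[leRHS](bexp_cst edge_prob) ler_bexp//; first exact: edge_prob01.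
  move=> w; rewrite -real_normK ?num_real// ler_pXn2r ?nnegrE// mxE.
  apply: (@le_trans _ _ (\sum_(k < n) 1)); last by rewrite sumr_const card_ord.
  apply: le_trans (ler_norm_sum _ _ _) _; apply: ler_sum => k _.
  by rewrite normrM mulr_ile1// noise_norm.
apply: (@le_trans _ _ (\sum_(a < n) (n%:R ^+ 2 + n%:R ^+ 2))); last first.
  rewrite sumr_const card_ord -[leLHS]mulr_natr; lra.
apply: ler_sum => a _; rewrite bexp_sum (bigD1 a)//=; apply: lerD => //.
apply: (@le_trans _ _ (\sum_(b < n) n%:R)); last first.
  by rewrite sumr_const card_ord -[leLHS]mulr_natr expr2.
rewrite big_mkcond/=; apply: ler_sum => b _.
by case: ifP => // ba; apply: bexp_noise_sqr_entry; rewrite eq_sym.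
Qed.

(** The trace method at the fourth power, stated on quadratic forms: Cauchy-Schwarz twice passes
    from z E z^T to z E^2, whose norm is bounded by the Frobenius norm of E^2. *)
Lemma noise_op w z :
  dot (z *m noise w) z ^+ 4 <=
  dot z z ^+ 4 * \sum_a \sum_b (noise w *m noise w) a b ^+ 2.
Proof.
set E := noise w; set F := \sum_a _.
have h1 := dot_CS (z *m E) z.
have sE : E^T = E by exact: sym_mx_sym.
have h2 : dot (z *m E) (z *m E) ^+ 2 <= dot (z *m (E *m E)) (z *m (E *m E)) * dot z z.
  by rewrite -(dot_sym _ _ sE) -mulmxA dot_CS.
have h3 : dot (z *m (E *m E)) (z *m (E *m E)) <= dot z z * F.
  rewrite /F exchange_big mulr_sumr; apply: ler_sum => b _.
  have := dot_CS z (\row_a (E *m E) a b).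
  rewrite -expr2 mxE (_ : dot z (\row_a _) = \sum_a z 0 a * (E *m E) a b); last first.
    by apply: eq_bigr => a _; rewrite mxE.
  move=> /le_trans; apply; rewrite le_eqVlt; apply/orP; left; apply/eqP; congr (_ * _).
  by apply: eq_bigr => a _; rewrite mxE expr2.
have z0 := dot_ge0 z.
have F0 : 0 <= F by apply: sumr_ge0 => a _; apply: sumr_ge0 => b _; exact: sqr_ge0.
set x := dot (z *m E) z in h1 *; set y := dot (z *m E) (z *m E) in h1 h2.
have y0 : 0 <= y by exact: dot_ge0.
have -> : x ^+ 4 = (x ^+ 2) ^+ 2 by ring.
apply: (@le_trans _ _ ((y * dot z z) ^+ 2)).
  by rewrite ler_pXn2r ?nnegrE ?sqr_ge0 ?mulr_ge0.
rewrite exprMn (_ : dot z z ^+ 4 * F = dot z z * F * dot z z * dot z z ^+ 2); last by ring.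
rewrite ler_wpM2r ?sqr_ge0//; apply: le_trans h2 _.
by rewrite ler_wpM2r.
Qed.

Definition form_coef (B : 'I_n -> 'I_n -> R) (e : edge) : R :=
  if (e.1 < e.2)%N then B e.1 e.2 + B e.2 e.1 else 0.

Lemma noise_form (B : 'I_n -> 'I_n -> R) w :
  \sum_i \sum_j B i j * noise w i j = \sum_e form_coef B e * eps edge_prob e w.
Proof.
have -> : \sum_i \sum_j B i j * noise w i j =
    \sum_i \sum_(j | j != i) B i j * noise w i j.
  apply: eq_bigr => i _; rewrite (bigD1 i)//= mxE eqxx mulr0 add0r//.
rewrite -sum_edges; apply: eq_bigr => -[i j] _; rewrite /form_coef/=.
case: ifP => ij; last by rewrite mul0r.
rewrite !mxE edge_ofC; have -> : (j == i) = false.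
  by apply/eqP => ji; rewrite ji ltnn in ij.
by rewrite eq_sym; case: eqP => [h|_]; [rewrite h ltnn in ij|rewrite -mulrDl /edge_of (ltnNge j) (ltnW ij)].
Qed.

Lemma form_coef_sqr (B : 'I_n -> 'I_n -> R) :
  \sum_e form_coef B e ^+ 2 <= 2 * \sum_i \sum_j B i j ^+ 2.
Proof.
apply: (@le_trans _ _ (\sum_(e : edge) (if (e.1 < e.2)%N
    then 2 * B e.1 e.2 ^+ 2 + 2 * B e.2 e.1 ^+ 2 else 0))).
  apply: ler_sum => -[i j] _; rewrite /form_coef/=; case: ifP => _; last by rewrite expr0n.
  rewrite -subr_ge0 (_ : _ - _ = (B i j - B j i) ^+ 2) ?sqr_ge0//; ring.
rewrite (sum_edges (fun i j => 2 * B i j ^+ 2)) mulr_sumr; apply: ler_sum => i _.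
rewrite mulr_sumr [leRHS](bigD1 i)//= lerDr mulr_ge0// sqr_ge0//.
Qed.

Lemma bexp_form_sqr_le (B : 'I_n -> 'I_n -> R) :
  bexp (fun w => (\sum_i \sum_j B i j * noise w i j) ^+ 2) <=
  2 * \sum_i \sum_j B i j ^+ 2.
Proof.
under eq_bexp do rewrite noise_form.
exact: le_trans (bexp_lin_sqr_le edge_prob01 _) (form_coef_sqr _).
Qed.

Section UnitVector.
Variable v : 'rV[R]_n.
Hypothesis v1 : dot v v = 1.

Lemma sum_sqr_unit : \sum_i v 0 i ^+ 2 = 1.
Proof. by rewrite -v1; apply: eq_bigr => i _; rewrite expr2. Qed.

Lemma quad_form w :
  dot (v *m noise w) v = \sum_e form_coef (fun i j => v 0 i * v 0 j) e * eps edge_prob e w.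
Proof.
rewrite -noise_form dot_mulmx; apply: eq_bigr => i _; apply: eq_bigr => j _.
by rewrite mulrAC.
Qed.

Lemma bexp_quad_le : bexp (fun w => dot (v *m noise w) v ^+ 2) <= 2.
Proof.
have := bexp_form_sqr_le (fun i j => v 0 i * v 0 j).
rewrite (_ : \sum_i _ = 1) ?mulr1; last first.
  under eq_bigr do (under eq_bigr do rewrite exprMn; rewrite -mulr_sumr sum_sqr_unit mulr1).
  exact: sum_sqr_unit.
apply: le_trans; rewrite le_eqVlt; apply/orP; left; apply/eqP.
by apply: eq_bexp => w; rewrite quad_form noise_form.
Qed.

Definition mean_sqr : R := \sum_a \sum_(i | i != a) v 0 i ^+ 2 * (S i a * (1 - S i a)).

Lemma bexp_vE : bexp (fun w => dot (v *m noise w) (v *m noise w)) = mean_sqr.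
Proof.
rewrite /dot bexp_sum; apply: eq_bigr => a _.
pose B i j := v 0 i * (j == a)%:R.
have vEa w : (v *m noise w) 0 a = \sum_e form_coef B e * eps edge_prob e w.
  rewrite -noise_form mxE; apply: eq_bigr => i _.
  rewrite (bigD1 a)//= big1 ?addr0 => [|j ja]; first by rewrite /B eqxx mulr1.
  by rewrite /B (negPf ja) mulr0 mul0r.
under eq_bexp do rewrite vEa.
rewrite bexp_linM.
transitivity (\sum_i \sum_(j | j != i) v 0 i ^+ 2 * (j == a)%:R * (S i j * (1 - S i j))).
  rewrite -sum_edges; apply: eq_bigr => -[i j] _; rewrite /form_coef/= /edge_prob/=.
  case: ifP => ij; last by rewrite !mul0r.
  have -> : S j i = S i j by rewrite -[in LHS]sS mxE.
  rewrite /B; have [ja|ja] := eqVneq j a; last first.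
    by have [ia|ia] := eqVneq i a => /=; ring.
  have -> : (i == a) = false by apply/eqP => ia; rewrite ia ja ltnn in ij.
  by rewrite /=; ring.
rewrite (exchange_big_dep xpredT)//= (bigD1 a)//= [X in _ + X]big1 ?addr0.
  by rewrite eqxx; under eq_bigl do rewrite eq_sym; under eq_bigr do rewrite mulr1.
by move=> j ja; apply: big1 => i _; rewrite (negPf ja) mulr0 mul0r.
Qed.

Lemma quad_var : \sum_e form_coef (fun i j => v 0 i * v 0 j) e ^+ 2
    * (edge_prob e * (1 - edge_prob e)) =
  2 * \sum_i \sum_(j | j != i) v 0 i ^+ 2 * v 0 j ^+ 2 * (S i j * (1 - S i j)).
Proof.
transitivity (\sum_i \sum_(j | j != i)
    2 * (v 0 i ^+ 2 * v 0 j ^+ 2 * (S i j * (1 - S i j)))).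
  rewrite -sum_edges; apply: eq_bigr => -[i j] _; rewrite /form_coef/= /edge_prob/=.
  case: ifP => ij; last by rewrite !mul0r mulr0.
  have -> : S j i = S i j by rewrite -[in LHS]sS mxE.
  ring.
by rewrite mulr_sumr; apply: eq_bigr => i _; rewrite mulr_sumr.
Qed.

Lemma form_coef_quad_le (r : R) : (forall i, v 0 i ^+ 2 <= r) -> forall e,
  `|form_coef (fun i j => v 0 i * v 0 j) e| <= 2 * r.
Proof.
move=> vr [i j]; rewrite /form_coef/=; case: ifP => _; last first.
  by rewrite normr0 mulr_ge0// (le_trans _ (vr i)) ?sqr_ge0.
have := vr i; have := vr j.
have := sqr_ge0 (v 0 i - v 0 j); have := sqr_ge0 (v 0 i + v 0 j).
by rewrite ler_norml => *; apply/andP; split; lra.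
Qed.

(** Supplies the bound on coefficients asked by [lindeberg_swap]: 2 |v_i v_j| <= v_i^2 + v_j^2 <= 1
    for distinct i and j. *)
Lemma form_coef_quad_le1 e : `|form_coef (fun i j => v 0 i * v 0 j) e| <= 1.
Proof.
case: e => i j; rewrite /form_coef/=; case: ifP => ij; last by rewrite normr0 ler01.
have : v 0 i ^+ 2 + v 0 j ^+ 2 <= 1.
  rewrite -sum_sqr_unit (bigD1 i)//= lerD2l (bigD1 j)/=; last first.
    by apply/eqP => ji; rewrite ji ltnn in ij.
  by rewrite lerDl sumr_ge0// => k _; rewrite sqr_ge0.
have := sqr_ge0 (v 0 i - v 0 j); have := sqr_ge0 (v 0 i + v 0 j).
by rewrite ler_norml => *; apply/andP; split; lra.
Qed.

(** The Lyapunov condition: one factor is bounded by 2 r, where [r] measures the delocalization of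
    [v], and the squares of the other two factors sum to at most 2. *)
Lemma sum_form_coef_cube_le (r : R) : 0 <= r -> (forall i, v 0 i ^+ 2 <= r) ->
  \sum_e `|form_coef (fun i j => v 0 i * v 0 j) e| ^+ 3 <= 4 * r.
Proof.
move=> r0 vr; have := form_coef_sqr (fun i j => v 0 i * v 0 j).
have -> : \sum_i \sum_j (v 0 i * v 0 j) ^+ 2 = 1.
  under eq_bigr do (under eq_bigr do rewrite exprMn; rewrite -mulr_sumr sum_sqr_unit mulr1).
  exact: sum_sqr_unit.
set c := form_coef _ => hc.
apply: (@le_trans _ _ (2 * r * \sum_e c e ^+ 2)); last first.
  by apply: le_trans (ler_wpM2l _ hc) _; [rewrite mulr_ge0|lra].
rewrite mulr_sumr; apply: ler_sum => e _.
rewrite exprS real_normK ?num_real// ler_wpM2r ?sqr_ge0//.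
exact: form_coef_quad_le.
Qed.

(** Each of the n coordinates is a linear form in the noise with coefficients v_i S_jk, whose
    squares sum to at most n. *)
Lemma bexp_vEM : (forall i j, `|S i j| <= 1) ->
  bexp (fun w => dot (v *m noise w *m S) (v *m noise w *m S)) <= 2 * n%:R ^+ 2.
Proof.
move=> Sn; rewrite /dot bexp_sum.
apply: (@le_trans _ _ (\sum_(k < n) 2 * n%:R)); last first.
  by rewrite sumr_const card_ord -[leLHS]mulr_natr -mulrA -expr2.
apply: ler_sum => k _.
have Ek w : (v *m noise w *m S) 0 k = \sum_i \sum_j v 0 i * S j k * noise w i j.
  rewrite exchange_big mxE; apply: eq_bigr => j _; rewrite mxE mulr_suml.
  by apply: eq_bigr => i _; rewrite mulrAC.
rewrite (@eq_bexp _ _ edge_prob _ (fun w => (\sum_i \sum_j v 0 i * S j k * noise w i j) ^+ 2));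
  last by move=> w; rewrite Ek expr2.
apply: le_trans (bexp_form_sqr_le _) _; rewrite ler_pM2l//.
rewrite exchange_big; apply: (@le_trans _ _ (\sum_(j < n) 1)); last first.
  by rewrite sumr_const card_ord.
apply: ler_sum => j _; under eq_bigr do rewrite exprMn.
rewrite -mulr_suml sum_sqr_unit mul1r -real_normK ?num_real//.
by rewrite exprn_ile1.
Qed.

Lemma mean_sqr_bound : 0 <= mean_sqr <= n%:R.
Proof.
have var01 i j : 0 <= S i j * (1 - S i j) <= 1.
  have /andP[? ?] := S01 i j; rewrite mulr_ge0 ?subr_ge0//=.
  by rewrite mulr_ile1 ?subr_ge0// lerBlDr lerDl.
apply/andP; split.
  apply: sumr_ge0 => a _; apply: sumr_ge0 => i _; rewrite mulr_ge0 ?sqr_ge0//.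
  by case/andP: (var01 i a).
apply: (@le_trans _ _ (\sum_(a < n) 1)); last by rewrite sumr_const card_ord.
apply: ler_sum => a _; rewrite -[leRHS]sum_sqr_unit big_mkcond/=; apply: ler_sum => i _.
have /andP[? ?] := var01 i a.
by case: ifP => _; rewrite ?sqr_ge0// ler_piMr ?sqr_ge0.
Qed.

Lemma noise_upd (i j : 'I_n) (b : bool) w : (i < j)%N ->
  noise (upd (i, j) b w) =
  noise w + (b%:R - (w (i, j))%:R) *: (delta_mx i j + delta_mx j i).
Proof.
move=> ij; have nij : i != j by apply/eqP => h; rewrite h ltnn in ij.
apply/matrixP => k l; rewrite !mxE; have [<-|kl] := eqVneq k l.
  have [->|ki] := eqVneq k i; first by rewrite (negPf nij)/= addr0 mulr0 addr0.
  by rewrite andbF/= addr0 mulr0 addr0.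
rewrite /eps ffunE; case: eqP => [E|nE].
  have kl_ij : (k = i /\ l = j) \/ (k = j /\ l = i).
    by apply: edge_of_eq; rewrite E /edge_of ij.
  rewrite E; case: kl_ij => -[-> ->]; rewrite !eqxx.
    by rewrite (negPf nij)/=; ring.
  by rewrite eq_sym (negPf nij)/=; ring.
have -> : ((k == i) && (l == j))%:R + ((k == j) && (l == i))%:R = 0 :> R.
  have -> : (k == i) && (l == j) = false.
    by apply/negP => /andP[/eqP ki /eqP lj]; apply: nE; rewrite /edge_of ki lj ij.
  have -> : (k == j) && (l == i) = false.
    by apply/negP => /andP[/eqP ki /eqP lj]; apply: nE; rewrite edge_ofC /edge_of ki lj ij.
  by rewrite addr0.
by rewrite mulr0 addr0.
Qed.

(** Switching the edge moves [v *m noise w] along the vector u with entries v_i at j and v_j at i,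
    so the difference is 2 (x . u) + (1 - 2 w) |u|^2; the sign in the last term records the state in
    which x was computed. *)
Lemma bdiff_vE (i j : 'I_n) w : (i < j)%N ->
  bdiff (i, j) (fun w => dot (v *m noise w) (v *m noise w)) w =
  2 * (v 0 i * (v *m noise w) 0 j + v 0 j * (v *m noise w) 0 i)
  + (1 - 2 * (w (i, j))%:R) * (v 0 i ^+ 2 + v 0 j ^+ 2).
Proof.
move=> ij; have nij : i != j by apply/eqP => h; rewrite h ltnn in ij.
rewrite /bdiff !noise_upd// !mulmxDr -!scalemxAr.
set x := v *m noise w; set u := v *m (_ + _).
have uE k : u 0 k = v 0 i * (k == j)%:R + v 0 j * (k == i)%:R.
  rewrite /u mulmxDr !mxE; congr (_ + _).
    rewrite (bigD1 i)//= big1 ?addr0 => [|l li]; first by rewrite mxE eqxx.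
    by rewrite mxE (negPf li) mulr0.
  rewrite (bigD1 j)//= big1 ?addr0 => [|l li]; first by rewrite mxE eqxx.
  by rewrite mxE (negPf li) mulr0.
have dotu y : dot y u = v 0 i * y 0 j + v 0 j * y 0 i.
  rewrite /dot; under eq_bigr do rewrite uE mulrDr.
  rewrite big_split/= (bigD1 j)//= [X in _ + X + _]big1 => [|k kj]; last first.
    by rewrite (negPf kj) !mulr0.
  rewrite (bigD1 i)//= [X in _ + (_ + X)]big1 => [|k kj]; last first.
    by rewrite (negPf kj) !mulr0.
  by rewrite !eqxx/=; ring.
rewrite !dotE (dotC u x) !dotu !uE !eqxx (negPf nij) eq_sym (negPf nij)/=.
ring.
Qed.

(** By Efron-Stein the variance is at most the mean of 16 |vE|^2 + 4 n, hence at most 20 n because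
    |vE|^2 has mean at most n. After division by an eigenvalue of order n, the fluctuation is
    negligible. *)
Lemma bexp_vE_var :
  bexp (fun w => (dot (v *m noise w) (v *m noise w) - mean_sqr) ^+ 2) <= 20 * n%:R.
Proof.
set f := fun w => dot (v *m noise w) (v *m noise w).
have Ef : bexp f = mean_sqr by exact: bexp_vE.
have -> : bexp (fun w => (f w - mean_sqr) ^+ 2) = bexp (fun w => f w ^+ 2) - bexp f ^+ 2.
  rewrite (@eq_bexp _ _ edge_prob _ (fun w => f w ^+ 2 + (-2 * mean_sqr * f w + mean_sqr ^+ 2)));
    last by move=> w; ring.
  by rewrite !bexpD bexpZ bexp_cst -Ef; ring.
apply: le_trans (efron_stein edge_prob01 f) _; rewrite -bexp_sum.
apply: (@le_trans _ _ (bexp (fun w => 16 * f w + 4 * n%:R))); last first.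
  rewrite bexpD bexpZ bexp_cst Ef; have /andP[_] := mean_sqr_bound.
  by rewrite -(ler_pM2l (_ : 0 < 16))//; lra.
apply: (ler_bexp edge_prob01) => w; set x := v *m noise w.
apply: (@le_trans _ _ (\sum_(e : edge) (if (e.1 < e.2)%N
   then (16 * (v 0 e.1 ^+ 2 * x 0 e.2 ^+ 2) + 4 * v 0 e.1 ^+ 4) +
        (16 * (v 0 e.2 ^+ 2 * x 0 e.1 ^+ 2) + 4 * v 0 e.2 ^+ 4) else 0))).
  apply: ler_sum => -[i j] _ /=; case: ifP => ij; last first.
    by rewrite /bdiff /f !noise_upd_free ?ij//= subrr expr0n.
  rewrite bdiff_vE// -/x.
  have : (w (i, j))%:R = 0 :> R \/ (w (i, j))%:R = 1 :> R by case: (w _); auto.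
  set a := v 0 i; set b := v 0 j; set c := x 0 i; set d := x 0 j => h.
  (* These squares encode (2 A + B)^2 <= 8 A^2 + 2 B^2 for either sign of B, followed by (x + y)^2
     <= 2 x^2 + 2 y^2 inside A and inside B; hence the factors 16 and 4. *)
  have := sqr_ge0 (a * d - b * c); have := sqr_ge0 (a ^+ 2 - b ^+ 2).
  have := sqr_ge0 (2 * (a * d + b * c) - (a ^+ 2 + b ^+ 2)).
  have := sqr_ge0 (2 * (a * d + b * c) + (a ^+ 2 + b ^+ 2)).
  by case: h => -> *; lra.
rewrite (sum_edges (fun i j => 16 * (v 0 i ^+ 2 * x 0 j ^+ 2) + 4 * v 0 i ^+ 4)).
apply: (@le_trans _ _ (\sum_i \sum_j
    (16 * (v 0 i ^+ 2 * x 0 j ^+ 2) + 4 * v 0 i ^+ 2))).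
  apply: ler_sum => i _; rewrite big_mkcond; apply: ler_sum => j _.
  have vi1 : v 0 i ^+ 2 <= 1.
    by rewrite -sum_sqr_unit (bigD1 i)//= lerDl sumr_ge0// => k _; rewrite sqr_ge0.
  have h1 : 0 <= v 0 i ^+ 2 * x 0 j ^+ 2 by rewrite mulr_ge0 ?sqr_ge0.
  have h2 := sqr_ge0 (v 0 i).
  have h3 : v 0 i ^+ 4 <= v 0 i ^+ 2.
    by rewrite (_ : v 0 i ^+ 4 = v 0 i ^+ 2 * v 0 i ^+ 2) ?ler_piMl//; ring.
  by case: ifP => _; lra.
under eq_bigr do rewrite big_split/=; rewrite big_split/=.
apply: lerD.
  under eq_bigr do (rewrite -mulr_sumr -mulr_sumr).
  rewrite -mulr_sumr -mulr_suml sum_sqr_unit mul1r /f -/x.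
  by under eq_bigr do rewrite expr2.
under eq_bigr do rewrite sumr_const card_ord -[_ *+ _]mulr_natr.
by rewrite -mulr_suml -mulr_sumr sum_sqr_unit mulr1.
Qed.

(** Each of five quantities exceeds its threshold with probability at most a constant over k, and 2
    + 1 + 2 + 2 + 20 = 27. Off these events [top_eig_expansion] applies; replacing |vE|^2 by its
    mean raises its constant 17 to 18. *)
Lemma top_eig_fluctuation (l g c k : R) :
  v *m S = l *: v ->
  (forall z, dot z v = 0 -> dot (z *m S) z <= (l - g) * dot z z) ->
  0 < c <= 1 -> 1 <= k -> 8 <= c * k ^+ 3 -> k ^+ 16 = n%:R ->
  c * k ^+ 16 <= l <= k ^+ 16 -> c * k ^+ 16 <= g ->
  bexp (fun w => (18 / c ^+ 4 / k <
    `|lambda_max (graph_mx w) - l - dot (v *m noise w) v - mean_sqr / l|)%R%:R)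
  <= 27 / k.
Proof.
move=> vS gap c01 k1 ck kn l12 g1.
have k0 : 0 < k by rewrite (lt_le_trans ltr01).
have kp j : 0 < k ^+ j by rewrite exprn_gt0.
have /andP[c0 c1] := c01; have /andP[l1 l2] := l12.
have l0 : 0 < l by rewrite (lt_le_trans _ l1)// mulr_gt0.
pose f1 w := dot (v *m noise w) v ^+ 2.
pose f2 w := dot (v *m noise w) (v *m noise w).
pose f3 w := dot (v *m noise w *m S) (v *m noise w *m S).
pose f4 w := \sum_a \sum_b (noise w *m noise w) a b ^+ 2.
pose f5 w := (f2 w - mean_sqr) ^+ 2.
have f1p w : 0 <= f1 w by exact: sqr_ge0.
have f2p w : 0 <= f2 w by exact: dot_ge0.
have f3p w : 0 <= f3 w by exact: dot_ge0.
have f4p w : 0 <= f4 w by apply: sumr_ge0 => a _; apply: sumr_ge0 => b _; exact: sqr_ge0.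
have f5p w : 0 <= f5 w by exact: sqr_ge0.
have Sn i j : `|S i j| <= 1 by have /andP[? ?] := S01 i j; rewrite ger0_norm.
have tail (f : {ffun edge -> bool} -> R) (a b m : R) : 0 < a -> (forall w, 0 <= f w) ->
    bexp f <= m -> m * k <= b * a -> bexp (fun w => (a < f w)%R%:R) <= b / k.
  move=> a0 fp fm mk; apply: (le_trans (bexp_markov edge_prob01 a0 fp)).
  rewrite ler_pdivrMr// mulrAC ler_pdivlMr//; apply: le_trans mk.
  by rewrite ler_wpM2r// ltW.
have t1 : bexp (fun w => (k < f1 w)%R%:R) <= 2 / k.
  by apply: (tail _ _ _ 2) => //; exact: bexp_quad_le.
have t2 : bexp (fun w => (k ^+ 17 < f2 w)%R%:R) <= 1 / k.
  apply: (tail _ _ _ (k ^+ 16)) => //; last by rewrite mul1r -exprSr.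
  by rewrite bexp_vE kn; case/andP: mean_sqr_bound.
have t3 : bexp (fun w => (k ^+ 33 < f3 w)%R%:R) <= 2 / k.
  apply: (tail _ _ _ (2 * (k ^+ 16) ^+ 2)) => //; last by rewrite -exprM -mulrA -exprSr.
  by rewrite kn; exact: bexp_vEM.
(* The threshold is the fourth power of the operator bound k^13 asked by [top_eig_expansion];
   Markov's inequality uses only 49 of the 52 powers. *)
have t4 : bexp (fun w => (k ^+ 52 < f4 w)%R%:R) <= 2 / k.
  apply: (tail _ _ _ (2 * (k ^+ 16) ^+ 3)) => //.
    by rewrite kn; exact: bexp_noise_sqr.
  by rewrite -exprM -mulrA -exprSr ler_pM2l// ler_weXn2l.
have t5 : bexp (fun w => (k ^+ 17 < f5 w)%R%:R) <= 20 / k.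
  apply: (tail _ _ _ (20 * k ^+ 16)) => //; last by rewrite -mulrA -exprSr.
  by rewrite kn; exact: bexp_vE_var.
apply: (@le_trans _ _ (bexp (fun w => (k < f1 w)%R%:R + ((k ^+ 17 < f2 w)%R%:R +
    ((k ^+ 33 < f3 w)%R%:R + ((k ^+ 52 < f4 w)%R%:R + (k ^+ 17 < f5 w)%R%:R)))))); last first.
  rewrite !bexpD; lra.
apply: (ler_bexp edge_prob01) => w.
have [h1|h1] := ltP k (f1 w).
  by rewrite (@le_trans _ _ 1) ?lern1 ?leq_b1// lerDl !addr_ge0.
have [h2|h2] := ltP (k ^+ 17) (f2 w).
  by rewrite (@le_trans _ _ 1) ?lern1 ?leq_b1// add0r lerDl !addr_ge0.
have [h3|h3] := ltP (k ^+ 33) (f3 w).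
  by rewrite (@le_trans _ _ 1) ?lern1 ?leq_b1// !add0r lerDl !addr_ge0.
have [h4|h4] := ltP (k ^+ 52) (f4 w).
  by rewrite (@le_trans _ _ 1) ?lern1 ?leq_b1// !add0r lerDl.
have [h5|h5] := ltP (k ^+ 17) (f5 w).
  by rewrite (@le_trans _ _ 1) ?lern1 ?leq_b1// !add0r.
rewrite !addr0 ltNge; suff -> : `|lambda_max (graph_mx w) - l
  - dot (v *m noise w) v - mean_sqr / l| <= 18 / c ^+ 4 / k by [].
have [m [y ym]] : exists m y, top_eigenpair (graph_mx w) m y.
  apply: ex_top_eigenpair_gt0; last exact: sym_mx_sym.
  by rewrite -(ltr0n R) -kn.
rewrite (lambda_max_eq ym); move: ym; rewrite graph_mx_noise => ym.
have k0' := ltW k0.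
have opE z : `|dot (z *m noise w) z| <= k ^+ 13 * dot z z.
  rewrite -(ler_pXn2r (n := 4))// ?nnegrE ?normr_ge0 ?mulr_ge0 ?dot_ge0 ?(ltW (kp _))//.
  rewrite -normrX ger0_norm ?exprn_even_ge0//; apply: le_trans (noise_op _ _) _.
  by rewrite exprMn mulrC -exprM ler_wpM2r// exprn_ge0 ?dot_ge0.
have H := top_eig_expansion sS (sym_mx_sym _) v1 vS gap ym c01 k1 ck l12 g1 opE h1 h2 h3.
have f2m : `|f2 w - mean_sqr| <= k ^+ 9.
  rewrite -ler_sqr ?nnegrE ?normr_ge0 ?(ltW (kp _))// real_normK ?num_real//.
  by rewrite (le_trans h5)// -exprM ler_weXn2l.
have f2l : `|f2 w / l - mean_sqr / l| <= 1 / c ^+ 4 / k.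
  rewrite -mulrBl normrM (gtr0_norm (_ : 0 < l^-1)) ?invr_gt0// ler_pdivrMr//.
  apply: (le_trans f2m); apply: (@le_trans _ _ (1 / c ^+ 4 / k * (c * k ^+ 16))).
    rewrite (_ : _ * _ = c^-1 ^+ 3 * k ^+ 15); last by field; rewrite !gt_eqF.
    apply: (@le_trans _ _ (1 * k ^+ 15)); first by rewrite mul1r ler_weXn2l.
    by rewrite ler_wpM2r ?(ltW (kp _))// exprn_ege1// invf_ge1.
  by rewrite ler_wpM2l// !mulr_ge0// invr_ge0 ?exprn_ge0// ltW.
rewrite (_ : _ - _ = m - (l + dot (v *m noise w) v + f2 w / l) + (f2 w / l - mean_sqr / l)); last by ring.
apply: le_trans (ler_normD _ _) _.
rewrite (_ : 18 / c ^+ 4 / k = 17 / c ^+ 4 / k + 1 / c ^+ 4 / k); last by ring.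
exact: lerD.
Qed.

End UnitVector.
End Noise.

(** * The heat kernel *)

Section HeatKernel.
Context {R : realType}.
Implicit Types (f : R -> R) (t x y : R).

Lemma mvt_bound (f df : R -> R) (a b B : R) : a <= b ->
  (forall x, a <= x <= b -> is_derive x 1 f (df x)) ->
  (forall x, a <= x <= b -> `|df x| <= B) ->
  `|f b - f a| <= B * (b - a).
Proof.
move=> ab fdf dfB.
have [|//|x] := @MVT_segment R f df a b ab.
- by move=> x; rewrite in_itv/= => /andP[/ltW ax /ltW xb]; apply: fdf; rewrite ax xb.
- apply: derivable_within_continuous => x; rewrite in_itv/= => /fdf df'.
  exact: ex_derive.
- rewrite in_itv/= => /dfB xB ->; rewrite normrM (@ger0_norm _ (b - a)) ?subr_ge0//.
  by rewrite ler_wpM2r// subr_ge0.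
Qed.

Lemma mvt_bound0 (f df : R -> R) (h B : R) :
  (forall x, `|x| <= `|h| -> is_derive x 1 f (df x)) ->
  (forall x, `|x| <= `|h| -> `|df x| <= B) ->
  `|f h - f 0| <= B * `|h|.
Proof.
move=> fdf dfB; have [h0|/ltW h0] := leP 0 h.
  rewrite (ger0_norm h0) -[h in leRHS]subr0.
  by apply: (mvt_bound (df := df)) => // x /andP[x0 xh];
    [apply: fdf|apply: dfB]; rewrite !ger0_norm.
rewrite distrC (ler0_norm h0) -[- h]add0r.
by apply: (mvt_bound (df := df)) => // x /andP[hx x0];
    [apply: fdf|apply: dfB]; rewrite !ler0_norm// lerN2.
Qed.

Lemma is_derive_shift (f : R -> R) (x s d : R) :
  is_derive (x + s) 1 f d -> is_derive s 1 (fun s => f (x + s)) d.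
Proof.
move=> fd; have : is_derive s (1 : R) (fun s : R => x + s) (0 + 1) by exact: is_deriveD.
by rewrite add0r => xs; have := is_derive1_comp fd xs; rewrite mulr1.
Qed.

(** The mean value inequality is integrated up from [f2] to [f1] to [f], each time applied to the
    function minus its Taylor polynomial; this iteration yields the constant M in place of M / 6. *)
Lemma taylor3 (f f1 f2 f3 : R -> R) (M : R) :
  (forall x, is_derive x 1 f (f1 x)) -> (forall x, is_derive x 1 f1 (f2 x)) ->
  (forall x, is_derive x 1 f2 (f3 x)) -> (forall x, `|f3 x| <= M) ->
  forall x h, `|f (x + h) - f x - h * f1 x - h ^+ 2 / 2 * f2 x| <= M * `|h| ^+ 3.
Proof.
move=> d1 d2 d3 hM x h.
have M0 : 0 <= M by exact: le_trans (normr_ge0 _) (hM 0).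
have A s : `|f2 (x + s) - f2 x| <= M * `|s|.
  have := @mvt_bound0 (fun s => f2 (x + s)) (fun s => f3 (x + s)) s M.
  rewrite addr0; apply=> y _; last exact: hM.
  exact: is_derive_shift.
have B s : `|f1 (x + s) - f1 x - s * f2 x| <= M * `|s| ^+ 2.
  have := @mvt_bound0 (fun s => f1 (x + s) - s * f2 x)
    (fun s => f2 (x + s) - f2 x) s (M * `|s|).
  rewrite addr0 mul0r subr0 [_ - f1 x]addrAC expr2 mulrA; apply=> y ys.
    have := is_derive_shift (d2 (x + y)) => ?.
    by apply: is_derive_eq; rewrite scaler0 add0r /GRing.scale/= mulr1.
  by apply: (le_trans (A y)); rewrite ler_wpM2l.
have := @mvt_bound0 (fun s => f (x + s) - s * f1 x - s ^+ 2 / 2 * f2 x)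
    (fun s => f1 (x + s) - f1 x - s * f2 x) h (M * `|h| ^+ 2).
rewrite addr0 !mul0r expr0n/= !mul0r !subr0 -[M * _ * _]mulrA -exprSr.
rewrite (_ : f (x + h) - h * _ - _ - _ =
  f (x + h) - f x - h * f1 x - h ^+ 2 / 2 * f2 x); last by ring.
apply=> y yh.
  have := is_derive_shift (d1 (x + y)) => ?.
  by apply: is_derive_eq; rewrite /GRing.scale/=; field.
by apply: (le_trans (B y)); rewrite ler_wpM2l// ler_pXn2r ?nnegrE.
Qed.

(** The kernel t^(-1/2) exp (- x^2 / (2 t)), without the factor 1 / sqrt (2 pi). The prefactor is
    put into the exponent, so that derivatives and products of kernels become computations with
    exponents. *)
Definition heat t x := expR (- (x ^+ 2 / (2 * t)) - ln t / 2).

Definition heat1 t x := - (x / t) * heat t x.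
Definition heat2 t x := (x ^+ 2 / t ^+ 2 - t^-1) * heat t x.
Definition heat3 t x := (3 * x / t ^+ 2 - x ^+ 3 / t ^+ 3) * heat t x.
(** The second time derivative: by the heat equation a quarter of the fourth space derivative,
    whence the Hermite polynomial of degree four. *)
Definition heat_tt t x := (x ^+ 4 / t ^+ 4 - 6 * x ^+ 2 / t ^+ 3 + 3 / t ^+ 2) / 4 * heat t x.

Lemma heat_gt0 t x : 0 < heat t x. Proof. exact: expR_gt0. Qed.

Lemma is_derive_heat t x : t != 0 -> is_derive x 1 (heat t) (heat1 t x).
Proof.
move=> t0; rewrite /heat1 mulrC; apply: is_derive1_comp.
apply: is_derive_eq; rewrite /GRing.scale/=; field.
by rewrite t0.
Qed.

Lemma is_derive_heat1 t x : t != 0 -> is_derive x 1 (heat1 t) (heat2 t x).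
Proof.
move=> t0; have := is_derive_heat x t0 => ?.
apply: is_derive_eq; rewrite /GRing.scale/= /heat1 /heat2; field.
by rewrite t0.
Qed.

Lemma is_derive_heat2 t x : t != 0 -> is_derive x 1 (heat2 t) (heat3 t x).
Proof.
move=> t0; have := is_derive_heat x t0 => ?.
apply: is_derive_eq; rewrite /GRing.scale/= /heat1 /heat3; field.
by rewrite t0.
Qed.

Lemma is_derive_heat_t t x : 0 < t -> is_derive t 1 (heat ^~ x) (heat2 t x / 2).
Proof.
move=> t0; have tn0 : t != 0 by rewrite gt_eqF.
have dln := is_derive1_ln t0.
have dV : is_derive t (1 : R) (fun t : R => (2 * t)^-1) (- (2 * t) ^- 2 * 2).
  have tt : 2 * t != 0 by rewrite mulf_neq0.
  have d2 : is_derive t (1 : R) (fun t : R => 2 * t) 2.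
    by apply: is_derive_eq; rewrite /GRing.scale/=; ring.
  have := is_deriveV tt d2; rewrite /GRing.scale/=; exact.
rewrite /heat2 mulrAC mulrC; apply: is_derive1_comp.
apply: is_derive_eq; rewrite /GRing.scale/=; field.
by rewrite tn0.
Qed.

Lemma is_derive_heat2_t t x : 0 < t ->
  is_derive t 1 (fun t => heat2 t x / 2) (heat_tt t x).
Proof.
move=> t0; have tn0 : t != 0 by rewrite gt_eqF.
have dh := is_derive_heat_t x t0.
have dV : is_derive t (1 : R) (fun t : R => t^-1) (- t ^- 2 * 1).
  exact: (is_deriveV (f := id)).
have -> : (fun t => heat2 t x / 2) =
    (fun t : R => (x ^+ 2 / 2 * (t^-1 ^+ 2) - t^-1 / 2) * heat t x).
  by apply/funext => s; rewrite /heat2 -exprVn; ring.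
apply: is_derive_eq; rewrite /GRing.scale/= /heat2 /heat_tt; field.
by rewrite tn0.
Qed.

Lemma pow_expRN_le (n : nat) (u : R) : 0 <= u ->
  u ^+ n.+1 * expR (- u) <= n.+1`!%:R.
Proof.
move=> u0; rewrite expRN ler_pdivrMr ?expR_gt0//.
rewrite mulrC -ler_pdivrMr ?ltr0n ?fact_gt0//.
by apply: le_trans (expR_ge1Dxn n u0); rewrite lerDr ler01.
Qed.

(** In the variable u = x^2 / (2 t) each derivative is bounded by a polynomial of degree at most 2
    in u times the kernel, with powers of 1/t as coefficients. The factor exp (- u) absorbs the
    powers of u, and t >= t0 bounds those of 1/t. Odd powers of x are first dominated by even
    ones. *)
Lemma heat_bounds (t0 : R) : 0 < t0 -> exists2 K, 0 < K &
  forall t x, t0 <= t -> [/\ heat t x <= K, `|heat1 t x| <= K,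
    `|heat2 t x / 2| <= K, `|heat3 t x| <= K & `|heat_tt t x| <= K].
Proof.
move=> t00; pose k := expR (- ln t0 / 2); pose i0 := t0^-1.
have k0 : 0 < k by exact: expR_gt0.
have i00 : 0 < i0 by rewrite invr_gt0.
exists (k * (1 + 20 * i0 + 20 * i0 ^+ 2 + i0 ^+ 3 + 2)).
  by rewrite mulr_gt0// !addr_gt0 ?mulr_gt0 ?exprn_gt0.
move=> t x tt; have t_gt0 : 0 < t by rewrite (lt_le_trans t00).
pose i := t^-1; have i_gt0 : 0 < i by rewrite invr_gt0.
have ii : i <= i0 by rewrite lef_pV2.
set h := heat t x; have h0 : 0 < h by exact: heat_gt0.
pose u := x ^+ 2 / (2 * t).
have u0 : 0 <= u by rewrite divr_ge0 ?sqr_ge0// mulr_ge0// ltW.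
have hE : h <= k * expR (- u).
  rewrite /h /heat expRD mulrC ler_wpM2r ?expR_ge0// ler_expR.
  by rewrite !mulNr lerN2 ler_pM2r ?invr_gt0// ler_ln.
have hk : h <= k.
  by apply: (le_trans hE); rewrite ler_piMr ?(ltW k0)// -expR0 ler_expR oppr_le0.
have uh : u * h <= k.
  apply: (le_trans (ler_wpM2l u0 hE)); rewrite mulrCA ler_piMr ?(ltW k0)//.
  by have := pow_expRN_le 0 u0; rewrite expr1.
have u2h : u ^+ 2 * h <= 2 * k.
  apply: (le_trans (ler_wpM2l (sqr_ge0 u) hE)).
  by rewrite mulrCA mulrC ler_wpM2r ?(ltW k0)//; exact: (pow_expRN_le 1 u0).
have xu : x ^+ 2 * i = 2 * u by rewrite /u /i; field; rewrite gt_eqF.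
have x2 : 0 <= x ^+ 2 by exact: sqr_ge0.
have i2 : i ^+ 2 <= i0 ^+ 2 by rewrite ler_pXn2r ?nnegrE ?(ltW i_gt0) ?(ltW i00).
have i3 : i ^+ 3 <= i0 ^+ 3 by rewrite ler_pXn2r ?nnegrE ?(ltW i_gt0) ?(ltW i00).
have a1 : `|x| <= 1 + x ^+ 2.
  by rewrite -real_normK ?num_real//; have := sqr_ge0 (`|x| - 1); have := normr_ge0 x; nra.
have a3 : `|x| ^+ 3 <= 1 + x ^+ 4.
  have -> : x ^+ 4 = `|x| ^+ 4 by rewrite -normrX ger0_norm ?exprn_even_ge0.
  have n0 := normr_ge0 x; set z := `|x| in n0 *.
  have := mulr_ge0 (sqr_ge0 z) (sqr_ge0 (z - 1)); have := sqr_ge0 (z ^+ 2 - 1); nra.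
have X (a b c r : R) : 0 <= a -> 0 <= b -> 0 <= c -> 
   r <= (a + b * u + c * u ^+ 2) * h -> r <= (a + b + 2 * c) * k.
  move=> a0 b0 c0 /le_trans; apply.
  have := ler_wpM2l a0 hk; have := ler_wpM2l b0 uh; have := ler_wpM2l c0 u2h; lra.
have ik0 : 0 <= i0 * k by rewrite mulr_ge0 ?ltW.
have i2k0 : 0 <= i0 ^+ 2 * k by rewrite mulr_ge0 ?exprn_ge0 ?ltW.
have i3k0 : 0 <= i0 ^+ 3 * k by rewrite mulr_ge0 ?exprn_ge0 ?ltW.
have ik : i * k <= i0 * k by rewrite ler_wpM2r// ltW.
have i2k : i ^+ 2 * k <= i0 ^+ 2 * k by rewrite ler_wpM2r// ltW.
have i3k : i ^+ 3 * k <= i0 ^+ 3 * k by rewrite ler_wpM2r// ltW.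
have i1' := ltW i_gt0; have i2' : 0 <= i ^+ 2 by exact: sqr_ge0.
have i3' : 0 <= i ^+ 3 by rewrite exprn_ge0.
split.
- by lra.
- rewrite /heat1 -/h normrM (gtr0_norm h0) normrN normrM (gtr0_norm i_gt0).
  have : `|x| * i * h <= (i + 2 * u + 0 * u ^+ 2) * h.
    by rewrite ler_wpM2r ?(ltW h0)// mul0r addr0 -xu; have := ler_wpM2r i1' a1; lra.
  by move/X => /(_ i1' (ler0n _ _) (lexx _)); lra.
- rewrite normrM [`|2^-1|]ger0_norm ?invr_ge0// /heat2 -/h normrM (gtr0_norm h0).
  have : `|x ^+ 2 / t ^+ 2 - t^-1| * h <= (i + (2 * i) * u + 0 * u ^+ 2) * h.
    rewrite ler_wpM2r ?(ltW h0)//; apply: (le_trans (ler_normB _ _)).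
    rewrite (gtr0_norm i_gt0) -exprVn -/i (ger0_norm (mulr_ge0 x2 i2')).
    have -> : x ^+ 2 * i ^+ 2 = i * (x ^+ 2 * i) by ring.
    rewrite xu; lra.
  move/X => /(_ i1' (mulr_ge0 (ler0n _ 2) i1') (lexx _)).
  set r := _ * h => hr; have r0 : 0 <= r by rewrite mulr_ge0// ltW.
  lra.
- rewrite /heat3 -/h normrM (gtr0_norm h0).
  have : `|3 * x / t ^+ 2 - x ^+ 3 / t ^+ 3| * h <=
      ((3 * i ^+ 2 + i ^+ 3) + (6 * i) * u + (4 * i) * u ^+ 2) * h.
    rewrite ler_wpM2r ?(ltW h0)//; apply: (le_trans (ler_normB _ _)).
    rewrite -!exprVn -/i [`|3 * x * _|]normrM [`|3 * x|]normrM [`|x ^+ 3 * _|]normrM.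
    rewrite (ger0_norm i2') (ger0_norm i3') [`|x ^+ 3|]normrX (@ger0_norm _ 3)//.
    have -> : (4 * i) * u ^+ 2 = x ^+ 4 * i ^+ 3.
      have -> : x ^+ 4 * i ^+ 3 = i * (x ^+ 2 * i) ^+ 2 by ring.
      by rewrite xu; ring.
    have -> : (6 * i) * u = 3 * (x ^+ 2 * i ^+ 2).
      have -> : x ^+ 2 * i ^+ 2 = i * (x ^+ 2 * i) by ring.
      by rewrite xu; ring.
    by have := ler_wpM2r i2' a1; have := ler_wpM2r i3' a3; lra.
  move/X => /(_ (addr_ge0 (mulr_ge0 (ler0n _ 3) i2') i3') (mulr_ge0 (ler0n _ 6) i1')
    (mulr_ge0 (ler0n _ 4) i1')); lra.
- rewrite /heat_tt -/h normrM (gtr0_norm h0).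
  have : `|(x ^+ 4 / t ^+ 4 - 6 * x ^+ 2 / t ^+ 3 + 3 / t ^+ 2) / 4| * h <=
      ((3 * i ^+ 2) / 4 + (3 * i ^+ 2) * u + (i ^+ 2) * u ^+ 2) * h.
    rewrite ler_wpM2r ?(ltW h0)// normrM [`|4^-1|]ger0_norm ?invr_ge0//.
    rewrite -!exprVn -/i.
    have -> : x ^+ 4 * i ^+ 4 - 6 * x ^+ 2 * i ^+ 3 + 3 * i ^+ 2 =
       i ^+ 2 * ((x ^+ 2 * i) ^+ 2 - 6 * (x ^+ 2 * i) + 3) by ring.
    rewrite xu normrM (ger0_norm i2').
    have : `|(2 * u) ^+ 2 - 6 * (2 * u) + 3| <= 4 * u ^+ 2 + 12 * u + 3.
      by rewrite ler_norml; have := sqr_ge0 u => ?; apply/andP; split; lra.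
    by move=> /(ler_wpM2l i2'); lra.
  move/X => /(_ (mulr_ge0 (mulr_ge0 (ler0n _ 3) i2') _) (mulr_ge0 (ler0n _ 3) i2') i2').
  by rewrite invr_ge0 => /(_ (ler0n _ _)); lra.
Qed.

(** The jump a (b - q) has mean 0 and variance a^2 q (1 - q): first order terms cancel, and the
    second order term equals the time increment because the time derivative is half the second space
    derivative. The remainders are cubic in space and quadratic in time; |a| <= 1 turns a^4 into
    |a|^3. *)
Lemma heat_step (t0 : R) : 0 < t0 -> exists2 K, 0 < K &
  forall t x (a q : R), t0 <= t -> 0 <= q <= 1 -> `|a| <= 1 ->
  `|q * heat t (x + a * (1 - q)) + (1 - q) * heat t (x + a * (0 - q))
    - heat (t + a ^+ 2 * (q * (1 - q))) x| <= K * `|a| ^+ 3.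
Proof.
move=> t00; have [K K0 HK] := heat_bounds t00.
exists (3 * K); first by rewrite mulr_gt0.
move=> t x a q tt /andP[q0 q1] a1; have t_gt0 : 0 < t by rewrite (lt_le_trans t00).
have tn0 : t != 0 by rewrite gt_eqF.
have T3 := @taylor3 (heat t) (heat1 t) (heat2 t) (heat3 t) K
  (fun x => is_derive_heat x tn0) (fun x => is_derive_heat1 x tn0)
  (fun x => is_derive_heat2 x tn0) _ x.
have {}T3 h : `|h| <= `|a| -> `|heat t (x + h) - heat t x - h * heat1 t x -
    h ^+ 2 / 2 * heat2 t x| <= K * `|a| ^+ 3.
  move=> ha; apply: (le_trans (T3 _ h)); first by move=> y; case: (HK t y tt).
  by rewrite ler_pM2l// ler_pXn2r ?nnegrE.
pose v := q * (1 - q).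
have v0 : 0 <= v by rewrite mulr_ge0 ?subr_ge0.
have v1 : v <= 1 by rewrite mulr_ile1 ?subr_ge0// lerBlDr lerDl.
pose s := a ^+ 2 * v; have s0 : 0 <= s by rewrite mulr_ge0 ?sqr_ge0.
have T2 : `|heat (t + s) x - heat t x - s * (heat2 t x / 2)| <= K * `|a| ^+ 3.
  have A r : t <= r -> r <= t + s -> `|heat2 r x / 2 - heat2 t x / 2| <= K * s.
    move=> tr rs; apply: (@le_trans _ _ (K * (r - t))); last by rewrite ler_pM2l// lerBlDl.
    have := @mvt_bound (fun t => heat2 t x / 2) (heat_tt ^~ x) t r K tr.
    apply=> y /andP[ty yr].
      by apply: is_derive_heat2_t; rewrite (lt_le_trans t_gt0).
    by case: (HK y x (le_trans tt ty)).
  have : `|(heat (t + s) x - (t + s) * (heat2 t x / 2)) -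
      (heat t x - t * (heat2 t x / 2))| <= K * s * (t + s - t).
    apply: (@mvt_bound (fun r => heat r x - r * (heat2 t x / 2))
       (fun r => heat2 r x / 2 - heat2 t x / 2)).
    - by rewrite lerDl.
    - move=> r /andP[tr rs]; have := is_derive_heat_t x (lt_le_trans t_gt0 tr) => ?.
      by apply: is_derive_eq; rewrite /GRing.scale/=; ring.
    - by move=> r /andP[tr rs]; exact: A.
  rewrite (_ : _ - _ - _ = heat (t + s) x - heat t x - s * (heat2 t x / 2)); last by ring.
  move=> /le_trans; apply; rewrite addrAC subrr add0r -mulrA ler_pM2l//.
  rewrite /s mulrACA -real_normK ?num_real//.
  have a0 := normr_ge0 a; set z := `|a| in a0 a1 *.
  rewrite (_ : z ^+ 3 = z ^+ 3 * 1); last by rewrite mulr1.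
  rewrite -exprD; apply: ler_pM; [exact: exprn_ge0|exact: (mulr_ge0 v0 v0)| |].
    by rewrite ler_wiXn2l.
  by rewrite mulr_ile1.
have h1 := T3 (a * (1 - q)); have h2 := T3 (a * (0 - q)).
have {}h1 : `|heat t (x + a * (1 - q)) - heat t x - a * (1 - q) * heat1 t x -
    (a * (1 - q)) ^+ 2 / 2 * heat2 t x| <= K * `|a| ^+ 3.
  by apply: h1; rewrite normrM ler_piMr// ger0_norm ?subr_ge0// lerBlDr lerDl.
have {}h2 : `|heat t (x + a * (0 - q)) - heat t x - a * (0 - q) * heat1 t x -
    (a * (0 - q)) ^+ 2 / 2 * heat2 t x| <= K * `|a| ^+ 3.
  by apply: h2; rewrite normrM ler_piMr// sub0r normrN ger0_norm.
rewrite -/v -/s; set X1 := heat t (x + a * (1 - q)) in h1 *.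
set X2 := heat t (x + a * (0 - q)) in h2 *; set Y := heat (t + s) x in T2 *.
set B := K * `|a| ^+ 3 in h1 h2 T2 *.
set r1 := (X in `|X| <= B) in h1; set r2 := (X in `|X| <= B) in h2.
set r3 := (X in `|X| <= B) in T2.
have -> : q * X1 + (1 - q) * X2 - Y = q * r1 + (1 - q) * r2 - r3.
  by rewrite /r1 /r2 /r3 /s /v; field.
have B0 : 0 <= B by rewrite mulr_ge0 ?exprn_ge0// ltW.
have := ler_normB (q * r1 + (1 - q) * r2) r3.
have := ler_normD (q * r1) ((1 - q) * r2).
rewrite !normrM (ger0_norm q0) (@ger0_norm _ (1 - q)) ?subr_ge0// -mulrA -/B.
have q1' : 0 <= 1 - q by rewrite subr_ge0.
have := ler_wpM2l q0 h1; have := ler_wpM2l q1' h2; nra.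
Qed.

Lemma heat_lip (t0 : R) : 0 < t0 -> exists2 K, 0 < K &
  forall t s x y, t0 <= t -> t0 <= s ->
  `|heat t x - heat s y| <= K * (`|t - s| + `|x - y|).
Proof.
move=> t00; have [K K0 HK] := heat_bounds t00; exists K => // t s x y tt ts.
have wx r u v : t0 <= r -> u <= v -> `|heat r v - heat r u| <= K * (v - u).
  move=> tr uv; apply: (@mvt_bound (heat r) (heat1 r)) => // z _.
    by apply: is_derive_heat; rewrite gt_eqF// (lt_le_trans t00).
  by case: (HK r z tr).
have wt z u v : t0 <= u -> u <= v -> `|heat v z - heat u z| <= K * (v - u).
  move=> tu uv; have := @mvt_bound (heat ^~ z) (fun r => heat2 r z / 2) u v K uv.
  apply=> r /andP[ur _].
    by apply: is_derive_heat_t; rewrite (lt_le_trans t00)// (le_trans tu).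
  by case: (HK r z (le_trans tu ur)).
have -> : heat t x - heat s y = (heat t x - heat s x) + (heat s x - heat s y) by ring.
apply: (le_trans (ler_normD _ _)); rewrite mulrDr; apply: lerD.
  have [st|/ltW st] := leP s t.
    by rewrite (@ger0_norm _ (t - s)) ?subr_ge0//; exact: wt.
  by rewrite distrC (@ler0_norm _ (t - s)) ?subr_le0// opprB; exact: wt.
have [yx|/ltW xy] := leP y x.
  by rewrite (@ger0_norm _ (x - y)) ?subr_ge0//; exact: wx.
by rewrite distrC (@ler0_norm _ (x - y)) ?subr_le0// opprB; exact: wx.
Qed.

End HeatKernel.

(** * Weak convergence from heat kernels *)

Section GaussianSmoothing.
Context {R : realType}.
Local Notation leb := (@lebesgue_measure R).
Implicit Types (f g : R -> R) (a x t m v : R).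

Definition gconst : R := (Num.sqrt (pi *+ 2))^-1.

Lemma gconst_gt0 : 0 < gconst.
Proof. by rewrite invr_gt0 sqrtr_gt0 mulrn_wgt0 ?pi_gt0. Qed.

Lemma heatC t x y : heat t (x - y) = heat t (y - x).
Proof. by rewrite /heat -sqrrN opprB. Qed.

Lemma normal_pdf_heat m t x : 0 < t ->
  normal_pdf m (Num.sqrt t) x = gconst * heat t (x - m).
Proof.
move=> t0; rewrite normal_pdfE ?gt_eqF ?sqrtr_gt0//.
rewrite /normal_peak /normal_fun sqr_sqrtr ?(ltW t0)// /gconst /heat expRD.
rewrite -mulrnAr sqrtrM ?(ltW t0)// invfM.
have -> : expR (- (ln t / 2)) = (Num.sqrt t)^-1.
  rewrite expRN; congr (_^-1).
  have h : expR (ln t / 2) ^+ 2 = t.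
    by rewrite -expRM_natl -mulr_natl mulrC divfK// lnK.
  by rewrite -[in RHS]h sqrtr_sqr ger0_norm// expR_ge0.
by rewrite mulNr -(mulr_natl t 2); ring.
Qed.

Lemma measurable_heat t a : measurable_fun setT (fun x : measurableTypeR R => heat t (x - a)).
Proof.
rewrite /heat; apply: measurableT_comp => //; apply: measurable_funB => //.
apply: measurableT_comp => //; apply: measurable_funM => //.
by apply: measurable_funX; exact: measurable_funB.
Qed.

Lemma integral_heat t a : 0 < t ->
  (\int[leb]_x (heat t (x - a))%:E = (gconst^-1)%:E)%E.
Proof.
move=> t0; have := integral_normal_pdf a (Num.sqrt t).
under eq_integral do rewrite normal_pdf_heat// EFinM.
rewrite ge0_integralZl//=.
- move=> h; rewrite -[LHS]mul1e -(_ : (gconst^-1)%:E * gconst%:E = 1)%E.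
    by rewrite -muleA h mule1.
  by rewrite -EFinM mulVf// gt_eqF// gconst_gt0.
- by apply/measurable_EFinP; exact: measurable_heat.
- by move=> x _; rewrite lee_fin ltW// heat_gt0.
- by rewrite lee_fin ltW// gconst_gt0.
Qed.

(** Completion of the square in x. Integrating out the second factor on the right gives the
    semigroup law. *)
Lemma heat_mul m v a t x : 0 < t -> 0 < v ->
  heat t (x - a) * heat v (x - m) =
  heat (t + v) (m - a) * heat (t * v / (t + v)) (x - (v * a + t * m) / (t + v)).
Proof.
move=> t0 v0; have tv : 0 < t + v by rewrite addr_gt0.
rewrite /heat -!expRD; congr expR.
rewrite lnM ?lnM ?lnV ?posrE ?mulr_gt0 ?invr_gt0//.
by field; rewrite !gt_eqF.
Qed.

(** The Radon-Nikodym derivative of [normal_prob] and [normal_pdf] have the same integral over every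
    measurable set, hence agree almost everywhere. *)
Lemma integral_normal_prob m v f : 0 < v -> measurable_fun setT f ->
  (forall x, 0 <= f x) -> (exists B, forall x, f x <= B) ->
  (\int[normal_prob m (Num.sqrt v)]_x (f x)%:E =
   \int[leb]_x ((f x * normal_pdf m (Num.sqrt v) x)%:E))%E.
Proof.
move=> v0 mf f0 [B fB]; have B0 : 0 <= B by exact: le_trans (f0 0) (fB 0).
have dom := normal_prob_dominates m (Num.sqrt v).
have fi : (normal_prob m (Num.sqrt v)).-integrable setT (EFin \o f).
  apply: measurable_bounded_integrable => //.
    by rewrite [X in (X < _)%E](@probability_setT _ _ _ (normal_prob m (Num.sqrt v))) ltry.
  exists B; split; first exact: num_real.
  by move=> M BM x _ /=; rewrite ger0_norm// (le_trans (fB x))// ltW.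
rewrite -(Radon_Nikodym_change_of_variables dom)//=.
apply: ae_eq_integral => //.
- apply: emeasurable_funM; first exact/measurable_EFinP.
  apply: (measurable_int leb).
  exact: Radon_Nikodym_integrable.
- apply/measurable_EFinP; apply: measurable_funM => //; exact: measurable_normal_pdf.
- under [X in ae_eq _ _ _ X]eq_fun do rewrite EFinM.
  apply: ae_eqe_mul2l => /=.
  rewrite Radon_NikodymE/=; case: cid => /= h [h1 h2 h3].
  apply: integral_ae_eq => //=.
  + by apply/measurable_EFinP; exact: measurable_normal_pdf.
  + by move=> E _ mE; rewrite -h3.
Qed.

Lemma heat_le t x : 0 < t -> heat t x <= expR (- (ln t / 2)).
Proof.
move=> t0; rewrite /heat ler_expR gerDr oppr_le0.
by rewrite divr_ge0 ?sqr_ge0// mulr_ge0// ltW.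
Qed.

(** One formula for both branches of [gaussian]: a point mass leaves the kernel at time t, in
    accordance with v = 0. From here on the degenerate limit is no special case. *)
Lemma gaussian_heat m v t a : 0 <= v -> 0 < t ->
  (\int[gaussian m v]_x (heat t (x - a))%:E = (heat (t + v) (m - a))%:E)%E.
Proof.
move=> v0 t0; rewrite /gaussian; case: eqVneq => [->|vn0].
  by rewrite addr0 integral_dirac//= ?diracT ?mul1e//; apply/measurable_EFinP; exact: measurable_heat.
have {vn0 v0} v0 : 0 < v by rewrite lt_def vn0.
rewrite [LHS](@integral_normal_prob m v (fun x => heat t (x - a)))//; first last.
- exists (expR (- (ln t / 2))) => x; exact: heat_le.
- by move=> x; rewrite ltW// heat_gt0.
- exact: measurable_heat.
have tv : 0 < t + v by rewrite addr_gt0.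
under eq_integral do rewrite normal_pdf_heat// mulrCA heat_mul// mulrA EFinM.
rewrite ge0_integralZl//=.
- rewrite integral_heat ?divr_gt0 ?mulr_gt0// -EFinM mulrAC mulfV ?mul1r//.
  by rewrite gt_eqF// gconst_gt0.
- by apply/measurable_EFinP; exact: measurable_heat.
- by move=> x _; rewrite lee_fin ltW// heat_gt0.
- by rewrite lee_fin mulr_ge0// ltW ?heat_gt0 ?gconst_gt0.
Qed.

End GaussianSmoothing.

Section WeakConvergence.
Context {R : realType}.
Local Notation leb := (@lebesgue_measure R).
Local Notation c := (@gconst R).
Implicit Types (f g : R -> R) (a x t m v : R) (s : seq (R * R)).

(** A finite law is a list of pairs (mass, atom), atoms possibly repeated. *)
Definition law_exp s f := \sum_(j <- s) j.1 * f j.2.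

Definition is_law s := all (fun j => 0 <= j.1) s && (\sum_(j <- s) j.1 == 1).

Lemma law_expD s f g : law_exp s (fun x => f x + g x) = law_exp s f + law_exp s g.
Proof. by rewrite -big_split; apply: eq_bigr => j _; rewrite mulrDr. Qed.

Lemma law_expN s f : law_exp s (fun x => - f x) = - law_exp s f.
Proof. by rewrite /law_exp -sumrN; apply: eq_bigr => j _; rewrite mulrN. Qed.

Lemma law_exp_cst s k : is_law s -> law_exp s (fun=> k) = k.
Proof. by move=> /andP[_ /eqP s1]; rewrite /law_exp -mulr_suml s1 mul1r. Qed.

Lemma law_exp_le s f g : is_law s -> (forall x, f x <= g x) ->
  law_exp s f <= law_exp s g.
Proof.
move=> /andP[/allP s0 _] fg; rewrite /law_exp !big_seq; apply: ler_sum => j js.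
by rewrite ler_wpM2l// s0.
Qed.

Lemma integrable_heat t x : 0 < t -> leb.-integrable setT (fun a => (heat t (x - a))%:E).
Proof.
move=> t0; apply/integrableP; split.
  apply/measurable_EFinP; under eq_fun do rewrite heatC; exact: measurable_heat.
under eq_integral do rewrite gee0_abs ?lee_fin ?(ltW (heat_gt0 _ _))// heatC.
by rewrite integral_heat// ltry.
Qed.

Lemma Rintegral_heat t x : 0 < t -> \int[leb]_a heat t (x - a) = c^-1.
Proof.
move=> t0; rewrite /Rintegral; under eq_integral do rewrite heatC.
by rewrite integral_heat.
Qed.

(** Doubling the time leaves a spare factor exp (- y^2 / (4 t)) that absorbs y^2; the change of
    prefactor costs sqrt 2, bounded by 2. Integrated, this gives a second moment of order t. *)
Lemma heat_sqr_le t y : 0 < t -> y ^+ 2 * heat t y <= 8 * t * heat (2 * t) y.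
Proof.
move=> t0; pose u := y ^+ 2 / (4 * t).
have u0 : 0 <= u by rewrite divr_ge0 ?sqr_ge0// mulr_ge0// ltW.
have -> : heat t y = heat (2 * t) y * expR (- u) * expR (ln 2 / 2).
  rewrite /heat -!expRD; congr expR; rewrite lnM ?posrE// /u.
  by field; rewrite gt_eqF.
have -> : y ^+ 2 = 4 * t * u by rewrite /u; field; rewrite gt_eqF.
have h1 : u * expR (- u) <= 1 by have := pow_expRN_le 0 u0; rewrite expr1.
have h2 : expR (ln 2 / 2) <= 2 :> R.
  have l2 : 0 <= ln (2 : R) by rewrite ln_ge0// ler1n.
  rewrite -[leRHS]lnK ?posrE// ler_expR; lra.
have -> : 4 * t * u * (heat (2 * t) y * expR (- u) * expR (ln 2 / 2)) =
  (4 * t * heat (2 * t) y) * ((u * expR (- u)) * expR (ln 2 / 2)) by ring.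
have -> : 8 * t * heat (2 * t) y = (4 * t * heat (2 * t) y) * 2 by ring.
rewrite ler_wpM2l ?mulr_ge0 ?(ltW t0) ?(ltW (heat_gt0 _ _))//.
rewrite -[leRHS]mul1r; by apply: ler_pM => //; rewrite mulr_ge0// expR_ge0.
Qed.

Section CompactSupport.
Variables (g : R -> R) (B K : R).
Hypotheses (cg : continuous g) (g0 : forall x, 0 <= g x) (gB : forall x, g x <= B).
Hypothesis gK : forall x, K < `|x| -> g x = 0.

Let B0 : 0 <= B. Proof. exact: le_trans (g0 0) (gB 0). Qed.

Lemma compact_support_unif (e : R) : 0 < e -> exists2 d, 0 < d &
  forall x y, `|x - y| < d -> `|g x - g y| <= e.
Proof.
move=> e0; pose P (d : R) (x : R) := forall y, `|x - y| < d -> `|g x - g y| <= e.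
have cK : compact `[- (K + 1), K + 1] by exact: segment_compact.
have [d d0 dP] : exists2 d, 0 < d & forall x, `[- (K + 1), K + 1]%classic x -> P d x.
  have := (compact_near_coveringP _).1 cK R (0^'+) P _.
  case.
    move=> x _; have e20 : 0 < e / 2 by rewrite divr_gt0.
    have cx : g y @[y --> x] --> g x by exact: cg.
    move/cvgrPdist_lt : cx => /(_ _ e20) /nbhs_ballP[r /= r0 hr].
    exists (ball x (r / 2), [set d | d < r / 2]) => /=.
      split; first by apply: nbhsx_ballx; rewrite divr_gt0.
      by apply: nbhs_right_lt; rewrite divr_gt0.
    move=> [z d] /= [zx dr] y zy.
    have h1 : `|g x - g z| < e / 2.
      by apply: hr; apply: le_ball zx; rewrite ler_pdivrMr// ler_peMr ?ler1n// ltW.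
    have h2 : `|g x - g y| < e / 2.
      apply: hr; rewrite /ball/= (splitr r); apply: le_lt_trans (ler_distD z _ _) _.
      by rewrite ltrD// (lt_trans zy).
    rewrite (splitr e) distrC; apply: le_trans (ler_distD (g x) _ _) _.
    by rewrite lerD// ltW// distrC.
  move=> r /= r0 hr; exists (r / 2); first by rewrite divr_gt0.
  have := hr (r / 2); rewrite /ball/= sub0r normrN gtr0_norm ?divr_gt0//.
  by apply; rewrite ?divr_gt0// ltr_pdivrMr// ltr_pMr// ltr1n.
(* The cap 1 treats points outside the enlarged segment: if [x] is beyond K + 1, then [y] is beyond
   K and [g] vanishes at both. *)
exists (Num.min d 1); first by rewrite lt_min d0 ltr01.
move=> x y; rewrite lt_min => /andP[xyd xy1].
have [xK|xK] := leP `|x| (K + 1).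
  by apply: dP => //=; rewrite in_itv/= -ler_norml.
rewrite gK; last by rewrite (lt_trans _ xK)// ltrDl ltr01.
rewrite gK ?subrr ?normr0 ?ltW//.
have := ler_dist_dist x y; rewrite ler_norml => /andP[_ h].
lra.
Qed.

Let mg : measurable_fun setT g. Proof. exact: continuous_measurable_fun. Qed.

Lemma integrable_mul_heat (h : R -> R) t x : 0 < t -> measurable_fun setT h ->
  (exists C, forall a, `|h a| <= C) ->
  leb.-integrable setT (fun a => (h a * heat t (x - a))%:E).
Proof.
move=> t0 mh [C hC].
have C0 : 0 <= C by exact: le_trans (normr_ge0 _) (hC 0).
apply: (le_integrable _ _ _ (integrableZl measurableT C (integrable_heat x t0))) => //.
  apply/measurable_EFinP; apply: measurable_funM => //.
  by under eq_fun do rewrite heatC; exact: measurable_heat.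
move=> a _; rewrite /= lee_fin !normrM (ger0_norm C0).
by rewrite ler_wpM2r.
Qed.

Lemma integrable_compact_support : leb.-integrable setT (EFin \o g).
Proof.
have K0 x : `|x| <= Num.max K 0 \/ g x = 0.
  by have [xK|/gK ->] := leP `|x| K; [left; rewrite le_max xK|right].
pose C := B * expR (Num.max K 0 ^+ 2 / 2).
apply: (le_integrable _ _ _ (integrableZl measurableT C (integrable_heat 0 ltr01))) => //.
  exact/measurable_EFinP.
move=> x _; rewrite /= lee_fin ger0_norm// ger0_norm; last first.
  by rewrite !mulr_ge0 ?expR_ge0// ltW// heat_gt0.
rewrite /C sub0r -mulrA; case: (K0 x) => [xK|->]; last first.
  by rewrite !mulr_ge0 ?expR_ge0// ltW// heat_gt0.
rewrite -[leLHS]mulr1; apply: ler_pM => //.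
rewrite /heat ln1 -expRD -[leLHS]expR0 ler_expR sqrrN mulr1 mul0r subr0 subr_ge0.
rewrite ler_pM2r ?invr_gt0// -(real_normK (num_real x)).
by rewrite ler_pXn2r ?nnegrE// le_max lexx orbT.
Qed.

Definition smooth t x := c * \int[leb]_a (g a * heat t (x - a)).

Let c_gt0 : 0 < c. Proof. exact: gconst_gt0. Qed.

Let gC : exists C, forall a, `|g a| <= C.
Proof. by exists B => a; rewrite ger0_norm. Qed.

(** A Chebyshev argument: |g a - g x| is at most e/2 near x and at most a multiple of (x - a)^2
    elsewhere, and the second part integrates to O(t). *)
Lemma smooth_approx (e : R) : 0 < e -> exists2 t, 0 < t &
  forall x, `|smooth t x - g x| <= e.
Proof.
move=> e0; have e20 : 0 < e / 2 by rewrite divr_gt0.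
have [d d0 gd] := compact_support_unif e20.
pose M := B / d ^+ 2.
have M0 : 0 <= M by rewrite divr_ge0 ?sqr_ge0.
have D a x : `|g a - g x| <= e / 2 + M * (x - a) ^+ 2.
  have [axd|dax] := ltP `|a - x| d.
    by apply: (le_trans (gd _ _ axd)); rewrite lerDl mulr_ge0 ?sqr_ge0.
  have h1 : `|g a - g x| <= B.
    rewrite ler_norml; have := g0 a; have := g0 x; have := gB a; have := gB x.
    by move=> *; apply/andP; split; lra.
  apply: (le_trans h1); apply: (@le_trans _ _ (M * (x - a) ^+ 2)); last by rewrite lerDr ltW.
  rewrite /M mulrAC ler_pdivlMr ?exprn_gt0// ler_wpM2l//.
  by rewrite -(real_normK (num_real (x - a))) distrC ler_pXn2r ?nnegrE// ltW.
(* Chosen so that 8 M t <= e/2, where 8 t comes from [heat_sqr_le]; the summand 1 keeps the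
   denominator positive. *)
pose t := (e / 2) / (8 * M + 1).
have M1 : 0 < 8 * M + 1 by rewrite ltr_wpDl// mulr_ge0.
have t0 : 0 < t by rewrite divr_gt0.
have t20 : 0 < 2 * t by rewrite mulr_gt0.
exists t => // x.
have ih := integrable_heat x t0; have ih2 := integrable_heat x t20.
have igx := integrable_mul_heat x t0 mg gC.
have igc : leb.-integrable setT (fun a => (g x * heat t (x - a))%:E).
  by apply: (integrable_mul_heat x t0 (h := fun=> g x)) => //; exists `|g x|.
have -> : smooth t x - g x = c * \int[leb]_a (g a * heat t (x - a) - g x * heat t (x - a)).
  rewrite RintegralB// mulrBr; congr (_ - _).
  by rewrite RintegralZl// Rintegral_heat// mulrCA mulfV ?mulr1// gt_eqF.
rewrite normrM (gtr0_norm c_gt0) -ler_pdivlMl//.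
have iB : leb.-integrable setT (fun a => (g a * heat t (x - a) - g x * heat t (x - a))%:E).
  by under eq_fun do rewrite EFinB; exact: integrableB.
apply: (le_trans (le_normr_Rintegral _ _)) => //.
pose F a := e / 2 * heat t (x - a) + M * (8 * t) * heat (2 * t) (x - a).
have iF1 : leb.-integrable setT (fun a => (e / 2 * heat t (x - a))%:E).
  by under eq_fun do rewrite EFinM; exact: integrableZl.
have iF2 : leb.-integrable setT (fun a => (M * (8 * t) * heat (2 * t) (x - a))%:E).
  by under eq_fun do rewrite EFinM; exact: integrableZl.
apply: (@le_trans _ _ (\int[leb]_a F a)).
  apply: le_Rintegral => //.
  - by have := integrable_norm iB; apply: eq_integrable.
  - by under [X in integrable _ _ X]eq_fun do rewrite /= /F EFinD; exact: integrableD.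
  move=> a _; rewrite -mulrBl normrM (gtr0_norm (heat_gt0 _ _)).
  apply: (le_trans (ler_wpM2r (ltW (heat_gt0 _ _)) (D a x))).
  rewrite /F mulrDl lerD2l -[leLHS]mulrA -[leRHS]mulrA ler_wpM2l//.
  exact: heat_sqr_le.
rewrite /F RintegralD// !RintegralZl// !Rintegral_heat// -mulrDl mulrC.
have ci : 0 < c^-1 by rewrite invr_gt0; exact: gconst_gt0.
rewrite (ler_pM2l ci).
have : (8 * M + 1) * t = e / 2 by rewrite mulrC /t divfK// gt_eqF.
lra.
Qed.

(** The expectation of a smoothed function depends on the law only through its expectations of
    translated heat kernels, the data that the criterion controls. *)
Lemma law_exp_smooth s t : 0 < t ->
  law_exp s (smooth t) = c * \int[leb]_a (g a * law_exp s (fun x => heat t (x - a))).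
Proof.
move=> t0; have int s' : leb.-integrable setT
    (fun a => (g a * law_exp s' (fun x => heat t (x - a)))%:E).
  rewrite /law_exp; under eq_fun do rewrite mulr_sumr -sumEFin.
  apply: integrable_sum => // j _.
  under eq_fun do rewrite mulrCA EFinM; apply: integrableZl => //.
  exact: integrable_mul_heat.
elim: s => [|j s IH].
  rewrite /law_exp big_nil; under eq_Rintegral do rewrite big_nil mulr0.
  by rewrite Rintegral_cst// mul0r mulr0.
rewrite /law_exp big_cons -/(law_exp s _) IH.
under [in RHS]eq_Rintegral do rewrite big_cons mulrDr mulrCA.
have h1 : leb.-integrable setT (fun a => (g a * heat t (j.2 - a))%:E).
  exact: integrable_mul_heat.
have h2 : leb.-integrable setT (fun a => (j.1 * (g a * heat t (j.2 - a)))%:E).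
  by under eq_fun do rewrite EFinM; exact: integrableZl.
rewrite (RintegralD measurableT h2 (int s)).
by rewrite RintegralZl// mulrDr /smooth mulrCA.
Qed.

Let f_ t (z : measurableTypeR R * measurableTypeR R) := (g z.2 * heat t (z.1 - z.2))%:E.

Let f_ge0 t z : (0 <= f_ t z)%E.
Proof. by rewrite lee_fin mulr_ge0// ltW// heat_gt0. Qed.

Let measurable_f t : measurable_fun setT (f_ t).
Proof.
apply/measurable_EFinP; apply: measurable_funM.
  by apply: measurableT_comp.
rewrite /heat; apply: measurableT_comp => //; apply: measurable_funB => //.
apply: measurableT_comp => //; apply: measurable_funM => //.
by apply: measurable_funX; exact: measurable_funB.
Qed.

Let smoothE t x : 0 < t ->
  ((smooth t x)%:E = c%:E * \int[leb]_a (g a * heat t (x - a))%:E)%E.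
Proof.
move=> t0; rewrite /smooth EFinM fineK//; apply: integrable_fin_num => //.
exact: integrable_mul_heat.
Qed.

Lemma measurable_smooth t : 0 < t -> measurable_fun setT (smooth t).
Proof.
move=> t0; apply/measurable_EFinP; rewrite [X in measurable_fun _ X](_ : _ =
  fun x => (c%:E * fubini_F leb (f_ t) x)%E); last first.
  by apply/funext => x /=; rewrite smoothE.
apply: measurable_funeM; exact: (measurable_fun_fubini_tonelli_F (m2 := leb) (f_ t)).
Qed.

Lemma gaussian_smooth m v t : 0 <= v -> 0 < t ->
  \int[gaussian m v]_x smooth t x = c * \int[leb]_a (g a * heat (t + v) (m - a)).
Proof.
move=> v0 t0; rewrite /Rintegral.
under eq_integral do rewrite smoothE//.
rewrite ge0_integralZl//; first last.
- by rewrite lee_fin ltW.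
- by move=> x _; apply: integral_ge0 => a _; exact: (f_ge0 t (x, a)).
- exact: (measurable_fun_fubini_tonelli_F (m2 := leb) (f_ t)).
rewrite (fubini_tonelli (m1 := gaussian m v) (m2 := leb) (f_ t))// /f_/=.
have -> : (\int[leb]_a \int[gaussian m v]_x (g a * heat t (x - a))%:E =
    \int[leb]_a (g a * heat (t + v) (m - a))%:E)%E.
  apply: eq_integral => a _; under eq_integral do rewrite EFinM.
  rewrite ge0_integralZl//.
  - by rewrite gaussian_heat// EFinM.
  - by apply/measurable_EFinP; exact: measurable_heat.
  - by move=> x _; rewrite lee_fin ltW// heat_gt0.
  - by rewrite lee_fin.
rewrite fineM//.
apply: integrable_fin_num => //.
by apply: integrable_mul_heat => //; rewrite ltr_wpDr.
Qed.

End CompactSupport.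

Section Criterion.
Variables (s : nat -> seq (R * R)) (m v : R).
Hypothesis v0 : 0 <= v.
Hypothesis law_s : forall n, is_law (s n).
Hypothesis heat_cvg : forall t e, 0 < t -> 0 < e -> \forall n \near \oo,
  forall a, `|law_exp (s n) (fun x => heat t (x - a)) - heat (t + v) (m - a)| <= e.

Local Notation nu := (gaussian m v).

Lemma integrable_gaussian f B : measurable_fun setT f -> (forall x, `|f x| <= B) ->
  nu.-integrable setT (EFin \o f).
Proof.
move=> mf fB; apply: measurable_bounded_integrable => //.
  by rewrite [X in (X < _)%E](@probability_setT _ _ _ nu) ltry.
exists B; split; first exact: num_real.
by move=> M BM x _ /=; rewrite (le_trans (fB x))// ltW.
Qed.

Lemma law_exp_dist (r : seq (R * R)) f g e : is_law r ->
  (forall x, `|f x - g x| <= e) -> `|law_exp r f - law_exp r g| <= e.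
Proof.
move=> lr fg; rewrite -law_expN -law_expD -(law_exp_cst e lr) ler_norml.
rewrite -law_expN; apply/andP; split; apply: law_exp_le => // x.
  by have := fg x; rewrite ler_norml => /andP[].
by have := fg x; rewrite ler_norml => /andP[].
Qed.

Lemma gaussian_dist f g B e : measurable_fun setT f -> measurable_fun setT g ->
  (forall x, `|f x| <= B) -> (forall x, `|g x| <= B) ->
  (forall x, `|f x - g x| <= e) -> `|\int[nu]_x f x - \int[nu]_x g x| <= e.
Proof.
move=> mf mg fB gB fg.
have If := integrable_gaussian mf fB; have Ig := integrable_gaussian mg gB.
rewrite -RintegralB//.
have Ifg : nu.-integrable setT (EFin \o (fun x => f x - g x)).
  rewrite (_ : _ \o _ = (EFin \o f) \- (EFin \o g))%E; first exact: integrableB.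
  by apply/funext => x; rewrite /= EFinB.
apply: (le_trans (le_normr_Rintegral _ Ifg)) => //.
have -> : e = \int[nu]_x cst e x.
  rewrite Rintegral_cst// [X in fine X](@probability_setT _ _ _ nu).
  by rewrite mulr1.
apply: le_Rintegral => //.
  by have := integrable_norm Ifg.
by apply: (@integrable_gaussian (cst e) `|e|).
Qed.

(** Smoothing costs e/3 under the finite law and e/3 under the Gaussian. For the smoothed function,
    the kernel estimate is uniform in the translation [a], so its error comes out of the integral
    against [g] with the finite factor c I. *)
Lemma compact_support_cvg g B K : continuous g -> (forall x, 0 <= g x) ->
  (forall x, g x <= B) -> (forall x, K < `|x| -> g x = 0) ->
  forall e : R, 0 < e -> \forall n \near \oo,
    `|law_exp (s n) g - \int[nu]_x g x| <= e.
Proof.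
move=> cg g0 gB gK e e0; have e30 : 0 < e / 3 by rewrite divr_gt0.
have [t t0 gt] := smooth_approx cg g0 gB gK e30.
have ig := integrable_compact_support cg g0 gB gK.
have mg : measurable_fun setT g by exact: continuous_measurable_fun.
have gC : exists C, forall a, `|g a| <= C by exists B => a; rewrite ger0_norm.
pose I := \int[leb]_a g a.
have I0 : 0 <= I by apply: Rintegral_ge0.
have c0 := @gconst_gt0 R.
have cI : 0 < c * I + 1 by rewrite ltr_wpDl// mulr_ge0// ltW.
have eI : 0 < e / 3 / (c * I + 1) by rewrite divr_gt0.
have A2 : `|\int[nu]_x smooth g t x - \int[nu]_x g x| <= e / 3.
  apply: (@gaussian_dist _ _ (B + e / 3)) => //.
  - exact: measurable_smooth.
  - move=> x; rewrite -[smooth g t x](subrK (g x)) addrC.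
    by apply: (le_trans (ler_normD _ _)); rewrite lerD// ger0_norm.
  - by move=> x; rewrite ger0_norm// (le_trans (gB x))// lerDl ltW.
have := heat_cvg t0 eI; apply: filterS => n hn.
have A1 : `|law_exp (s n) g - law_exp (s n) (smooth g t)| <= e / 3.
  by apply: law_exp_dist => // x; rewrite distrC.
set h := fun a => law_exp (s n) (fun x => heat t (x - a)) in hn.
have hE a : `|h a - heat (t + v) (m - a)| <= e / 3 / (c * I + 1) by exact: hn.
have A3 : `|law_exp (s n) (smooth g t) - \int[nu]_x smooth g t x| <= e / 3.
  rewrite (law_exp_smooth cg g0 gB)// (gaussian_smooth cg g0 gB)// -mulrBr.
  have i1 : leb.-integrable setT (fun a => (g a * h a)%:E).
    rewrite /h /law_exp; under eq_fun do rewrite mulr_sumr -sumEFin.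
    apply: integrable_sum => // j _.
    under eq_fun do rewrite mulrCA EFinM; apply: integrableZl => //.
    exact: integrable_mul_heat.
  have i2 : leb.-integrable setT (fun a => (g a * heat (t + v) (m - a))%:E).
    by apply: integrable_mul_heat => //; rewrite ltr_wpDr.
  rewrite -RintegralB// normrM (gtr0_norm c0).
  have i3 : leb.-integrable setT (EFin \o (fun a => g a * h a - g a * heat (t + v) (m - a))).
    rewrite (_ : _ \o _ = (fun a => (g a * h a)%:E) \-
      (fun a => (g a * heat (t + v) (m - a))%:E))%E; first exact: integrableB.
    by apply/funext => x; rewrite /= EFinB.
  apply: (@le_trans _ _ (c * (I * (e / 3 / (c * I + 1))))).
    rewrite ler_wpM2l ?(ltW c0)//; apply: (le_trans (le_normr_Rintegral _ i3)) => //.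
    rewrite /I -RintegralZr//; apply: le_Rintegral => //.
    - by have := integrable_norm i3.
    - rewrite (_ : _ \o _ = (fun a => (e / 3 / (c * I + 1))%:E * (EFin \o g) a))%E.
        exact: integrableZl.
      by apply/funext => x; rewrite /= mulrC EFinM.
    - move=> a _; rewrite -mulrBr normrM (ger0_norm (g0 a)) ler_wpM2l//.
  rewrite mulrA mulrCA ler_piMr ?(ltW e30)// ler_pdivrMr// mul1r lerDl ler01//.
have -> : law_exp (s n) g - \int[nu]_x g x =
  (law_exp (s n) g - law_exp (s n) (smooth g t)) +
  (law_exp (s n) (smooth g t) - \int[nu]_x smooth g t x) +
  (\int[nu]_x smooth g t x - \int[nu]_x g x) by ring.
apply: (le_trans (ler_normD _ _)).
have := ler_normD (law_exp (s n) g - law_exp (s n) (smooth g t))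
  (law_exp (s n) (smooth g t) - \int[nu]_x smooth g t x).
lra.
Qed.

(** A bounded nonnegative function is approximated from below by the compactly supported functions
    [g k], which converge to it pointwise. Being below [f], they give a lower bound whatever mass
    the finite laws place far away. *)
Lemma bounded_cvg_lower f B : continuous f -> (forall x, 0 <= f x) ->
  (forall x, f x <= B) -> forall e : R, 0 < e -> \forall n \near \oo,
    \int[nu]_x f x - e <= law_exp (s n) f.
Proof.
move=> cf f0 fB e e0; have e20 : 0 < e / 2 by rewrite divr_gt0.
have mf : measurable_fun setT f by exact: continuous_measurable_fun.
have B0 : 0 <= B by exact: le_trans (f0 0) (fB 0).
pose g (k : nat) x := Num.max 0 (f x - B * `|x| / k.+1%:R).
have gE k x : g k x = (f x - B * `|x| / k.+1%:R + `|f x - B * `|x| / k.+1%:R|) / 2.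
  by rewrite /g maxr_absE add0r sub0r normrN.
have hk0 k x : 0 <= B * `|x| / k.+1%:R by rewrite divr_ge0// mulr_ge0.
have g0 k x : 0 <= g k x by rewrite le_max lexx.
have gf k x : g k x <= f x by rewrite ge_max f0 gerBl hk0.
have gB k x : g k x <= B by exact: le_trans (gf k x) (fB x).
have cg k : continuous (g k).
  move=> x; rewrite /continuous_at (_ : g k = fun x =>
     (f x - B * `|x| / k.+1%:R + `|f x - B * `|x| / k.+1%:R|) / 2); last first.
    by apply/funext => z; exact: gE.
  have c1 : f z - B * `|z| / k.+1%:R @[z --> x] --> f x - B * `|x| / k.+1%:R.
    apply: cvgB; first exact: cf.
    apply: cvgMl; apply: cvgMr; apply: cvg_norm; exact: cvg_id.
  by apply: cvgMl; apply: cvgD => //; apply: cvg_norm.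
have gK k x : k.+1%:R < `|x| -> g k x = 0.
  move=> kx; apply/max_idPl; rewrite subr_le0 (le_trans (fB x))//.
  by rewrite ler_pdivlMr ?ltr0n// ler_wpM2l// ltW.
have [k hk] : exists k, \int[nu]_x f x - e / 2 <= \int[nu]_x g k x.
  have fnorm x : `|f x| <= B by rewrite ger0_norm.
  have gnorm k x : `|g k x| <= B by rewrite ger0_norm.
  have mgk k : measurable_fun setT (g k) by exact: continuous_measurable_fun.
  have g_cvg x : g k x @[k --> \oo] --> f x.
    apply/cvgrPdist_le => r r0; near=> k.
    have : B * `|x| / k.+1%:R <= r.
      rewrite ler_pdivrMr ?ltr0n// -ler_pdivrMl//.
      apply: (@le_trans _ _ k%:R); last by rewrite ler_nat.
      by near: k; exact: nbhs_infty_ger.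
    rewrite ler_norml; have := gf k x; have : f x - B * `|x| / k.+1%:R <= g k x.
      by rewrite le_max lexx orbT.
    have L (y z u q : R) : 0 < q -> u - y <= z -> z <= u -> y <= q -> - q <= u - z <= q.
      by move=> *; apply/andP; split; lra.
    exact: L.
  have [] := @dominated_convergence _ _ _ nu setT measurableT
    (fun k x => (g k x)%:E) (fun x => (f x)%:E) (cst B%:E).
  - by move=> k; apply/measurable_EFinP; exact: mgk.
  - by apply/measurable_EFinP; exact: mf.
  - by apply: aeW => x _; apply: cvg_EFin; [exact: nearW|exact: g_cvg].
  - by have := @integrable_gaussian (cst B) `|B|; apply.
  - by apply: aeW => x k _; rewrite lee_fin.
  move=> _ _ D.
  have {}D : \int[nu]_x g k x @[k --> \oo] --> (\int[nu]_x f x : R).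
    apply: fine_cvg; rewrite /Rintegral fineK; first exact: D.
    exact: (integrable_fin_num measurableT (integrable_gaussian mf fnorm)).
  have /cvgrPdist_le/(_ _ e20) := D; case=> k _ /(_ k (leqnn k)) hk.
  exists k; move: hk; rewrite ler_norml => /andP[_]; lra.
have := compact_support_cvg (cg k) (g0 k) (gB k) (gK k) e20; apply: filterS => n.
rewrite ler_norml => /andP[h _].
have : law_exp (s n) (g k) <= law_exp (s n) f by apply: law_exp_le.
lra.
Unshelve. all: by end_near. Qed.

(** The one-sided bound is applied to the nonnegative functions B - f and B + f; since all total
    masses are 1, the two lower bounds become a two-sided estimate for [f]. *)
Theorem law_weak_cvg f : continuous f -> bounded_fun f ->
  law_exp (s n) f @[n --> \oo] --> (\int[nu]_x f x : R).
Proof.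
move=> cf bf.
have [B fB] : exists B, forall x, `|f x| <= B.
  have [M [_ hM]] := bf; exists (`|M| + 1) => x; apply: hM => //.
  by rewrite (le_lt_trans (ler_norm M))// ltrDl.
have mf : measurable_fun setT f by exact: continuous_measurable_fun.
have If := integrable_gaussian mf fB.
have Ic : nu.-integrable setT (EFin \o cst B).
  by apply: (@integrable_gaussian (cst B) `|B|).
have IB : \int[nu]_x cst B x = B.
  rewrite Rintegral_cst// [X in fine X](@probability_setT _ _ _ nu).
  by rewrite mulr1.
have fB' x : - B <= f x <= B by rewrite -ler_norml.
apply/cvgrPdist_le => e e0.
have up := @bounded_cvg_lower (fun x => B - f x) (B + B) _ _ _ _ e0.
have lo := @bounded_cvg_lower (fun x => B + f x) (B + B) _ _ _ _ e0.
have cB : continuous (fun x : R => B) by move=> x; exact: cvg_cst.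
near=> n.
have hu : \int[nu]_x (B - f x) - e <= law_exp (s n) (fun x => B - f x).
  near: n; apply: up.
  - by move=> x; apply: cvgB; [exact: cvg_cst|exact: cf].
  - by move=> x; case/andP: (fB' x); rewrite subr_ge0.
  - by move=> x; case/andP: (fB' x); lra.
have hl : \int[nu]_x (B + f x) - e <= law_exp (s n) (fun x => B + f x).
  near: n; apply: lo.
  - by move=> x; apply: cvgD; [exact: cvg_cst|exact: cf].
  - by move=> x; case/andP: (fB' x); lra.
  - by move=> x; case/andP: (fB' x); lra.
move: hu hl; rewrite RintegralB// RintegralD// IB !law_expD law_expN law_exp_cst//.
rewrite ler_norml => hu hl; apply/andP; split; lra.
Unshelve. all: by end_near. Qed.

End Criterion.

End WeakConvergence.

(** * Equidistribution and Nystrom extension *)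

(** Takes the place of subsequence arguments: if [P] fails infinitely often, the filter of tails
    restricted to the failures is proper, and an ultrafilter containing it contradicts the
    assumption. *)
Lemma ultra_near (P : set nat) :
  (forall F : set_system nat, UltraFilter F -> F --> \oo -> F P) ->
  \forall n \near \oo, P n.
Proof.
move=> ultraP; apply: contrapT => nP.
have proper_nP : ProperFilter (within (~` P) \oo).
  split; last exact: within_filter.
  move=> /= H; apply: nP; near=> n; apply: contrapT => Pn.
  by move: (Pn); near: n.
have [G [GU sG]] := ultraFilterLemma proper_nP.
have GP : G P by apply: ultraP => // A oA; apply: sG; apply: filterS oA => n An _.
have GnP : G (~` P) by apply: sG; rewrite /within /=; near=> n.
by have /filter_ex[n []] : G (P `&` ~` P) by exact: filterI.
Unshelve. all: by end_near. Qed.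

Lemma ultra_cvg_bounded (R : realType) (F : set_system nat) (x : nat -> R) (M : R) :
  UltraFilter F -> (\forall n \near F, `|x n| <= M) -> exists l : R, x @ F --> l.
Proof.
move=> FU xM.
have cM : compact `[- M, M]%classic by exact: segment_compact.
have xFM : (x @ F) `[- M, M]%classic.
  by apply: filterS xM => n /=; rewrite ler_norml in_itv.
have [p [_ clp]] := cM (x @ F) _ xFM.
exists p => /= V pV; have [//|FnV] := in_ultra_setVsetC (x @^-1` V) FU.
by have [q [/= nVq Vq]] := clp (~` V) V FnV pV.
Qed.

Section Averages.
Context {R : realType}.
Implicit Types (f g h : R -> R) (F : set_system nat).

Definition lipschitz_fun (k : R) f := forall x y : R, `|f x - f y| <= k * `|x - y|.

Definition int01 f : R := \int[lebesgue_measure]_(x in `[0, 1]) f x.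

Lemma lipschitz_fun_continuous k f : lipschitz_fun k f -> continuous f.
Proof.
move=> lf x; apply/cvgrPdist_lt => e e0.
have k0 : 0 < `|k| + 1 by rewrite ltr_wpDl.
near=> y; apply: (le_lt_trans (lf x y)).
apply: (@le_lt_trans _ _ ((`|k| + 1) * `|x - y|)).
  by apply: ler_wpM2r => //; rewrite (le_trans (ler_norm _))// lerDl.
rewrite mulrC -ltr_pdivlMr//; near: y.
by apply: (@nbhsx_ballx _ R^o x); rewrite divr_gt0.
Unshelve. all: by end_near. Qed.

Lemma continuous_integrable01 f :
  continuous f -> lebesgue_measure.-integrable `[0, 1] (EFin \o f).
Proof.
move=> cf; apply: continuous_compact_integrable; first exact: segment_compact.
exact: continuous_subspaceT.
Qed.

Lemma int01_cst (c : R) : int01 (fun=> c) = c.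
Proof.
rewrite /int01 Rintegral_cst//= lebesgue_measure_itv/= lte_fin ltr01 /=.
by rewrite subr0 mulr1.
Qed.

Lemma int01Z (c : R) f : continuous f -> int01 (fun x => c * f x) = c * int01 f.
Proof. by move=> cf; apply: RintegralZl => //; exact: continuous_integrable01. Qed.

Lemma eq_int01 f g : (forall x, 0 <= x <= 1 -> f x = g x) -> int01 f = int01 g.
Proof.
by move=> fg; apply: eq_Rintegral => x; rewrite inE/= in_itv /=; exact: fg.
Qed.

Lemma continuous_bounded01 f : continuous f ->
  exists2 M : R, 0 < M & forall x, 0 <= x <= 1 -> `|f x| <= M.
Proof.
move=> cf; have cI : compact (f @` `[0, 1]%classic).
  apply: continuous_compact; last exact: segment_compact.
  exact: continuous_subspaceT.
have [M [Mr hM]] := compact_bounded cI.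
exists (`|M| + 1); first by rewrite ltr_wpDl.
move=> x x01; apply: (hM (`|M| + 1)); last by exists x => //=; rewrite in_itv.
by rewrite (le_lt_trans (ler_norm _))// ltrDl.
Qed.

Definition mean n (z : 'I_n -> R) : R := n%:R^-1 * \sum_i z i.

Lemma ler_mean n (a b : 'I_n -> R) : (forall i, a i <= b i) -> mean a <= mean b.
Proof.
by move=> ab; apply: ler_wpM2l; rewrite ?invr_ge0//; apply: ler_sum => i _.
Qed.

Lemma mean_cst n (c : R) : (0 < n)%N -> mean (fun _ : 'I_n => c) = c.
Proof.
move=> n0; rewrite /mean sumr_const card_ord -[c *+ n]mulr_natl mulKf//.
by rewrite pnatr_eq0 -lt0n.
Qed.

Lemma meanD n (a b : 'I_n -> R) : mean (fun i => a i + b i) = mean a + mean b.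
Proof. by rewrite /mean big_split mulrDr. Qed.

Lemma meanZ n (c : R) (a : 'I_n -> R) : mean (fun i => c * a i) = c * mean a.
Proof. by rewrite /mean -mulr_sumr mulrCA. Qed.

Lemma ler_norm_mean n (a : 'I_n -> R) : `|mean a| <= mean (fun i => `|a i|).
Proof.
rewrite /mean normrM ger0_norm ?invr_ge0//; apply: ler_wpM2l; rewrite ?invr_ge0//.
exact: ler_norm_sum.
Qed.

Lemma mean_dist n (a b : 'I_n -> R) (e : R) : 0 <= e ->
  (forall i, `|a i - b i| <= e) -> `|mean a - mean b| <= e.
Proof.
move=> e0 ab; have -> : mean a - mean b = mean (fun i => a i + (-1) * b i).
  by rewrite meanD meanZ mulN1r.
apply: (le_trans (ler_norm_mean _)).
case: (posnP n) => [n0|n0].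
  by subst n; rewrite /mean big_ord0 mulr0.
rewrite -[leRHS](mean_cst e n0); apply: ler_mean => i.
by rewrite mulN1r.
Qed.

Section Equidistributed.
Variable u : nat -> R.
Hypothesis u01 : forall i, 0 <= u i <= 1.
Hypothesis equi : forall f, continuous f ->
  mean (fun i : 'I_n => f (u i)) @[n --> \oo] --> int01 f.
Implicit Types z : forall n, 'I_n -> R.

(** Uniform closeness on the sample points only, which is all that averages over the sample can see.
    The array [z] may depend on n in an arbitrary way. *)
Definition tracks F z g :=
  forall e : R, 0 < e -> \forall n \near F, forall i, `|z n i - g (u i)| <= e.

Section Tracking.
Context (F : set_system nat) {FF : ProperFilter F} (Foo : F --> \oo).

Lemma near_gt0 : \forall n \near F, (0 < n)%N.
Proof. by apply: Foo; exists 1%N. Qed.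

Lemma mean_tracks z g : continuous g -> tracks F z g ->
  mean (z n) @[n --> F] --> int01 g.
Proof.
move=> cg zg.
have eF : mean (fun i : 'I_n => g (u i)) @[n --> F] --> int01 g.
  exact: cvg_trans (cvg_app _ Foo) (equi cg).
apply/cvgrPdist_le => e e0; have e2 : 0 < e / 2 by rewrite divr_gt0.
move/cvgrPdist_le : eF => /(_ _ e2) eF.
near=> n.
have h1 : `|int01 g - mean (fun i : 'I_n => g (u i))| <= e / 2 by near: n.
have h2 : `|mean (z n) - mean (fun i : 'I_n => g (u i))| <= e / 2.
  by apply: mean_dist; [exact: ltW|near: n; exact: zg].
have L (a b c : R) : `|a - b| <= e / 2 -> `|c - b| <= e / 2 -> `|a - c| <= e.
  by rewrite !ler_norml; lra.
exact: L h1 h2.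
Unshelve. all: by end_near. Qed.

Lemma tracks_fun g : tracks F (fun n i => g (u i)) g.
Proof.
by move=> e e0; near=> n => i; rewrite subrr normr0 ltW.
Unshelve. all: by end_near. Qed.

Lemma tracks_bounded z g : continuous g -> tracks F z g ->
  exists2 M : R, 0 < M & \forall n \near F, forall i, `|z n i| <= M.
Proof.
move=> cg zg; have [M M0 hM] := continuous_bounded01 cg.
exists (M + 1); first by rewrite addr_gt0.
near=> n => i.
have k : forall i, `|z n i - g (u i)| <= 1 by near: n; exact: zg.
have := k i; have := hM _ (u01 i).
have L (a b c : R) : `|a| <= b -> `|c - a| <= 1 -> `|c| <= b + 1.
  by rewrite !ler_norml; lra.
exact: L.
Unshelve. all: by end_near. Qed.

Lemma tracksM z1 z2 g1 g2 : continuous g1 -> continuous g2 ->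
  tracks F z1 g1 -> tracks F z2 g2 ->
  tracks F (fun n i => z1 n i * z2 n i) (fun x => g1 x * g2 x).
Proof.
move=> c1 c2 h1 h2 e e0.
have [M1 M10 hM1] := tracks_bounded c1 h1.
have [M2 M20 hM2] := continuous_bounded01 c2.
have d1 : 0 < e / 2 / M2 by rewrite !divr_gt0.
have d2 : 0 < e / 2 / M1 by rewrite !divr_gt0.
near=> n => i.
have k1 : forall i, `|z1 n i - g1 (u i)| <= e / 2 / M2 by near: n; exact: h1.
have k2 : forall i, `|z2 n i - g2 (u i)| <= e / 2 / M1 by near: n; exact: h2.
have k3 : forall i, `|z1 n i| <= M1 by near: n.
have -> : z1 n i * z2 n i - g1 (u i) * g2 (u i) =
  z1 n i * (z2 n i - g2 (u i)) + (z1 n i - g1 (u i)) * g2 (u i) by ring.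
apply: (le_trans (ler_normD _ _)); rewrite !normrM.
have a1 := ler_pM (normr_ge0 _) (normr_ge0 _) (k3 i) (k2 i).
have a2 := ler_pM (normr_ge0 _) (normr_ge0 _) (k1 i) (hM2 _ (u01 i)).
apply: (le_trans (lerD a1 a2)).
by rewrite mulrCA divff ?gt_eqF// mulfVK ?gt_eqF// mulr1 -splitr.
Unshelve. all: by end_near. Qed.

Lemma mean_tracksM z1 z2 g1 g2 : continuous g1 -> continuous g2 ->
  tracks F z1 g1 -> tracks F z2 g2 ->
  mean (fun i : 'I_n => z1 n i * z2 n i) @[n --> F] --> int01 (fun x => g1 x * g2 x).
Proof.
move=> c1 c2 h1 h2.
apply: (mean_tracks (z := fun n i => z1 n i * z2 n i)); last exact: tracksM.
by move=> x; apply: continuousM; [exact: c1|exact: c2].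
Qed.

(* Pointwise convergence of equi-Lipschitz functions is uniform on [0, 1]:
   compare with the points of a fine grid. *)
Lemma tracks_equilipschitz (h : nat -> R -> R) (g : R -> R) (k : R) :
  (\forall n \near F, lipschitz_fun k (h n)) ->
  (forall x, h n x @[n --> F] --> g x) ->
  lipschitz_fun k g /\ tracks F (fun n i => h n (u i)) g.
Proof.
move=> lh hg.
have lg : lipschitz_fun k g.
  move=> x y; have cd : `|h n x - h n y| @[n --> F] --> `|g x - g y|.
    by apply: cvg_norm; apply: cvgB; exact: hg.
  rewrite -(cvg_lim _ cd)//; apply: limr_le; first by apply/cvg_ex; eexists; exact: cd.
  by near=> n; have : lipschitz_fun k (h n) by near: n.
split => // e e0.
(* The spacing 1/N makes a Lipschitz error at most e/4; two such errors and the error e/2 at a grid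
   point add up to e. *)
pose N := (Num.truncn ((`|k| + 1) * 4 / e)).+1.
have N0 : 0 < N%:R :> R by [].
have kN : `|k| * N%:R^-1 <= e / 4.
  have : (`|k| + 1) * 4 / e <= N%:R by rewrite ltW// truncnS_gt.
  rewrite ler_pdivrMr// => H.
  rewrite ler_pdivrMr//.
  have L (a b c : R) : (a + 1) * 4 <= b * c -> a <= c / 4 * b by lra.
  exact: L H.
have e2 : 0 < e / 2 by rewrite divr_gt0.
have grid : \forall n \near F, forall j : 'I_N.+1, `|h n (j%:R / N%:R) - g (j%:R / N%:R)| <= e / 2.
  apply: filter_forall => j; have := hg (j%:R / N%:R).
  move/cvgrPdist_le => /(_ _ e2); apply: filterS => n.
  by rewrite distrC.
near=> n => i.
have gr : forall j : 'I_N.+1, `|h n (j%:R / N%:R) - g (j%:R / N%:R)| <= e / 2 by near: n.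
have lhn : lipschitz_fun k (h n) by near: n.
have /andP[ui0 ui1] := u01 i.
have uN0 : 0 <= u i * N%:R by rewrite mulr_ge0.
have jN : (Num.truncn (u i * N%:R) < N.+1)%N.
  rewrite ltnS -(ler_nat R); apply: le_trans (_ : u i * N%:R <= _); first by rewrite truncn_le.
  by rewrite ler_piMl.
have := gr (Ordinal jN); rewrite /=.
set t := (X in h n X); move=> ht.
have ut : `|u i - t| <= N%:R^-1.
  have /andP[q1 q2] := truncn_itv uN0.
  have -> : u i - t = (u i * N%:R - (Num.truncn (u i * N%:R))%:R) * N%:R^-1.
    by rewrite mulrBl mulfK ?lt0r_neq0.
  rewrite normrM [in X in _ * X]ger0_norm ?invr_ge0//.
  rewrite ger_pMl ?invr_gt0// ler_norml.
  rewrite -addn1 natrD in q2.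
  move: q1 q2; have L (a b : R) : a <= b -> b < a + 1%:R -> -1 <= b - a <= 1 by lra.
  exact: L.
have kt : `|k| * `|u i - t| <= e / 4.
  by apply: le_trans kN; apply: ler_wpM2l.
have q1 : `|h n (u i) - h n t| <= e / 4.
  by apply: (le_trans (lhn _ _)); apply: le_trans kt; apply: ler_wpM2r => //; exact: ler_norm.
have q2 : `|g (u i) - g t| <= e / 4.
  by apply: (le_trans (lg _ _)); apply: le_trans kt; apply: ler_wpM2r => //; exact: ler_norm.
have L (a b c d : R) : `|a - b| <= e / 2 -> `|c - a| <= e / 4 -> `|d - b| <= e / 4 ->
   `|c - d| <= e by rewrite !ler_norml; lra.
exact: L ht q1 q2.
Unshelve. all: by end_near. Qed.

Definition kernel_op (K : R -> R -> R) g (x : R) : R := int01 (fun y => K x y * g y).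

Definition lipschitz_kernel (k : R) (K : R -> R -> R) :=
  [/\ forall x y, K x y = K y x, forall x y, `|K x y| <= 1 &
      forall y, lipschitz_fun k (K^~ y)].

(** The zero-diagonal sample matrix acting on [z], divided by n; it differs from the full average by
    a single term of order 1/n. *)
Definition offdiag (K : R -> R -> R) z n (i : 'I_n) : R :=
  n%:R^-1 * \sum_(j | j != i) K (u i) (u j) * z n j.

Lemma lipschitz_kernel_continuous k K x : lipschitz_kernel k K -> continuous (K x).
Proof.
case=> sK _ lK; apply: (@lipschitz_fun_continuous k) => y y'.
by rewrite ![K x _]sK; exact: lK.
Qed.

Lemma offdiagE K z n (i : 'I_n) : offdiag K z i =
  mean (fun j => K (u i) (u j) * z n j) - n%:R^-1 * (K (u i) (u i) * z n i).
Proof.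
by rewrite /offdiag /mean [in RHS](bigD1 i)//= [in RHS]mulrDr addrAC subrr add0r.
Qed.

Lemma invn_cvg0 : (n%:R^-1 : R) @[n --> F] --> (0 : R).
Proof.
apply: (@cvg_trans _ ((n%:R^-1 : R) @[n --> \oo])); first exact: cvg_app Foo.
apply/gtr0_cvgV0; last exact: cvgr_idn.
by exists 1%N => // n /= n0; rewrite ltr0n.
Qed.

Section KernelTracking.
Variables (k : R) (K : R -> R -> R) (z : forall n, 'I_n -> R) (g : R -> R).
Arguments z {n}.
Hypotheses (lK : lipschitz_kernel k K) (cg : continuous g).
Hypothesis zg : tracks F (@z) g.

Lemma mean_kernel_cvg x : mean (fun j : 'I_n => K x (u j) * z j) @[n --> F] --> kernel_op K g x.
Proof.
have cK : continuous (K x) := lipschitz_kernel_continuous lK.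
apply: (mean_tracks (z := fun n j => K x (u j) * z j)).
  by move=> y; apply: continuousM; [exact: cK|exact: cg].
exact: (tracksM cK cg (@tracks_fun (K x))).
Qed.

(** Equidistribution gives convergence at each fixed first argument; the averages inherit the
    Lipschitz bound of [K] in that argument, which makes the convergence uniform over the sample. *)
Lemma tracks_kernel :
  (exists k', lipschitz_fun k' (kernel_op K g)) /\
  tracks F (fun n i => mean (fun j : 'I_n => K (u i) (u j) * z j)) (kernel_op K g).
Proof.
have [M M0 hM] := tracks_bounded cg zg.
have [_ _ lK1] := lK.
have [] := @tracks_equilipschitz
  (fun n x => mean (fun j : 'I_n => K x (u j) * z j)) (kernel_op K g) (`|k| * M).
- near=> n; have zM : forall i : 'I_n, `|z i| <= M by near: n.
  have n0 : (0 < n)%N by near: n; exact: near_gt0.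
  move=> x y; apply: mean_dist; first by rewrite !mulr_ge0// (ltW M0).
  move=> j; rewrite -mulrBl normrM [leRHS]mulrAC; apply: ler_pM => //.
  by apply: (le_trans (lK1 _ _ _)); apply: ler_wpM2r => //; exact: ler_norm.
- exact: mean_kernel_cvg.
- by move=> l1 t1; split => //; eexists; exact: l1.
Unshelve. all: by end_near. Qed.

Lemma kernel_op_continuous : continuous (kernel_op K g).
Proof. by have [[k' l'] _] := tracks_kernel; exact: lipschitz_fun_continuous l'. Qed.

Lemma tracks_offdiag : tracks F (fun n i => offdiag K (@z) i) (kernel_op K g).
Proof.
have [M M0 hM] := tracks_bounded cg zg.
have [_ K1 _] := lK; have [_ t1] := tracks_kernel.
move=> e e0; have e2 : 0 < e / 2 by rewrite divr_gt0.
have d2 : 0 < e / 2 / M by rewrite divr_gt0.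
have /cvgrPdist_le/(_ _ d2) n0 := invn_cvg0.
near=> n => i.
have a1 : forall i : 'I_n, `|mean (fun j : 'I_n => K (u i) (u j) * z j) - kernel_op K g (u i)| <= e / 2.
  by near: n; exact: t1.
have a2 : forall i : 'I_n, `|z i| <= M by near: n.
have a3 : `|0 - n%:R^-1 : R| <= e / 2 / M by near: n.
have a4 : `|n%:R^-1 * (K (u i) (u i) * z i)| <= e / 2.
  rewrite normrM normrM; rewrite sub0r normrN in a3.
  apply: (@le_trans _ _ (e / 2 / M * (1 * M))); last by rewrite mul1r mulfVK ?gt_eqF.
  by apply: ler_pM => //; apply: ler_pM.
rewrite offdiagE; have := a1 i.
have L (a b c : R) : `|c| <= e / 2 -> `|a - b| <= e / 2 -> `|a - c - b| <= e.
  by rewrite !ler_norml; lra.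
exact: L a4.
Unshelve. all: by end_near. Qed.

End KernelTracking.

End Tracking.

Section Nystrom.
Variables (k : R) (K : R -> R -> R).
Hypothesis lK : lipschitz_kernel k K.

Definition sampled_kernel n : 'M[R]_n := kernel_matrix K (initial_segment u n).

Lemma sampled_kernelE n (i j : 'I_n) :
  sampled_kernel n i j = if i == j then 0 else K (u i) (u j).
Proof. by rewrite mxE !tnth_mktuple. Qed.

(** With the factor sqrt n, a unit vector becomes an array of mean square 1, the discrete form of an
    L^2-normalized function. *)
Definition scaled (y : forall n, 'rV[R]_n) n (i : 'I_n) : R := Num.sqrt n%:R * y n 0 i.

Lemma mean_scaled (y w : forall n, 'rV[R]_n) n : (0 < n)%N ->
  mean (fun i : 'I_n => scaled y i * scaled w i) = dot (y n) (w n).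
Proof.
move=> n0; rewrite /dot /mean mulr_sumr; apply: eq_bigr => i _.
rewrite /scaled [X in _ * X]mulrACA -expr2 sqr_sqrtr// mulKf//.
by rewrite pnatr_eq0 -lt0n.
Qed.

Lemma offdiag_scaled (y : forall n, 'rV[R]_n) n (m : R) (i : 'I_n) :
  y n *m sampled_kernel n = m *: y n -> offdiag K (scaled y) i = m / n%:R * scaled y i.
Proof.
move=> /rowP/(_ i); rewrite !mxE => e; rewrite /offdiag /scaled.
rewrite -mulrA [RHS]mulrCA; congr (_ * _).
transitivity (Num.sqrt n%:R * \sum_j y n 0 j * sampled_kernel n j i).
  rewrite mulr_sumr [RHS](bigD1 i)//= sampled_kernelE eqxx !mulr0 add0r.
  apply: eq_bigr => j ji; rewrite sampled_kernelE (negbTE ji).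
  by have [-> _ _] := lK; rewrite mulrCA [K _ _ * _]mulrC.
by rewrite e mulrCA.
Qed.

(* The eigenvector equation extends an eigenvector to a Lipschitz function on
   the line; along an ultrafilter these extensions converge. *)
Lemma nystrom F (y : forall n, 'rV[R]_n) (m : nat -> R) (mu : R) :
  UltraFilter F -> F --> \oo -> 0 < mu ->
  (\forall n \near F, dot (y n) (y n) = 1 /\ y n *m sampled_kernel n = m n *: y n) ->
  m n / n%:R @[n --> F] --> mu ->
  exists g, [/\ exists k', lipschitz_fun k' g, forall x, kernel_op K g x = mu * g x,
    int01 (fun x => g x * g x) = 1 & tracks F (scaled y) g].
Proof.
move=> FU Foo mu0 ev mmu; have [sK K1 lK1] := lK.
pose c n := (m n / n%:R)^-1.
have cmu : c n @[n --> F] --> mu^-1 by apply: cvgV => //; rewrite gt_eqF.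
have [B B0 muB] : exists2 B : R, 0 < B & mu^-1 < B.
  by exists (mu^-1 + 1); rewrite ?addr_gt0 ?invr_gt0 ?ltrDl.
have cB : \forall n \near F, [/\ (0 < n)%N, 0 < c n & c n <= B].
  near=> n; have n0 : (0 < n)%N by near: n; exact: near_gt0.
  have c0 : 0 < c n by near: n; apply: (cvgr_gt _ cmu); rewrite invr_gt0.
  by split => //; near: n; exact: (cvgr_le _ cmu).
(* Mean square 1 bounds the mean absolute value by |a| <= (1 + a^2) / 2; one application of the
   bounded kernel then turns this into a bound on all entries. *)
have z1 : \forall n \near F, mean (fun i : 'I_n => `|scaled y i|) <= 1.
  near=> n.
  have [n0 _ _] : [/\ (0 < n)%N, 0 < c n & c n <= B] by near: n.
  have [yy _] : dot (y n) (y n) = 1 /\ y n *m sampled_kernel n = m n *: y n by near: n.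
  apply: (@le_trans _ _ (mean (fun i : 'I_n => 2^-1 * (1 + scaled y i * scaled y i)))).
    apply: ler_mean => i; have L (a : R) : `|a| <= 2^-1 * (1 + a * a).
      have := sqr_ge0 (`|a| - 1); rewrite sqrrB1 -normrX ger0_norm ?sqr_ge0//.
      by rewrite expr2; lra.
    exact: L.
  by rewrite meanZ meanD mean_cst// mean_scaled// yy; lra.
have zc : \forall n \near F, forall i : 'I_n, scaled y i = c n * offdiag K (scaled y) i.
  near=> n => i.
  have [n0 c0 _] : [/\ (0 < n)%N, 0 < c n & c n <= B] by near: n.
  have [_ yM] : dot (y n) (y n) = 1 /\ y n *m sampled_kernel n = m n *: y n by near: n.
  by rewrite (offdiag_scaled _ yM) mulKf// -invr_eq0 gt_eqF.
have Kz : \forall n \near F, forall x, `|mean (fun j : 'I_n => K x (u j) * scaled y j)| <= 1.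
  near=> n => x; apply: (le_trans (ler_norm_mean _)).
  apply: le_trans (_ : mean (fun i : 'I_n => `|scaled y i|) <= 1); last by near: n.
  by apply: ler_mean => i; rewrite normrM ler_piMl.
have zB : \forall n \near F, forall i : 'I_n, `|scaled y i| <= B.
  near=> n => i.
  have [n0 c0 cb] : [/\ (0 < n)%N, 0 < c n & c n <= B] by near: n.
  have -> : scaled y i = c n * offdiag K (scaled y) i by move: i; near: n.
  rewrite normrM gtr0_norm// -[leRHS]mulr1; apply: ler_pM => //; first exact: ltW.
  rewrite /offdiag normrM ger0_norm ?invr_ge0//.
  apply: le_trans (_ : mean (fun i : 'I_n => `|scaled y i|) <= 1); last by near: n.
  apply: ler_wpM2l; rewrite ?invr_ge0//; apply: (le_trans (ler_norm_sum _ _ _)).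
  rewrite big_mkcond/=; apply: ler_sum => j _; case: ifP => // _.
  by rewrite normrM ler_piMl.
(* The average includes the diagonal term, so that one formula serves every x; at a sample point
   [h n] therefore differs from the eigenvector by a term of order 1/n. *)
pose h n x := c n * mean (fun j : 'I_n => K x (u j) * scaled y j).
have hx x : exists l : R, h n x @[n --> F] --> l.
  apply: (@ultra_cvg_bounded _ _ _ B); near=> n.
  have [n0 c0 cb] : [/\ (0 < n)%N, 0 < c n & c n <= B] by near: n.
  rewrite normrM gtr0_norm// -[leRHS]mulr1; apply: ler_pM => //; first exact: ltW.
  by move: x; near: n.
have [g hg] := choice hx.
have [lg tg] : lipschitz_fun (B * (`|k| * B)) g /\ tracks F (fun n i => h n (u i)) g.
  apply: tracks_equilipschitz => //; near=> n => x x'.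
  have [n0 c0 cb] : [/\ (0 < n)%N, 0 < c n & c n <= B] by near: n.
  rewrite /h -mulrBr normrM gtr0_norm// -mulrA; apply: ler_pM => //; first exact: ltW.
  apply: mean_dist; first by rewrite !mulr_ge0// (ltW B0).
  move=> j; rewrite -mulrBl normrM [leRHS]mulrAC; apply: ler_pM => //.
    by apply: (le_trans (lK1 _ _ _)); apply: ler_wpM2r => //; exact: ler_norm.
  by move: j; near: n.
have cg := lipschitz_fun_continuous lg.
have zg : tracks F (scaled y) g.
  move=> e e0; have e2 : 0 < e / 2 by rewrite divr_gt0.
  have d2 : 0 < e / 2 / (B * B) by rewrite !divr_gt0// mulr_gt0.
  have /cvgrPdist_le/(_ _ d2) n0 := invn_cvg0 Foo.
  near=> n => i.
  have [_ c0 cb] : [/\ (0 < n)%N, 0 < c n & c n <= B] by near: n.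
  have a1 : forall i : 'I_n, `|h n (u i) - g (u i)| <= e / 2 by near: n; exact: tg.
  have a2 : forall i : 'I_n, `|scaled y i| <= B by near: n.
  have a3 : `|0 - n%:R^-1 : R| <= e / 2 / (B * B) by near: n.
  have -> : scaled y i = h n (u i) - c n * (n%:R^-1 * (K (u i) (u i) * scaled y i)).
    rewrite /h -mulrBr -offdiagE.
    by move: {a1} i; near: n.
  have a4 : `|c n * (n%:R^-1 * (K (u i) (u i) * scaled y i))| <= e / 2.
    rewrite normrM [X in _ * X]normrM [X in _ * (_ * X)]normrM.
    rewrite sub0r normrN in a3.
    apply: (@le_trans _ _ (B * (e / 2 / (B * B) * (1 * B)))).
      apply: ler_pM => //; first by rewrite gtr0_norm.
      by apply: ler_pM => //; apply: ler_pM.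
    by rewrite mul1r mulrCA mulfVK// mulf_neq0 ?gt_eqF.
  have := a1 i.
  have L (a b d : R) : `|d| <= e / 2 -> `|a - b| <= e / 2 -> `|a - d - b| <= e.
    by rewrite !ler_norml; lra.
  exact: L a4.
exists g; split => //; first by eexists; exact: lg.
- move=> x.
  have h1 : h n x @[n --> F] --> mu^-1 * kernel_op K g x.
    by apply: cvgM => //; exact: mean_kernel_cvg.
  have -> : g x = mu^-1 * kernel_op K g x by exact: (cvg_unique _ (hg x) h1).
  by rewrite mulVKf ?gt_eqF.
- have h1 : mean (fun i : 'I_n => scaled y i * scaled y i) @[n --> F] --> int01 (fun x => g x * g x).
    exact: mean_tracksM.
  suff h2 : mean (fun i : 'I_n => scaled y i * scaled y i) @[n --> F] --> (1 : R).
    exact: (cvg_unique _ h1 h2).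
  apply: cvg_near_cst; near=> n; have [n0 _ _] : [/\ (0 < n)%N, 0 < c n & c n <= B] by near: n.
  rewrite mean_scaled//.
  by have [] : dot (y n) (y n) = 1 /\ y n *m sampled_kernel n = m n *: y n by near: n.
Unshelve. all: by end_near. Qed.

End Nystrom.
End Equidistributed.
End Averages.

(** * Spectral limits *)

Lemma dot_sampled_le (R : realType) n (M : 'M[R]_n) (z : 'rV[R]_n) :
  (forall i j, 0 <= M i j <= 1) -> `|dot (z *m M) z| <= n%:R * dot z z.
Proof.
move=> M01; rewrite dot_mulmx.
apply: (@le_trans _ _ (\sum_i \sum_j (z 0 i ^+ 2 / 2 + z 0 j ^+ 2 / 2))).
  apply: (le_trans (ler_norm_sum _ _ _)); apply: ler_sum => i _.
  apply: (le_trans (ler_norm_sum _ _ _)); apply: ler_sum => j _.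
  have := M01 i j; have L (a b c : R) : 0 <= b <= 1 -> `|a * b * c| <= a ^+ 2 / 2 + c ^+ 2 / 2.
    move=> /andP[b0 b1]; rewrite mulrAC normrM (ger0_norm b0).
    apply: (@le_trans _ _ `|a * c|); first by rewrite ler_piMr.
    have := sqr_ge0 (a - c); have := sqr_ge0 (a + c); rewrite ler_norml.
    by rewrite sqrrD sqrrB; lra.
  exact: L.
have -> : \sum_i \sum_j (z 0 i ^+ 2 / 2 + z 0 j ^+ 2 / 2) =
    n%:R * (\sum_i z 0 i ^+ 2 / 2) + n%:R * (\sum_j z 0 j ^+ 2 / 2).
  under eq_bigr do rewrite big_split /= sumr_const card_ord -[_ *+ n]mulr_natl.
  rewrite big_split /= -mulr_sumr; congr (_ + _).
  by rewrite sumr_const card_ord mulr_natl.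
rewrite -mulrDr /dot -mulr_suml -splitr.
by under [in leRHS]eq_bigr do rewrite -expr2.
Qed.

Lemma scaled_sqr (R : realType) (v : forall n, 'rV[R]_n) n (i : 'I_n) :
  scaled v i * scaled v i = n%:R * v n 0 i ^+ 2.
Proof. by rewrite /scaled mulrACA -expr2 sqr_sqrtr. Qed.

Section SpectralLimits.
Context {R : realType}.
Variables (u : nat -> R) (k : R) (K : R -> R -> R) (lam0 lam1 : R) (phi : R -> R).
Hypothesis u01 : forall i, 0 <= u i <= 1.
Hypothesis equi : forall f : R -> R, continuous f ->
  mean (fun i : 'I_n => f (u i)) @[n --> \oo] --> int01 f.
Hypotheses (lK : lipschitz_kernel k K) (K01 : forall x y, 0 <= K x y <= 1).

(** The functions that arise as Nystrom limits. The assumptions on the spectrum below are stated for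
    them alone. *)
Definition lipschitz_eigenfunction (mu : R) (g : R -> R) :=
  [/\ exists k', lipschitz_fun k' g, forall x, kernel_op K g x = mu * g x &
      int01 (fun x => g x * g x) = 1].

Hypotheses (lam1_ge0 : 0 <= lam1) (lam10 : lam1 < lam0).
Hypothesis eig_phi : lipschitz_eigenfunction lam0 phi.
Hypothesis eig_values : forall (mu : R) g, 0 < mu -> lipschitz_eigenfunction mu g ->
  mu = lam0 \/ mu <= lam1.
Hypothesis eig_simple : forall g, lipschitz_eigenfunction lam0 g ->
  exists2 s : R, s ^+ 2 = 1 & forall x, g x = s * phi x.

Local Notation M := (sampled_kernel u K).

Variables (l : nat -> R) (v : forall n, 'rV[R]_n).
Hypothesis top_v : forall n, (0 < n)%N -> top_eigenpair (M n) (l n) (v n).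

Let lam0_gt0 : 0 < lam0. Proof. exact: le_lt_trans lam10. Qed.

Let cphi : continuous phi.
Proof. by have [[k' l'] _ _] := eig_phi; exact: lipschitz_fun_continuous l'. Qed.

Lemma sampled_kernel_sym n : (M n)^T = M n.
Proof.
apply/matrixP => i j; rewrite mxE !sampled_kernelE eq_sym; case: eqP => // _.
by have [-> _ _] := lK.
Qed.

Lemma sampled_kernel01 n (i j : 'I_n) : 0 <= M n i j <= 1.
Proof. by rewrite sampled_kernelE; case: eqP => _; rewrite ?lexx ?ler01 ?K01. Qed.

Lemma top_eig_norm_le n : (0 < n)%N -> `|l n| <= n%:R.
Proof.
move=> n0; have [vv vM _] := top_v n0.
have := dot_sampled_le (v n) (@sampled_kernel01 n).
by rewrite vM dotZl vv !mulr1.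
Qed.

Lemma sampled_form (x : R -> R) n : (0 < n)%N ->
  dot ((\row_(i < n) x (u i)) *m M n) (\row_i x (u i)) =
  n%:R ^+ 2 * mean (fun i : 'I_n => x (u i) * offdiag u K (fun n i => x (u i)) i).
Proof.
move=> n0; have nn : n%:R != 0 :> R by rewrite pnatr_eq0 -lt0n.
rewrite dot_mulmx /mean expr2 mulrA mulfK// mulr_sumr; apply: eq_bigr => i _.
rewrite /offdiag mulrCA [X in _ = _ * X]mulrA mulfV// mul1r mulr_sumr.
rewrite (bigD1 i)//= sampled_kernelE eqxx mulr0 mul0r add0r.
apply: eq_bigr => j ji; rewrite sampled_kernelE eq_sym (negbTE ji) !mxE.
by rewrite mulrA.
Qed.

(** Along an ultrafilter l/n has a limit mu. The trial vector with entries phi (u i) shows mu >=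
    lam0 > 0; positivity lets [nystrom] identify mu as an eigenvalue, and the values at most lam1
    are excluded by the lower bound. *)
Lemma top_eig_cvg : l n / n%:R @[n --> \oo] --> lam0.
Proof.
apply/cvgrPdist_le => e e0; apply: ultra_near => F FU Foo.
have FF : ProperFilter F by exact: ultra_proper.
have [mu lmu] : exists mu : R, l n / n%:R @[n --> F] --> mu.
  apply: (@ultra_cvg_bounded _ _ _ 1); near=> n.
  have n0 : (0 < n)%N by near: n; exact: near_gt0.
  by rewrite normrM normfV normr_nat ler_pdivrMr ?ltr0n// mul1r top_eig_norm_le.
have [lphi eqphi phi1] := eig_phi.
have tphi : tracks u F (fun n (i : 'I_n) => phi (u i)) phi by exact: tracks_fun.
have cvg_num : mean (fun i : 'I_n => phi (u i) * offdiag u K (fun n i => phi (u i)) i)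
    @[n --> F] --> lam0.
  have -> : lam0 = int01 (fun x => phi x * kernel_op K phi x).
    rewrite -[lam0]mulr1 -phi1 -int01Z; last by move=> x; apply: continuousM; exact: cphi.
    by apply: eq_int01 => x _; rewrite eqphi mulrCA.
  have cop := kernel_op_continuous u01 equi (FF := FF) Foo lK cphi tphi.
  have toff := tracks_offdiag u01 equi (FF := FF) Foo lK cphi tphi.
  exact: (mean_tracksM u01 equi Foo cphi cop tphi toff).
have cvg_den : mean (fun i : 'I_n => phi (u i) * phi (u i)) @[n --> F] --> (1 : R).
  by rewrite -phi1; exact: (mean_tracksM u01 equi Foo cphi cphi tphi tphi).
have lam0mu : lam0 <= mu.
  have c2 : (l n / n%:R) * mean (fun i : 'I_n => phi (u i) * phi (u i)) @[n --> F] --> mu * 1.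
    exact: cvgM.
  rewrite -[mu]mulr1 -(cvg_lim _ c2)// -(cvg_lim _ cvg_num)//.
  apply: ler_lim; [by apply/cvg_ex; eexists; exact: cvg_num|by apply/cvg_ex; eexists; exact: c2|].
  near=> n; have n0 : (0 < n)%N by near: n; exact: near_gt0.
  have [_ _ /(_ (\row_i phi (u i)))] := top_v n0.
  rewrite sampled_form//.
  have -> : dot (\row_(i < n) phi (u i)) (\row_i phi (u i)) =
      n%:R * mean (fun i : 'I_n => phi (u i) * phi (u i)).
    rewrite /mean mulVKf ?pnatr_eq0 -?lt0n//.
    by apply: eq_bigr => i _; rewrite !mxE.
  have L (N a b c : R) : 0 < N -> N ^+ 2 * a <= c * (N * b) -> a <= c / N * b.
    move=> N0 h; rewrite mulrAC ler_pdivlMr// -(ler_pM2l N0).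
    by move: h; rewrite expr2 (mulrCA c) -!mulrA (mulrC a).
  by apply: L; rewrite ltr0n.
have mu0 : 0 < mu by exact: lt_le_trans lam0mu.
have [] := nystrom u01 equi lK (y := v) FU Foo mu0 _ lmu.
  near=> n; have n0 : (0 < n)%N by near: n; exact: near_gt0.
  by have [] := top_v n0.
move=> g [lg eg g1 _].
have [|E|E] := @eig_values mu g mu0.
- by split.
- by rewrite -E; move/cvgrPdist_le : lmu; apply.
- by have := lt_le_trans lam10 (le_trans lam0mu E); rewrite ltxx.
Unshelve. all: by end_near. Qed.

Lemma tracks_top F : UltraFilter F -> F --> \oo ->
  exists2 s : R, s ^+ 2 = 1 & tracks u F (scaled v) (fun x => s * phi x).
Proof.
move=> FU Foo.
have lF : l n / n%:R @[n --> F] --> lam0 by exact: cvg_trans (cvg_app _ Foo) top_eig_cvg.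
have [] := nystrom u01 equi lK (y := v) FU Foo lam0_gt0 _ lF.
  near=> n; have n0 : (0 < n)%N by near: n; exact: near_gt0.
  by have [] := top_v n0.
move=> g [lg eg g1 tg]; have [|s s1 gs] := @eig_simple g; first by split.
exists s => // e e0; have := tg e e0; apply: filterS => n h i.
by rewrite -gs.
Unshelve. all: by end_near. Qed.

(** The sign [s] of [tracks_top] depends on the ultrafilter; squaring removes it, so the statement
    holds along the whole sequence. *)
Lemma tracks_top_sqr :
  tracks u \oo (fun n i => scaled v i * scaled v i) (fun x => phi x * phi x).
Proof.
move=> e e0; apply: ultra_near => F FU Foo.
have FF : ProperFilter F by exact: ultra_proper.
have [s s1 ts] := tracks_top FU Foo.
have cs : continuous (fun x => s * phi x).
  by move=> x; apply: continuousM; [exact: cvg_cst|exact: cphi].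
have := tracksM u01 (FF := FF) cs cs ts ts e0; apply: filterS => n h i.
by have := h i; rewrite [s * _ * _]mulrACA -[s * s]expr2 s1 mul1r.
Qed.

(** The deflated matrix [N] removes the top eigenvector. If its top eigenvalue over n had a limit mu
    > lam1, its eigenvector [y] would be orthogonal to [v] and an eigenvector of [M]; the Nystrom
    limit of [y] then forces mu = lam0 and is phi up to sign, as is the limit of [v], against
    orthogonality. *)
Lemma spectral_gap : \forall n \near \oo, forall z, dot z (v n) = 0 ->
  dot (z *m M n) z <= (l n - (lam0 - lam1) / 2 * n%:R) * dot z z.
Proof.
pose N n := M n - l n *: ((v n)^T *m v n).
have symN n : (N n)^T = N n.
  by rewrite /N linearB linearZ /= trmx_mul trmxK sampled_kernel_sym.
have zNE n (z : 'rV_n) : z *m N n = z *m M n - (l n * dot z (v n)) *: v n.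
  rewrite /N mulmxBr -scalemxAr mulmxA; congr (_ - _).
  have -> : z *m (v n)^T = (dot z (v n))%:M.
    apply/matrixP => i j; rewrite !ord1 !mxE eqxx mulr1n /dot.
    by apply: eq_bigr => q _; rewrite !mxE.
  by rewrite mul_scalar_mx scalerA.
have vN0 n : (0 < n)%N -> v n *m N n = 0.
  by move=> n0; have [vv vM _] := top_v n0; rewrite zNE vv vM mulr1 subrr.
have exN n : exists my : R * 'rV[R]_n, (0 < n)%N -> top_eigenpair (N n) my.1 my.2.
  case: (posnP n) => [->|n0]; first by exists (0, 0).
  by have [m [y]] := ex_top_eigenpair_gt0 n0 (symN n); exists (m, y).
pose m n := (sval (cid (exN n))).1; pose y n := (sval (cid (exN n))).2.
have top_y n : (0 < n)%N -> top_eigenpair (N n) (m n) (y n) := svalP (cid (exN n)).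
move: m y top_y => m y top_y.
(* One quarter is lost in the upper bound for m/n and one in the lower bound for l/n, leaving half
   of the gap. *)
pose dl := (lam0 - lam1) / 4.
have dl0 : 0 < dl by rewrite divr_gt0// subr_gt0.
have mle : \forall n \near \oo, m n / n%:R <= lam1 + dl.
  apply: ultra_near => F FU Foo; have FF : ProperFilter F by exact: ultra_proper.
  have [mu mmu] : exists mu : R, m n / n%:R @[n --> F] --> mu.
    apply: (@ultra_cvg_bounded _ _ _ 2); near=> n.
    have n0 : (0 < n)%N by near: n; exact: near_gt0.
    have [yy yN _] := top_y n n0; have [vv _ _] := top_v n0.
    rewrite normrM normfV normr_nat ler_pdivrMr ?ltr0n//.
    have -> : m n = dot (y n *m N n) (y n) by rewrite yN dotZl yy mulr1.
    rewrite zNE dotDl dotNl dotZl (dotC (v n)) -mulrA -expr2.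
    have h1 := dot_sampled_le (y n) (@sampled_kernel01 n); rewrite yy mulr1 in h1.
    have h2 := dot_CS (y n) (v n); rewrite yy vv mulr1 in h2.
    have h3 : `|l n * dot (y n) (v n) ^+ 2| <= n%:R.
      rewrite normrM [X in _ * X]ger0_norm ?sqr_ge0// -[leRHS]mulr1.
      by apply: ler_pM => //; [exact: sqr_ge0|exact: top_eig_norm_le].
    apply: (le_trans (ler_normB _ _)); have := lerD h1 h3.
    by rewrite -mulr2n mulr_natl.
  have [mule|] := leP mu lam1.
    near=> n; near: n; apply: (cvgr_le _ mmu).
    by apply: (le_lt_trans mule); rewrite ltrDl.
  move=> lam1mu; have mu0 : 0 < mu by exact: le_lt_trans lam1mu.
  have ym : \forall n \near F, [/\ dot (y n) (y n) = 1, y n *m M n = m n *: y n &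
      dot (y n) (v n) = 0].
    near=> n; have n0 : (0 < n)%N by near: n; exact: near_gt0.
    have [yy yN _] := top_y n n0.
    have m0 : 0 < m n.
      have : 0 < m n / n%:R by near: n; exact: (cvgr_gt _ mmu).
      by rewrite pmulr_lgt0// invr_gt0 ltr0n.
    have yv : dot (y n) (v n) = 0.
      have : m n * dot (y n) (v n) = 0.
        by rewrite -dotZl -yN dot_sym// vN0// -(scale0r 0) dotZr mul0r.
      by move/eqP; rewrite mulf_eq0 gt_eqF//= => /eqP.
    by split => //; have := zNE n (y n); rewrite yv mulr0 scale0r subr0 => <-.
  have [] := nystrom u01 equi lK (y := y) FU Foo mu0 _ mmu.
    by apply: filterS ym => n [].
  move=> g [lg eg g1 tg].
  have [|E|E] := @eig_values mu g mu0; first by split.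
  - have [|s s1 gs] := @eig_simple g; first by split => //; rewrite -E.
    have [t t1 tt] := tracks_top FU Foo.
    have cg : continuous g by case: lg => k' /lipschitz_fun_continuous.
    have ct : continuous (fun x => t * phi x).
      by move=> x; apply: continuousM; [exact: cvg_cst|exact: cphi].
    have h1 := mean_tracksM u01 equi (FF := FF) Foo cg ct tg tt.
    have h2 : mean (fun i : 'I_n => scaled y i * scaled v i) @[n --> F] --> (0 : R).
      apply: cvg_near_cst; near=> n; have n0 : (0 < n)%N by near: n; exact: near_gt0.
      rewrite mean_scaled//.
      by have [] : [/\ dot (y n) (y n) = 1, y n *m M n = m n *: y n &
        dot (y n) (v n) = 0] by near: n.
    have : int01 (fun x => g x * (t * phi x)) = s * t.
      rewrite -[RHS]mulr1; have [_ _ <-] := eig_phi.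
      rewrite -int01Z; last by move=> x; apply: continuousM; exact: cphi.
      by apply: eq_int01 => x _; rewrite gs mulrACA.
    have -> : int01 (fun x => g x * (t * phi x)) = 0 by exact: (cvg_unique _ h1 h2).
    move/eqP; rewrite eq_sym mulf_eq0 => /orP[]/eqP st.
      by move: s1; rewrite st expr0n => /eqP; rewrite eq_sym oner_eq0.
    by move: t1; rewrite st expr0n => /eqP; rewrite eq_sym oner_eq0.
  - by have := lt_le_trans lam1mu E; rewrite ltxx.
near=> n => z zv; have n0 : (0 < n)%N by near: n; exists 1%N.
have [_ _ /(_ z)] := top_y n n0; rewrite zNE zv mulr0 scale0r subr0 => h.
apply: (le_trans h); apply: ler_wpM2r; first exact: dot_ge0.
have h1 : m n / n%:R <= lam1 + dl by near: n.
have h2 : lam0 - dl <= l n / n%:R.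
  by near: n; apply: (cvgr_ge _ top_eig_cvg); rewrite ltrBlDr ltrDl.
have nR : 0 < n%:R :> R by rewrite ltr0n.
rewrite ler_pdivrMr// in h1; rewrite ler_pdivlMr// in h2.
apply: (le_trans h1); rewrite lerBrDr; apply: le_trans h2.
by rewrite -mulrDl; apply: ler_wpM2r => //; rewrite /dl; lra.
Unshelve. all: by end_near. Qed.

Definition variance_kernel (x y : R) := K x y * (1 - K x y).

(** The map p -> p (1 - p) is 1-Lipschitz on [0, 1], so the constant [k] is kept. *)
Lemma lipschitz_variance_kernel : lipschitz_kernel k variance_kernel.
Proof.
have [sK K1 lK1] := lK; split.
- by move=> x y; rewrite /variance_kernel sK.
- move=> x y; rewrite /variance_kernel normrM -[leRHS]mulr1; apply: ler_pM => //.
  by have := K01 x y; rewrite ler_norml; lra.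
- move=> y x x'; apply: le_trans (lK1 y x x'); rewrite /variance_kernel.
  have -> : K x y * (1 - K x y) - K x' y * (1 - K x' y) =
    (K x y - K x' y) * (1 - K x y - K x' y) by ring.
  rewrite normrM ler_piMr//.
  by have := K01 x y; have := K01 x' y; rewrite ler_norml; lra.
Qed.

Local Notation z := (fun n i => scaled v i * scaled v i).
Local Notation phi2 := (fun x => phi x * phi x).

Let cphi2 : continuous phi2.
Proof. by move=> x; apply: continuousM; exact: cphi. Qed.

Let cop : continuous (kernel_op variance_kernel phi2).
Proof.
exact: (kernel_op_continuous u01 equi (FF := eventually_filter) (fun A h => h) lipschitz_variance_kernel cphi2 tracks_top_sqr).
Qed.

Lemma mean_sqr_cvg : mean_sqr (M n) (v n) / l n @[n --> \oo] -->
  lam0^-1 * int01 (kernel_op variance_kernel phi2).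
Proof.
have toff := tracks_offdiag u01 equi (FF := eventually_filter) (fun A h => h)
  lipschitz_variance_kernel cphi2 tracks_top_sqr.
have h := mean_tracks equi (FF := eventually_filter) (fun A h => h) cop toff.
have hl : (l n / n%:R)^-1 @[n --> \oo] --> lam0^-1.
  by apply: cvgV; [exact: lt0r_neq0|exact: top_eig_cvg].
have hlh : (l n / n%:R)^-1 * mean (offdiag u variance_kernel z (n := n)) @[n --> \oo] -->
  lam0^-1 * int01 (kernel_op variance_kernel phi2) by exact: cvgM.
apply: cvg_trans hlh; apply: near_eq_cvg; near=> n.
have n0 : (0 < n)%N by near: n; exists 1%N.
have nn : n%:R != 0 :> R by rewrite pnatr_eq0 -lt0n.
rewrite /= invf_div mulrAC; congr (_ / _).
rewrite /mean mulVKf// /mean_sqr; apply: eq_bigr => i _.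
rewrite /offdiag mulr_sumr; apply: eq_bigr => j ji.
rewrite !sampled_kernelE (negbTE ji) /variance_kernel.
have [sK _ _] := lK; rewrite (sK (u j)).
by rewrite scaled_sqr mulrCA mulKf// mulrC.
Unshelve. all: by end_near. Qed.

Lemma quad_var_cvg :
  2 * (\sum_i \sum_(j | j != i) v n 0 i ^+ 2 * v n 0 j ^+ 2 * (M n i j * (1 - M n i j)))
    @[n --> \oo] --> 2 * int01 (fun x => phi2 x * kernel_op variance_kernel phi2 x).
Proof.
have toff := tracks_offdiag u01 equi (FF := eventually_filter) (fun A h => h)
  lipschitz_variance_kernel cphi2 tracks_top_sqr.
have h := mean_tracksM u01 equi (FF := eventually_filter) (fun A h => h) cphi2 cop tracks_top_sqr toff.
apply: cvgM; first exact: cvg_cst.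
apply: cvg_trans h; apply: near_eq_cvg; near=> n.
have n0 : (0 < n)%N by near: n; exists 1%N.
have nn : n%:R != 0 :> R by rewrite pnatr_eq0 -lt0n.
rewrite /mean mulr_sumr; apply: eq_bigr => i _.
rewrite /offdiag scaled_sqr !mulr_sumr.
apply: eq_bigr => j ji; rewrite sampled_kernelE eq_sym (negbTE ji) /variance_kernel.
rewrite scaled_sqr.
have L (a b c q : R) : q != 0 -> q^-1 * (q * a * (q^-1 * (c * (q * b)))) = a * b * c.
  by move=> q0; field.
exact: L.
Unshelve. all: by end_near. Qed.

End SpectralLimits.

(** * The central limit theorem for an equidistributed sample *)

Lemma le_of_sum4 (R : realType) (A B D E : R) :
  A + 1 + B + D <= E -> 0 <= A -> 0 <= B -> 0 <= D ->
  [/\ 1 <= E, A <= E, B <= E & D <= E].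
Proof. by split; lra. Qed.

Lemma quad_var_ge0 (R : realType) n (S : 'M[R]_n) (v : 'rV[R]_n) :
  (forall i j, 0 <= S i j <= 1) ->
  0 <= 2 * (\sum_i \sum_(j | j != i) v 0 i ^+ 2 * v 0 j ^+ 2 * (S i j * (1 - S i j))).
Proof.
move=> S01; rewrite mulr_ge0// sumr_ge0// => i _; apply: sumr_ge0 => j _.
have /andP[q1 q2] := S01 i j; apply: mulr_ge0; last by rewrite mulr_ge0// subr_ge0.
by apply: mulr_ge0; exact: sqr_ge0.
Qed.

(** [C] depends on [t] alone, and the bound is the same for all translations [a], as the weak
    convergence criterion demands. The five summands are the error of the expansion, its exceptional
    event, the Lindeberg error, and the errors in variance and mean. *)
Lemma heat_graph_bound (R : realType) (t : R) : 0 < t ->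
  exists2 C : R, 0 < C & forall n (S : 'M[R]_n) (v : 'rV[R]_n) (l g c k r m s a : R),
  S^T = S -> (forall i, S i i = 0) -> (forall i j, 0 <= S i j <= 1) ->
  dot v v = 1 -> v *m S = l *: v ->
  (forall z, dot z v = 0 -> dot (z *m S) z <= (l - g) * dot z z) ->
  0 < c <= 1 -> 1 <= k -> 8 <= c * k ^+ 3 -> k ^+ 16 = n%:R ->
  c * k ^+ 16 <= l <= k ^+ 16 -> c * k ^+ 16 <= g ->
  0 <= r -> (forall i, v 0 i ^+ 2 <= r) -> 0 <= s ->
  `|bexp (edge_prob S) (fun w => heat t (lambda_max (graph_mx w) - l - a))
    - heat (t + s) (m - a)| <=
  C * (18 / c ^+ 4 / k + 27 / k + r +
    `|2 * (\sum_i \sum_(j | j != i) v 0 i ^+ 2 * v 0 j ^+ 2 * (S i j * (1 - S i j))) - s| +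
    `|mean_sqr S v / l - m|).
Proof.
move=> t0; have [K0 K00 hK0] := heat_bounds t0.
have [K1 K10 hK1] := heat_step t0; have [K2 K20 hK2] := heat_lip t0.
have hh (x : R) : 0 <= heat t x <= K0.
  by have [h _ _ _ _] := hK0 t x (lexx t); rewrite h andbT; exact/ltW/heat_gt0.
exists (2 * K0 + 4 * K1 + K2); first by rewrite !addr_gt0// mulr_gt0.
move=> n S v l g c k r m s a sS S0 S01 v1 vS gap c01 k1 ck kn l01 cg r0 vr s0.
have p01 := edge_prob01 S01.
have fluct := top_eig_fluctuation sS S0 S01 v1 vS gap c01 k1 ck kn l01 cg.
have lind := lindeberg_swap p01 (form_coef_quad_le1 v1) hK1 (mean_sqr S v / l - a) (lexx t).
rewrite quad_var// in lind.
have cube := sum_form_coef_cube_le v1 r0 vr.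
move: lind; set Q := 2 * _; set b := mean_sqr S v / l => lind.
pose X (w : {ffun 'I_n * 'I_n -> bool}) := lambda_max (graph_mx w) - l.
pose del := 18 / c ^+ 4 / k; rewrite -/del in fluct *.
have k0 : 0 < k by exact: lt_le_trans k1.
have c0 : 0 < c by case/andP: c01.
have del0 : 0 <= del by rewrite /del !divr_ge0 ?exprn_ge0 ?ltW.
have ptw w : `|heat t (X w - a) - heat t (b - a + \sum_e
    form_coef (fun i j : 'I_n => v 0 i * v 0 j) e * eps (edge_prob S) e w)| <=
    K2 * del + 2 * K0 * (del < `|X w - dot (v *m noise S w) v - b|)%R%:R.
  rewrite -quad_form; case: ltP => h /=.
    have L (x y d : R) : 0 <= x <= K0 -> 0 <= y <= K0 -> 0 <= d -> `|x - y| <= d + 2 * K0 * 1.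
      by rewrite ler_norml; lra.
    by apply: L; rewrite ?hh// mulr_ge0// (ltW K20).
  rewrite mulr0 addr0; apply: (le_trans (hK2 _ _ _ _ (lexx t) (lexx t))).
  rewrite subrr normr0 add0r; apply: ler_wpM2l; first exact: ltW.
  have L (x y p q : R) : x - y - (p - y + q) = x - q - p by ring.
  by rewrite L.
have h1 : `|bexp (edge_prob S) (fun w => heat t (X w - a)) -
    bexp (edge_prob S) (fun w => heat t (b - a + \sum_e
      form_coef (fun i j : 'I_n => v 0 i * v 0 j) e * eps (edge_prob S) e w))| <=
    K2 * del + 2 * K0 * (27 / k).
  rewrite -bexpB; apply: (le_trans (ler_norm_bexp p01 _)).
  apply: (le_trans (ler_bexp p01 ptw)).
  rewrite bexpD bexp_cst lerD2l bexpZ; apply: ler_wpM2l; first by rewrite mulr_ge0// (ltW K00).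
  exact: fluct.
have h2 : `|heat (t + Q) (b - a) - heat (t + s) (m - a)| <= K2 * (`|Q - s| + `|b - m|).
  have Q0 : 0 <= Q by exact: quad_var_ge0.
  have -> : Q - s = (t + Q) - (t + s) by ring.
  have -> : b - m = (b - a) - (m - a) by ring.
  by apply: hK2; rewrite lerDl.
have h3 := ler_wpM2l (ltW K10) cube.
apply: (le_trans (ler_distD (heat (t + Q) (b - a)) _ _)).
apply: (le_trans (lerD (ler_distD _ _ _) h2)).
apply: (le_trans (lerD (lerD h1 lind) (lexx _))).
apply: (le_trans (lerD (lerD (lexx _) h3) (lexx _))).
have k27 : 0 <= 27 / k by rewrite divr_ge0// ltW.
have L (A B C D E : R) : 0 <= A -> 0 <= B -> 0 <= C -> 0 <= D -> 0 <= E ->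
   K2 * A + 2 * K0 * B + K1 * (4 * C) + K2 * (D + E) <=
   (2 * K0 + 4 * K1 + K2) * (A + B + C + D + E).
  move=> A0 B0 C0 D0 E0.
  have := mulr_ge0 (ltW K00) (addr_ge0 (addr_ge0 A0 C0) (addr_ge0 D0 E0)).
  have := mulr_ge0 (ltW K10) (addr_ge0 (addr_ge0 A0 B0) (addr_ge0 D0 E0)).
  have := mulr_ge0 (ltW K20) (addr_ge0 B0 C0).
  by lra.
by apply: L.
Qed.

Definition graph_law (R : realType) n (S : 'M[R]_n) : seq (R * R) :=
  [seq (bern_wt (edge_prob S) w, lambda_max (graph_mx w) - lambda_max S)
    | w <- index_enum {ffun 'I_n * 'I_n -> bool}].

Lemma graph_law_exp (R : realType) n (S : 'M[R]_n) (f : R -> R) :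
  law_exp (graph_law S) f =
  bexp (edge_prob S) (fun w => f (lambda_max (graph_mx w) - lambda_max S)).
Proof. by rewrite /law_exp big_map. Qed.

Lemma graph_law_is_law (R : realType) n (S : 'M[R]_n) :
  (forall i j, 0 <= S i j <= 1) -> is_law (graph_law S).
Proof.
move=> S01; apply/andP; split; last by rewrite big_map bern_wt_sum.
by apply/allP => x /mapP[w _ ->] /=; apply: bern_wt_ge0; exact: edge_prob01.
Qed.

Section GraphCLT.
Context {R : realType}.
Variables (u : nat -> R) (k : R) (K : R -> R -> R) (lam0 lam1 : R) (phi : R -> R).
Hypothesis u01 : forall i, 0 <= u i <= 1.
Hypothesis equi : forall f : R -> R, continuous f ->
  mean (fun i : 'I_n => f (u i)) @[n --> \oo] --> int01 f.
Hypotheses (lK : lipschitz_kernel k K) (K01 : forall x y, 0 <= K x y <= 1).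
Hypotheses (lam1_ge0 : 0 <= lam1) (lam10 : lam1 < lam0).
Hypothesis eig_phi : lipschitz_eigenfunction K lam0 phi.
Hypothesis eig_values : forall (mu : R) g, 0 < mu -> lipschitz_eigenfunction K mu g ->
  mu = lam0 \/ mu <= lam1.
Hypothesis eig_simple : forall g, lipschitz_eigenfunction K lam0 g ->
  exists2 s : R, s ^+ 2 = 1 & forall x, g x = s * phi x.

Let mu : R := lam0^-1 * int01 (kernel_op (variance_kernel K) (fun x => phi x * phi x)).
Let var : R := 2 * int01 (fun x => phi x * phi x *
  kernel_op (variance_kernel K) (fun x => phi x * phi x) x).

(** The deterministic core: the statement concerns one fixed equidistributed sequence, and the only
    randomness left is the finite Bernoulli product. *)
Theorem graph_law_cvg (f : R -> R) : continuous f -> bounded_fun f ->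
  law_exp (graph_law (sampled_kernel u K n)) f @[n --> \oo] -->
    (\int[gaussian mu var]_x f x : R).
Proof.
have symM n : (sampled_kernel u K n)^T = sampled_kernel u K n by exact: sampled_kernel_sym lK _.
have M01 n := @sampled_kernel01 _ u K K01 n.
have exv n : exists lv : R * 'rV[R]_n, (0 < n)%N ->
    top_eigenpair (sampled_kernel u K n) lv.1 lv.2.
  case: (posnP n) => [->|n0]; first by exists (0, 0).
  by have [l [v]] := ex_top_eigenpair_gt0 n0 (symM n); exists (l, v).
pose l n := (sval (cid (exv n))).1; pose v n := (sval (cid (exv n))).2.
have top_v n : (0 < n)%N -> top_eigenpair (sampled_kernel u K n) (l n) (v n) :=
  svalP (cid (exv n)).
move: l v top_v => l v top_v {exv}.
have gap := spectral_gap u01 equi lK K01 lam1_ge0 lam10 eig_phi eig_values eig_simple top_v.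
have lc := top_eig_cvg u01 equi lK K01 lam1_ge0 lam10 eig_phi eig_values top_v.
have mc := mean_sqr_cvg u01 equi lK K01 lam1_ge0 lam10 eig_phi eig_values eig_simple top_v.
have vc := quad_var_cvg u01 equi lK K01 lam1_ge0 lam10 eig_phi eig_values eig_simple top_v.
rewrite -/mu in mc; rewrite -/var in vc.
have lam0_gt0 : 0 < lam0 by exact: le_lt_trans lam10.
have var0 : 0 <= var.
  rewrite -(cvg_lim _ vc)//; apply: limr_ge; first by apply/cvg_ex; eexists; exact: vc.
  by near=> n; exact: quad_var_ge0.
(* The strict inequality c < lam0 gives c n <= l n for large n; the third bound matches the gap
   found by [spectral_gap]. *)
have [c [c01 clam cgap]] : exists c : R, [/\ 0 < c <= 1, c < lam0 & c <= (lam0 - lam1) / 2].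
  exists (Num.min 1 (Num.min (lam0 / 2) ((lam0 - lam1) / 2))); split.
  - rewrite ge_min lexx /= andbT !lt_min ltr01 divr_gt0//=.
    by rewrite divr_gt0// subr_gt0.
  - by rewrite !gt_min ltr_pdivrMr// ltr_pMr// ltr1n orbT.
  - by rewrite !ge_min lexx !orbT.
have c0 : 0 < c by case/andP: c01.
(* Four nested square roots: the sixteenth root of n. *)
pose kk n : R := Num.sqrt (Num.sqrt (Num.sqrt (Num.sqrt n%:R))).
have kk16 n : kk n ^+ 16 = n%:R.
  by rewrite /kk -[16%N]/(2 * 2 * 2 * 2)%N !exprM !sqr_sqrtr.
have kk_ge B : \forall n \near \oo, B <= kk n.
  near=> n; have nB : (`|B| + 1) ^+ 16 <= n%:R by near: n; exact: nbhs_infty_ger.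
  have k0 : 0 <= kk n by exact: sqrtr_ge0.
  rewrite -kk16 ler_pXn2r ?nnegrE ?addr_ge0// in nB.
  by apply: le_trans nB; rewrite (le_trans (ler_norm B))// lerDl.
apply: (law_weak_cvg (s := fun n => graph_law (sampled_kernel u K n))) => //.
  by move=> n; exact: graph_law_is_law.
move=> t e t0 e0; have [C C0 hC] := heat_graph_bound t0.
have [d d0 dE] : exists2 d : R, 0 < d & e = C * (d + d + d + d + d).
  exists (e / (C * 5)); first by rewrite divr_gt0// mulr_gt0.
  by field; rewrite gt_eqF.
move/cvgrPdist_le : (mc) => /(_ _ d0) mcd; move/cvgrPdist_le : (vc) => /(_ _ d0) vcd.
near=> n => a.
have n0 : (0 < n)%N by near: n; exists 1%N.
have nR : 0 < n%:R :> R by rewrite ltr0n.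
have [v1 vM _] := top_v n n0.
have gapn : forall z, dot z (v n) = 0 -> dot (z *m sampled_kernel u K n) z <=
   (l n - (lam0 - lam1) / 2 * n%:R) * dot z z by near: n.
have lle : l n <= n%:R.
  by apply: (le_trans (ler_norm _)); exact: (top_eig_norm_le K01 top_v).
have lge : c * n%:R <= l n.
  by rewrite -ler_pdivlMr//; near: n; exact: (cvgr_ge _ lc).
have kB : 8 / c + 1 + 18 / c ^+ 4 / d + 27 / d <= kk n by near: n.
have pos1 : 0 <= 8 / c by rewrite divr_ge0// ltW.
have pos2 : 0 <= 18 / c ^+ 4 / d by rewrite !divr_ge0 ?exprn_ge0 ?(ltW c0) ?(ltW d0).
have pos3 : 0 <= 27 / d by rewrite divr_ge0// ltW.
have [k1 k8 k18 k27] := le_of_sum4 kB pos1 pos2 pos3.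
have kk0 : 0 < kk n by exact: lt_le_trans k1.
pose r : R := (c ^+ 2 * n%:R)^-1.
have r0 : 0 <= r by rewrite invr_ge0 mulr_ge0 ?sqr_ge0.
have rd : r <= d.
  rewrite /r -[d]invrK lef_pV2 ?posrE ?invr_gt0 ?mulr_gt0 ?exprn_gt0//.
  rewrite mulrC -ler_pdivrMr ?exprn_gt0//; near: n; exact: nbhs_infty_ger.
(* Delocalization: Cauchy-Schwarz in the eigenvector equation gives l^2 v_i^2 <= n, and l >= c n. *)
have vr i : v n 0 i ^+ 2 <= r.
  have h : l n * v n 0 i = dot (v n) (\row_j sampled_kernel u K n j i).
    have /rowP/(_ i) := vM; rewrite !mxE => <-.
    by apply: eq_bigr => j _; rewrite !mxE.
  have := dot_CS (v n) (\row_j sampled_kernel u K n j i); rewrite -h v1 mul1r exprMn => h2.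
  have h3 : dot (\row_j sampled_kernel u K n j i) (\row_j sampled_kernel u K n j i) <= n%:R.
    rewrite /dot -[leRHS]mulr1 mulr_natl -[X in _ *+ X]card_ord -sumr_const.
    apply: ler_sum => j _; rewrite [X in X * _]mxE [X in _ * X]mxE.
    by have /andP[q1 q2] := M01 n j i; exact: mulr_ile1.
  rewrite /r -[leRHS]mul1r ler_pdivlMr ?mulr_gt0 ?exprn_gt0//.
  rewrite -(ler_pM2r nR) mul1r; apply: le_trans h3; apply: le_trans h2.
  rewrite -mulrA mulrC; apply: ler_wpM2r; first exact: sqr_ge0.
  have cn0 : 0 <= c * n%:R by rewrite mulr_ge0// (ltW c0).
  by rewrite -mulrA -expr2 -exprMn lerXn2r ?nnegrE// (le_trans cn0 lge).
have hn := hC n (sampled_kernel u K n) (v n) (l n) ((lam0 - lam1) / 2 * n%:R) c (kk n) r mu var a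
  (symM n) _ (M01 n) v1 vM gapn c01 k1 _ (kk16 n) _ _ r0 vr var0.
rewrite graph_law_exp (lambda_max_eq (top_v n n0)); apply: le_trans (hn _ _ _ _) _.
- by move=> i; rewrite sampled_kernelE eqxx.
- rewrite -ler_pdivrMl// mulrC; apply: (le_trans k8).
  by rewrite -[leLHS]expr1; apply: ler_weXn2l.
- by rewrite kk16 lge lle.
- by rewrite kk16; apply: ler_wpM2r.
have a1 : `|var - 2 * (\sum_i \sum_(j | j != i) v n 0 i ^+ 2 * v n 0 j ^+ 2 *
   (sampled_kernel u K n i j * (1 - sampled_kernel u K n i j)))| <= d by near: n.
have a2 : `|mu - mean_sqr (sampled_kernel u K n) (v n) / l n| <= d by near: n.
rewrite distrC in a1; rewrite distrC in a2.
have L (x y z : R) : 0 < y -> 0 < z -> x / y <= z -> x / z <= y.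
  by move=> y0 z0; rewrite !ler_pdivrMr// mulrC.
have a3 := L _ _ _ d0 kk0 k18; have a4 := L _ _ _ d0 kk0 k27.
rewrite dE; apply: ler_wpM2l; first exact: ltW.
exact: (lerD (lerD (lerD (lerD a3 a4) rd) a1) a2).
Unshelve. all: by end_near. Qed.

End GraphCLT.

(** * Measurability and integrals on the unit square *)

Section Measurability.
Context d (T : measurableType d) (R : realType).

Lemma measurable_fun_lt_set (f : T -> R) :
  (forall c, measurable [set x | f x < c]) -> measurable_fun setT f.
Proof.
move=> mf; apply: (measurability _ (RGenInftyO.measurableE R)).
move=> _ [_ [c ->] <-]; rewrite setTI.
have -> : f @^-1` `]-oo, c[%classic = [set x | f x < c].
  by apply/seteqP; split => x /=; rewrite in_itv.
exact: mf.
Qed.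

Lemma lt_set_measurable (f : T -> R) (c : R) :
  measurable_fun setT f -> measurable [set x | f x < c].
Proof.
move=> mf; rewrite -[X in measurable X]setTI.
have -> : [set x | f x < c] = f @^-1` `]-oo, c[%classic.
  by apply/seteqP; split => x /=; rewrite in_itv.
exact: mf.
Qed.

(* By the Lipschitz bound, [K x y < c] holds iff it holds with a margin
   through some rational first argument. *)
Lemma measurable_lipschitz_kernel (k : R) (K : R -> R -> R)
    (f g : T -> measurableTypeR R) :
  (forall x, measurable_fun setT (K x : measurableTypeR R -> R)) ->
  (forall y, lipschitz_fun k (K^~ y)) ->
  measurable_fun setT f -> measurable_fun setT g ->
  measurable_fun setT (fun x => K (f x) (g x)).
Proof.
move=> mK lK mf mg; apply: measurable_fun_lt_set => c.
have k0 : 0 < `|k| + 1 by rewrite ltr_wpDl.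
rewrite (_ : [set x | _] = \bigcup_(q : rat)
    [set x | K (ratr q) (g x) + (`|k| + 1) * `|f x - ratr q| < c]); last first.
  have lK' x q : `|K (f x) (g x) - K q (g x)| <= (`|k| + 1) * `|f x - q|.
    apply: (le_trans (lK _ _ _)); apply: ler_wpM2r => //.
    by rewrite (le_trans (ler_norm k))// lerDl.
  apply/seteqP; split => x /=.
    move=> Kc; have [e [e0 eE]] : exists e : R, 0 < e /\ c = K (f x) (g x) + 3 * ((`|k| + 1) * e).
      exists ((c - K (f x) (g x)) / (3 * (`|k| + 1))); split.
        by rewrite divr_gt0 ?subr_gt0// mulr_gt0.
      by field; rewrite gt_eqF.
    have fe : f x < f x + e by rewrite ltrDl.
    have [q /[!in_itv]/= /andP[q1 q2]] := rat_in_itvoo fe.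
    exists q => //=; have := lK' x (ratr q); rewrite eE.
    have fq : `|f x - ratr q| <= e by rewrite ler_norml; move: q1 q2; lra.
    have := ler_wpM2l (ltW k0) fq; have := mulr_gt0 k0 e0.
    have L (a b w z : R) : 0 < z -> w <= z -> `|a - b| <= w -> b + w < a + 3 * z.
      by rewrite ler_norml; lra.
    exact: L.
  move=> [q _ /=]; apply: le_lt_trans; have := lK' x (ratr q).
  have L (a b w : R) : `|a - b| <= w -> a <= b + w by rewrite ler_norml; lra.
  exact: L.
apply: bigcupT_measurable_rat => q; apply: lt_set_measurable.
apply: measurable_funD; first exact: (measurableT_comp (mK _)).
apply: measurable_funM => //; apply: measurableT_comp => //.
exact: measurable_funB.
Qed.

End Measurability.

Section UnitInterval.
Context {R : realType}.
Implicit Types f g : R -> R.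
Local Notation I01 := (`[0, 1]%classic : set R).
Local Notation leb := (@lebesgue_measure R).

Lemma continuous_measurable01 f : continuous f -> measurable_fun I01 f.
Proof.
by move=> cf; apply: measurable_funTS; exact: continuous_measurable_fun.
Qed.

Lemma eq_int01_ae f g : measurable_fun I01 f -> measurable_fun I01 g ->
  ae01 (fun x => f x = g x) -> int01 f = int01 g.
Proof.
move=> mf mg fg; rewrite /int01 /Rintegral; congr fine.
apply: ae_eq_integral => //; try exact/measurable_EFinP.
by move: fg; rewrite /ae01; apply: filterS => x + ux => ->.
Qed.

Lemma int01_EFin f : leb.-integrable I01 (EFin \o f) ->
  (\int[leb]_(x in I01) (f x)%:E)%E = (int01 f)%:E.
Proof. by move=> fi; rewrite /int01 /Rintegral fineK//; exact: integrable_fin_num. Qed.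

Lemma leb01_integral (f : measurableTypeR R -> \bar R) :
  measurable_fun setT f -> (forall x, 0 <= f x)%E ->
  (\int[leb01]_x f x = \int[leb]_(x in I01) f x)%E.
Proof.
move=> mf f0; have mC : measurable (~` I01 : set (measurableTypeR R)).
  exact: measurableC.
rewrite (ge0_negligible_integral mC)//; last by rewrite /= /leb01 /mrestr setICl measure0.
rewrite setTD setCK; apply: eq_measure_integral => A mA AI.
by rewrite /= /leb01 /mrestr; congr (leb _); apply/setIidl.
Qed.

Lemma L2_integrable f : L2_01 f -> L2_norm f = 1%E ->
  [/\ measurable_fun setT f, leb.-integrable I01 (EFin \o f),
      leb.-integrable I01 (EFin \o (fun x => f x * f x)) &
      int01 (fun x => f x * f x) = 1].
Proof.
move=> L2 f1; have mf : measurable_fun setT f by move: L2; rewrite /L2_01 inE => /andP[/[!inE]].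
have mff : measurable_fun setT (fun x => f x * f x) by exact: measurable_funM.
have ff0 x : (0 <= (f x * f x)%:E)%E by rewrite lee_fin -expr2 sqr_ge0.
have iff : (\int[leb]_(x in I01) (f x * f x)%:E)%E = 1%E.
  rewrite -leb01_integral//; last exact/measurable_EFinP.
  have n2 : (2 : R) != 0 by [].
  have := @poweR_Lnorm _ _ _ leb01 (EFin \o f) 2 n2.
  rewrite -[Lnorm _ _ _]/(L2_norm f) f1 poweR_EFin powR1 => ->.
  apply: eq_integral => x _ /=; rewrite powR_mulrn// real_normK ?num_real// expr2.
have mffI : measurable_fun I01 (EFin \o (fun x => f x * f x)).
  by apply/measurable_EFinP; exact: measurable_funTS.
have ffi : leb.-integrable I01 (EFin \o (fun x => f x * f x)).
  apply/integrableP; split => //.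
  rewrite (eq_integral (fun x : measurableTypeR R => (f x * f x)%:E)) ?iff ?ltry// => x _.
  by rewrite gee0_abs /= ?ff0.
have oi : leb.-integrable I01 (EFin \o (fun x => 1 + f x * f x)).
  have c1 : leb.-integrable I01 (EFin \o (cst (1 : R))).
    by apply: continuous_integrable01 => x; exact: cvg_cst.
  by have := integrableD _ c1 ffi; apply.
split => //; last by rewrite /int01 /Rintegral iff.
apply: (le_integrable _ _ _ oi) => //; first by apply/measurable_EFinP; exact: measurable_funTS.
move=> x _ /=; rewrite lee_fin (ger0_norm (_ : 0 <= 1 + _)); last first.
  by rewrite addr_ge0// -expr2 sqr_ge0.
have := sqr_ge0 (`|f x| - 1); rewrite sqrrB1 -normrX ger0_norm ?sqr_ge0// expr2.
by have := normr_ge0 (f x); lra.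
Qed.

Lemma L2_continuous f : continuous f -> L2_01 f.
Proof.
move=> cf; have mf : measurable_fun setT (f : measurableTypeR R -> R).
  exact: continuous_measurable_fun.
rewrite /L2_01 inE; apply/andP; split; rewrite inE//= /finite_norm unlock.
rewrite poweR_lty// leb01_integral; last 2 first.
- apply/measurable_EFinP/(@measurableT_comp _ _ _ _ _ _ (fun x : R => x `^ 2)) => //.
  exact/measurableT_comp.
- by move=> x; rewrite poweR_ge0.
have cff : continuous (fun x => f x * f x) by move=> x; apply: continuousM; exact: cf.
have /integrableP[_] := continuous_integrable01 cff.
apply: le_lt_trans; apply: ge0_le_integral => //.
- by move=> x _; rewrite poweR_ge0.
- apply: measurable_funTS; apply/measurable_EFinP/(@measurableT_comp _ _ _ _ _ _ (fun x : R => x `^ 2)) => //.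
  exact/measurableT_comp.
- apply/measurableT_comp => //; apply/measurable_EFinP.
  exact: continuous_measurable01.
- by move=> x _; rewrite /= lee_fin powR_mulrn// -normrX expr2.
Qed.

Section Square.
Variable G : measurableTypeR R * measurableTypeR R -> R.
Hypotheses (mG : measurable_fun setT G) (G0 : forall z, 0 <= G z).

Let G' (z : measurableTypeR R * measurableTypeR R) : \bar R :=
  ((EFin \o G) \_ unit_square) z.

Let G'E x y : G' (x, y) = (((fun x => ((fun y => (G (x, y))%:E) \_ I01) y) \_ I01) x)%E.
Proof.
rewrite /G' /patch /=; have -> : ((x, y) \in unit_square) = (x \in I01) && (y \in I01).
  by apply/idP/andP; rewrite !inE => -[].
by case: (x \in _); case: (y \in _).
Qed.

Let G'0 z : (0 <= G' z)%E.
Proof. by rewrite /G' /patch; case: ifP => // _; rewrite lee_fin. Qed.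

Let mG' : measurable_fun setT G'.
Proof.
apply/(measurable_restrictT _ _).1.
  by apply: measurableX; exact: measurable_itv.
by apply/measurable_EFinP; exact: measurable_funTS.
Qed.

(** The inner integrals are real-valued; integrability of every section makes them agree with the
    extended-real integrals of Tonelli's theorem. *)
Lemma int_square : (forall x, leb.-integrable I01 (fun y => (G (x, y))%:E)) ->
  \int[(leb \x leb)%E]_(z in unit_square) G z = int01 (fun x => int01 (fun y => G (x, y))).
Proof.
move=> Gi; rewrite /Rintegral integral_mkcond -/G'.
rewrite fubini_tonelli1// /int01 [in RHS]/Rintegral; congr fine.
rewrite [RHS]integral_mkcond; apply: eq_integral => x _.
transitivity (\int[leb]_y G' (x, y))%E => //.
rewrite (eq_integral _ _ (fun y _ => G'E x y)) /patch.
case: ifP => xI; last by rewrite integral0.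
by rewrite -(int01_EFin (Gi _)) [RHS]integral_mkcond.
Qed.

Lemma int_square_swap : (forall y, leb.-integrable I01 (fun x => (G (x, y))%:E)) ->
  \int[(leb \x leb)%E]_(z in unit_square) G z = int01 (fun y => int01 (fun x => G (x, y))).
Proof.
move=> Gi; rewrite /Rintegral integral_mkcond -/G'.
rewrite fubini_tonelli2// /int01 [in RHS]/Rintegral; congr fine.
rewrite [RHS]integral_mkcond; apply: eq_integral => y _.
transitivity (\int[leb]_x G' (x, y))%E => //.
rewrite (eq_integral _ _ (fun x _ => G'E x y)) /patch; case: ifP => yI.
  by rewrite -(int01_EFin (Gi _)) [RHS]integral_mkcond.
by rewrite integral0_eq// => x _; rewrite if_same.
Qed.

End Square.
End UnitInterval.

(** * From graphons to Lipschitz kernels *)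

Section KernelOperator.
Context {R : realType}.
Local Notation leb := (@lebesgue_measure R).
Local Notation I01 := (`[0, 1]%classic : set R).

Lemma integrable_continuousM (h f : R -> R) : continuous h ->
  leb.-integrable I01 (EFin \o f) -> leb.-integrable I01 (EFin \o (fun x => h x * f x)).
Proof.
move=> ch fi; have [M M0 hM] := continuous_bounded01 ch.
have Mi : leb.-integrable I01 (fun x => M%:E * (EFin \o f) x)%E by exact: integrableZl.
have /measurable_EFinP mf := measurable_int _ fi.
apply: (le_integrable _ _ _ Mi) => //.
  by apply/measurable_EFinP; apply: measurable_funM => //; exact: continuous_measurable01.
move=> x /=; rewrite in_itv /= => x01.
by rewrite lee_fin !normrM (gtr0_norm M0); apply: ler_wpM2r => //; exact: hM.
Qed.

Lemma int01D (f g : R -> R) : leb.-integrable I01 (EFin \o f) ->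
  leb.-integrable I01 (EFin \o g) -> int01 (fun x => f x + g x) = int01 f + int01 g.
Proof. by move=> fi gi; exact: RintegralD. Qed.

Lemma integrable01Z (c : R) (f : R -> R) : leb.-integrable I01 (EFin \o f) ->
  leb.-integrable I01 (EFin \o (fun x => c * f x)).
Proof. by move=> fi; have := integrableZl _ c fi; exact. Qed.

Lemma int01_scale (c : R) (f : R -> R) : leb.-integrable I01 (EFin \o f) ->
  int01 (fun x => c * f x) = c * int01 f.
Proof. by move=> fi; exact: RintegralZl. Qed.

Lemma kernel_op_lipschitz (k : R) (K : R -> R -> R) (g : R -> R) :
  lipschitz_kernel k K -> leb.-integrable I01 (EFin \o g) ->
  lipschitz_fun (k * int01 (fun y => `|g y|)) (kernel_op K g).
Proof.
move=> lK gi x x'; have [_ _ lK1] := lK.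
have cK t := lipschitz_kernel_continuous (x := t) lK.
have i1 t := integrable_continuousM (cK t) gi.
have ai : leb.-integrable I01 (EFin \o (fun y => `|g y|)) by exact: integrable_norm gi.
rewrite /kernel_op /int01 -RintegralB//.
apply: (le_trans (le_normr_Rintegral _ _)) => //.
  by have := integrableB _ (i1 x) (i1 x'); apply.
rewrite mulrAC -RintegralZl//.
apply: le_Rintegral => //.
- by apply: integrable_norm; have := integrableB _ (i1 x) (i1 x'); apply.
- by have := integrableZl _ (k * `|x - x'|) ai; apply.
- by move=> y _; rewrite -mulrBl normrM; apply: ler_wpM2r => //; exact: lK1.
Qed.

End KernelOperator.

Section GraphonKernel.
Context {R : realType}.
Variables (W : R -> R -> R) (L : R) (lam : nat -> R) (phi1 : R -> R).
Hypotheses (gW : graphon W) (lW : graphon_lipschitz L W).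
Hypothesis eig : nonneg_eigenvalues W lam.
Hypothesis gap : 0 < `|lam 0%N - lam 1%N|.
Hypothesis nphi1 : normalized_eigenfunction W (lam 0%N) phi1.
Local Notation leb := (@lebesgue_measure R).
Local Notation I01 := (`[0, 1]%classic : set R).

Definition clamp (x : R) : R := Num.max 0 (Num.min 1 x).

Lemma clamp01 x : 0 <= clamp x <= 1.
Proof. by rewrite /clamp le_max lexx /= ge_max ler01 ge_min lexx. Qed.

Lemma unit_itvP (x : R) : unit_itv x <-> 0 <= x <= 1.
Proof. by rewrite /unit_itv /= in_itv. Qed.

Lemma unit_itv_clamp x : unit_itv (clamp x).
Proof. by apply/unit_itvP; rewrite clamp01. Qed.

Lemma clamp_id x : 0 <= x <= 1 -> clamp x = x.
Proof. by case/andP=> x0 x1; rewrite /clamp min_r// max_r. Qed.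

Lemma clamp_lipschitz x y : `|clamp x - clamp y| <= `|x - y|.
Proof.
wlog xy : x y / x <= y.
  by move=> h; case: (leP x y) => [/h //|/ltW /h]; rewrite distrC [leRHS]distrC.
rewrite distrC [leRHS]distrC (ger0_norm (_ : 0 <= y - x)) ?subr_ge0//.
rewrite /clamp; case: (leP 1 x) => hx; case: (leP 1 y) => hy;
  (try case: (leP 0 x) => h1); (try case: (leP 0 y) => h2);
  rewrite ?(max_r ler01) ler_norml; lra.
Qed.

(** Composition with the 1-Lipschitz retraction onto [0, 1] preserves symmetry, range and Lipschitz
    constant and makes the kernel total, so that the analysis above applies on the whole line. *)
Definition clamped (x y : R) : R := W (clamp x) (clamp y).
Local Notation K := clamped.

Lemma clamped_id x y : 0 <= x <= 1 -> 0 <= y <= 1 -> K x y = W x y.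
Proof. by move=> x01 y01; rewrite /clamped !clamp_id. Qed.

Lemma clamped01 x y : 0 <= K x y <= 1.
Proof. by have [_ h] := gW; apply: h; exact: unit_itv_clamp. Qed.

Hypothesis L0 : 0 < L.

Lemma clamped_lipschitz : lipschitz_kernel L K.
Proof.
split.
- by move=> x y; have [h _] := gW; apply: h; exact: unit_itv_clamp.
- by move=> x y; have := clamped01 x y; rewrite ler_norml; lra.
- move=> y x x'; rewrite /clamped.
  have /(_ ((clamp x, clamp y), (clamp x', clamp y))) := lW.
  have sq z : unit_square (clamp z, clamp y) by split; exact: unit_itv_clamp.
  move=> /(_ (conj (sq x) (sq x'))) /= h; apply: (le_trans h).
  rewrite prod_normE /= subrr normr0 max_l//.
  by apply: ler_wpM2l; [exact: ltW|exact: clamp_lipschitz].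
Qed.

Let lK := clamped_lipschitz.
Let cK x : continuous (K x) := lipschitz_kernel_continuous lK.

Lemma graphon_op_clamped g x : 0 <= x <= 1 -> graphon_op W g x = kernel_op K g x.
Proof. by move=> x01; apply: eq_int01 => y y01; rewrite clamped_id. Qed.

Let lam_le1 k : lam k.+1 <= lam 1%N.
Proof.
elim: k => // k; apply: le_trans; have [h _] := eig.
by have /andP[] := h k.+1.
Qed.

Lemma second_eig_ge0 : 0 <= lam 1%N.
Proof. by have [/(_ 0%N)/andP[]] := eig. Qed.

Lemma eig_gap : lam 1%N < lam 0%N.
Proof.
have [/(_ 0%N)/andP[_ h] _] := eig; rewrite lt_neqAle h andbT.
by apply: contraTneq gap => ->; rewrite subrr normr0 ltxx.
Qed.

Let lam0 : 0 < lam 0%N. Proof. exact: le_lt_trans second_eig_ge0 eig_gap. Qed.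

Let L2phi1 : [/\ measurable_fun setT phi1, leb.-integrable I01 (EFin \o phi1),
      leb.-integrable I01 (EFin \o (fun x => phi1 x * phi1 x)) &
      int01 (fun x => phi1 x * phi1 x) = 1].
Proof. by have [[h _] n1] := nphi1; exact: L2_integrable. Qed.

(** [phi1] is an arbitrary L^2 representative; dividing the eigenvalue equation by [lam 0] yields a
    Lipschitz version that satisfies it everywhere. *)
Definition smooth_eigenfunction (x : R) : R := (lam 0%N)^-1 * kernel_op K phi1 x.
Local Notation phi := smooth_eigenfunction.

Let kop_lip := fun g gi => @kernel_op_lipschitz R L K g lK gi.

Lemma smooth_eigenfunction_lipschitz : exists k, lipschitz_fun k phi.
Proof.
have [_ iphi1 _ _] := L2phi1.
exists ((lam 0%N)^-1 * (L * int01 (fun y => `|phi1 y|))) => x y.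
rewrite /phi -mulrBr normrM gtr0_norm ?invr_gt0// -mulrA.
by apply: ler_wpM2l; [rewrite invr_ge0 ltW|exact: kop_lip].
Qed.

Let cphi : continuous phi.
Proof. by have [k l] := smooth_eigenfunction_lipschitz; exact: lipschitz_fun_continuous l. Qed.

Lemma smooth_eigenfunction_ae : ae01 (fun x => phi1 x = phi x).
Proof.
have [[_ h] _] := nphi1; move: h; rewrite /ae01; apply: filterS => x hx ux.
by rewrite /phi -graphon_op_clamped ?hx ?mulKf ?gt_eqF//; exact/unit_itvP.
Qed.

Lemma kernel_op_ae x (g h : R -> R) : measurable_fun I01 g -> measurable_fun I01 h ->
  ae01 (fun x => g x = h x) -> kernel_op K g x = kernel_op K h x.
Proof.
move=> mg mh gh; have mK := continuous_measurable01 (@cK x).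
apply: eq_int01_ae; try exact: measurable_funM.
by move: gh; rewrite /ae01; apply: filterS => y hy /hy ->.
Qed.

Lemma smooth_eigenfunction_eig : lipschitz_eigenfunction K (lam 0%N) phi.
Proof.
have [mphi1 _ _ sq1] := L2phi1.
have m1 : measurable_fun I01 phi1 by exact: measurable_funTS.
have m2 := continuous_measurable01 cphi.
split; first exact: smooth_eigenfunction_lipschitz.
- move=> x; rewrite -(kernel_op_ae x m1 m2 smooth_eigenfunction_ae) /phi.
  by rewrite mulVKf ?gt_eqF.
- rewrite -sq1; apply/esym/eq_int01_ae; try exact: measurable_funM.
  by have := smooth_eigenfunction_ae; rewrite /ae01; apply: filterS => y hy /hy ->.
Qed.

Lemma lipschitz_eigenspace (mu : R) g : lipschitz_eigenfunction K mu g ->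
  graphon_eigenspace W mu g.
Proof.
case=> [[k lg] eg _]; split; first exact/L2_continuous/lipschitz_fun_continuous/lg.
by apply: aeW => x /unit_itvP x01; rewrite graphon_op_clamped.
Qed.

(** Normalization makes [g] a free family of size 1, so mu is listed in [lam]: at index 0, or at a
    later one, where the list is bounded by [lam 1]. *)
Lemma lipschitz_eigenvalue (mu : R) g : 0 < mu -> lipschitz_eigenfunction K mu g ->
  mu = lam 0%N \/ mu <= lam 1%N.
Proof.
move=> mu0 eg; have [[k lg] _ g1] := eg.
have cg := lipschitz_fun_continuous lg; have mg := continuous_measurable01 cg.
have [_ /(_ mu mu0 1%N) [h _]] := eig.
have /h [s [_ s1 sl]] : multiplicity_ge W mu 1.
  exists (fun=> g); split; first by move=> _; exact: lipschitz_eigenspace.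
  move=> c cg0 i; rewrite ord1 {i}; apply/eqP; rewrite -sqrf_eq0 -[X in X == 0]mulr1 -g1.
  rewrite -int01Z; last by move=> x; apply: continuousM; exact: cg.
  rewrite -(int01_cst (0 : R)); apply/eqP; apply: eq_int01_ae => //.
    by apply: measurable_funM => //; exact: measurable_funM.
  move: cg0; rewrite /ae01; apply: filterS => x /= + ux => /(_ ux).
  by rewrite big_ord1 expr2 mulrACA => ->; rewrite mulr0.
case: s s1 sl => [|[|j] [|? ?]]// _ /(_ _ (mem_head _ _)) <-; first by left.
by right; exact: lam_le1.
Qed.

(** Otherwise [g] and [phi] would be free, the value [lam 0] would be listed at two indices, and the
    nonzero one would contradict the gap. *)
Lemma lipschitz_eigenfunction_unique g : lipschitz_eigenfunction K (lam 0%N) g ->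
  exists2 s : R, s ^+ 2 = 1 & forall x, g x = s * phi x.
Proof.
move=> eg; have [[k lg] Kg g1] := eg.
have [_ Kphi phi_1] := smooth_eigenfunction_eig.
have cg := lipschitz_fun_continuous lg; have mg := continuous_measurable01 cg.
have mphi := continuous_measurable01 cphi.
apply: contrapT => nex; have [_ /(_ _ lam0 2%N) [h _]] := eig.
have /h [s [us s2 sl]] : multiplicity_ge W (lam 0%N) 2.
  exists (fun i => if i == ord0 then g else phi); split.
    by move=> i; case: ifP => _; apply: lipschitz_eigenspace => //; exact: smooth_eigenfunction_eig.
  move=> c c0; have {c0}c0 : ae01 (fun x => c ord0 * g x = - c ord_max * phi x).
    move: c0; rewrite /ae01; apply: filterS => x + ux => /(_ ux).
    rewrite big_ord_recl big_ord1 /= => /eqP; rewrite addr_eq0 mulNr => /eqP ->.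
    by congr (- (c _ * _)); exact: val_inj.
  (* Both functions have norm 1, so a linear relation between them has coefficients of equal
     modulus; this gives s^2 = 1 below. *)
  have sq : c ord0 ^+ 2 = c ord_max ^+ 2.
    rewrite -[LHS]mulr1 -[RHS]mulr1 -{1}g1 -phi_1 -!int01Z; last 2 first.
    - by move=> x; apply: continuousM; exact: cphi.
    - by move=> x; apply: continuousM; exact: cg.
    apply: eq_int01_ae; try by (do 2 apply: measurable_funM => //).
    move: c0; rewrite /ae01; apply: filterS => x + ux => /(_ ux) e.
    by rewrite !expr2 mulrACA e mulrACA mulrNN.
  have [c00|c00] := eqVneq (c ord0) 0.
    move: sq; rewrite c00 expr0n /= => /esym/eqP; rewrite sqrf_eq0 => /eqP c10 i.
    by case: (unliftP ord0 i) => [j ->|->//]; rewrite -c10; congr c; apply: val_inj; rewrite ord1.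
  exfalso; apply: nex; exists (- c ord_max / c ord0).
    by rewrite exprMn sqrrN -sq exprVn mulfV// sqrf_eq0.
  (* The relation holds almost everywhere; applying the kernel operator to both sides makes it hold
     at every x. *)
  move=> x; apply: (mulfI (lt0r_neq0 lam0)); rewrite -Kg mulrCA -Kphi.
  rewrite -[RHS]int01Z; last by move=> y; apply: continuousM; [exact: cK|exact: cphi].
  have mK := continuous_measurable01 (@cK x).
  apply: eq_int01_ae; try by (do 2 apply: measurable_funM => //).
  move: c0; rewrite /ae01; apply: filterS => y + uy => /(_ uy) e.
  by rewrite mulrCA [_ / _ * _]mulrAC -e [in RHS]mulrAC mulfV ?mul1r.
have [j js j0] : exists2 j, j \in s & j != 0%N.
  case: s us s2 sl => [|a [|b [|? ?]]]//= /andP[]; rewrite inE => ab _ _ _.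
  case: (eqVneq a 0%N) => [a0|a0]; last by exists a => //; rewrite mem_head.
  by exists b; rewrite ?inE ?eqxx ?orbT// -a0 eq_sym.
case: j j0 js => // j _ /sl e; have := lam_le1 j.
by rewrite e leNgt eig_gap.
Qed.

Local Notation D := (variance_kernel K).
Local Notation phi2 := (fun x => phi x * phi x).

Let lD : lipschitz_kernel L D := lipschitz_variance_kernel lK clamped01.
Let cD x : continuous (D x) := lipschitz_kernel_continuous lD.
Let D0 x y : 0 <= D x y.
Proof. by have := clamped01 x y; rewrite /variance_kernel => /andP[? ?]; rewrite mulr_ge0// subr_ge0. Qed.
Let sD x y : D x y = D y x. Proof. by have [-> _ _] := lD. Qed.

Let cphi2 : continuous phi2.
Proof. by move=> x; apply: continuousM; exact: cphi. Qed.

Let cop g : leb.-integrable I01 (EFin \o g) -> continuous (kernel_op D g).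
Proof. by move=> gi; apply: lipschitz_fun_continuous; exact: kernel_op_lipschitz lD gi. Qed.

Let mD : measurable_fun setT (fun z : measurableTypeR R * measurableTypeR R => D z.1 z.2).
Proof.
apply: (measurable_lipschitz_kernel (k := L)) => //; last by case: lD.
by move=> x; apply: continuous_measurable_fun; exact: cD.
Qed.

Let iphi2 : leb.-integrable I01 (EFin \o phi2) := continuous_integrable01 cphi2.

Let one_int : leb.-integrable I01 (EFin \o (fun=> 1 : R)).
Proof. by apply: continuous_integrable01 => x; exact: cvg_cst. Qed.

Let opD_ae x : kernel_op D (fun y => phi1 y * phi1 y) x = kernel_op D phi2 x.
Proof.
have [mphi1 _ _ _] := L2phi1; have mphi := continuous_measurable01 cphi.
have m1 : measurable_fun I01 phi1 by exact: measurable_funTS.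
have mDx := continuous_measurable01 (@cD x).
apply: eq_int01_ae; try by (do 2 apply: measurable_funM => //).
by have := smooth_eigenfunction_ae; rewrite /ae01; apply: filterS => y hy /hy ->.
Qed.

Let sq0 (f : R -> R) t : 0 <= f t * f t. Proof. by rewrite -expr2 sqr_ge0. Qed.

Lemma limit_varE : limit_var W phi1 = 2 * int01 (fun x => phi2 x * kernel_op D phi2 x).
Proof.
have [mphi1 _ i2 _] := L2phi1; congr (2 * _).
pose G (z : measurableTypeR R * measurableTypeR R) : R :=
  (phi1 z.1 * phi1 z.1) * (D z.1 z.2 * (phi1 z.2 * phi1 z.2)).
have p1 : measurable_fun setT (fun z : measurableTypeR R * measurableTypeR R => phi1 z.1).
  exact: (measurableT_comp mphi1).
have p2 : measurable_fun setT (fun z : measurableTypeR R * measurableTypeR R => phi1 z.2).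
  exact: (measurableT_comp mphi1).
transitivity (\int[(leb \x leb)%E]_(z in unit_square) G z).
  apply: eq_Rintegral => -[x y]; rewrite inE => -[/unit_itvP ux /unit_itvP uy] /=.
  by rewrite /G /variance_kernel /= !clamped_id//; rewrite -[in RHS](expr2 (phi1 x)) -[in RHS](expr2 (phi1 y)); ring.
rewrite int_square.
- transitivity (int01 (fun x => phi1 x * phi1 x * kernel_op D (fun y => phi1 y * phi1 y) x)).
    apply: eq_int01 => x _.
    exact: (int01_scale (phi1 x * phi1 x) (integrable_continuousM (@cD x) i2)).
  have mphi := continuous_measurable01 cphi.
  have mop : measurable_fun I01 (kernel_op D phi2) by apply: continuous_measurable01; exact: cop.
  have m1 : measurable_fun I01 phi1 by exact: measurable_funTS.
  under eq_int01 do rewrite opD_ae.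
  apply: eq_int01_ae; try by (do 2 apply: measurable_funM => //).
  by have := smooth_eigenfunction_ae; rewrite /ae01; apply: filterS => y hy /hy ->.
- by do 3 apply: measurable_funM => //.
- by move=> z; rewrite /G; apply: mulr_ge0; [exact: sq0|apply: mulr_ge0; [exact: D0|exact: sq0]].
- move=> x; have := integrableZl _ (phi1 x * phi1 x) (integrable_continuousM (@cD x) i2).
  exact.
Qed.

Let d := kernel_op D (fun=> 1).
Let cd : continuous d := cop one_int.
Let ckphi2 : continuous (kernel_op D phi2) := cop iphi2.

Lemma kernel_op_swap : int01 (fun x => phi2 x * d x) = int01 (kernel_op D phi2).
Proof.
pose G (z : measurableTypeR R * measurableTypeR R) : R := phi2 z.1 * (D z.1 z.2 * 1).
have p1 : measurable_fun setT (fun z : measurableTypeR R * measurableTypeR R => phi z.1).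
  have mphi : measurable_fun setT (phi : measurableTypeR R -> R).
    exact: continuous_measurable_fun.
  exact: (measurableT_comp mphi).
have mG : measurable_fun setT G by do 2 apply: measurable_funM => //; exact: measurable_funM.
have G0 z : 0 <= G z by rewrite /G; apply: mulr_ge0; rewrite ?sq0// mulr1 D0.
have iG x : leb.-integrable I01 (fun y => (G (x, y))%:E).
  by have := integrableZl _ (phi2 x) (integrable_continuousM (@cD x) one_int); exact.
have iG' y : leb.-integrable I01 (fun x => (G (x, y))%:E).
  have i1 : leb.-integrable I01 (EFin \o (fun x => D y x * phi2 x)).
    exact: integrable_continuousM.
  by apply: eq_integrable i1 => // x _; rewrite /G /= mulr1 mulrC sD.
have := int_square_swap mG G0 iG'; rewrite (int_square mG G0 iG) => e.
transitivity (int01 (fun x => int01 (fun y => G (x, y)))).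
  apply: eq_int01 => x _; apply: esym.
  exact: (int01_scale (phi2 x) (integrable_continuousM (@cD x) one_int)).
rewrite e; apply: eq_int01 => y _; apply: eq_int01 => x _.
by rewrite /G /= mulr1 mulrC sD.
Qed.

(** The halves with phi^2 (x) and phi^2 (y) contribute equally by Tonelli and the symmetry of [D],
    so the symmetrized integral collapses to a single one. *)
Lemma limit_meanE : limit_mean W (lam 0%N) phi1 =
  (lam 0%N)^-1 * int01 (kernel_op D phi2).
Proof.
have [mphi1 _ i2 _] := L2phi1; congr (_ * _).
(* The factor 1 makes the inner integral of the first half an instance of [kernel_op] at the
   constant function. *)
pose G (z : measurableTypeR R * measurableTypeR R) : R :=
  2^-1 * (phi1 z.1 * phi1 z.1) * (D z.1 z.2 * 1) +
  2^-1 * (D z.1 z.2 * (phi1 z.2 * phi1 z.2)).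
have p1 : measurable_fun setT (fun z : measurableTypeR R * measurableTypeR R => phi1 z.1).
  exact: (measurableT_comp mphi1).
have p2 : measurable_fun setT (fun z : measurableTypeR R * measurableTypeR R => phi1 z.2).
  exact: (measurableT_comp mphi1).
have h0 : (0 : R) <= 2^-1 by [].
have iD1 x : leb.-integrable I01 (EFin \o (fun y => D x y * 1)).
  by apply: integrable_continuousM => //; exact: cD.
have iDp x : leb.-integrable I01 (EFin \o (fun y => D x y * (phi1 y * phi1 y))).
  by apply: integrable_continuousM => //; exact: cD.
have i1 x : leb.-integrable I01 (EFin \o (fun y => 2^-1 * (phi1 x * phi1 x) * (D x y * 1))).
  exact: (integrable01Z _ (iD1 x)).
have i3 x : leb.-integrable I01 (EFin \o (fun y => 2^-1 * (D x y * (phi1 y * phi1 y)))).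
  exact: (integrable01Z _ (iDp x)).
transitivity (\int[(leb \x leb)%E]_(z in unit_square) G z).
  apply: eq_Rintegral => -[x y]; rewrite inE => -[/unit_itvP ux /unit_itvP uy] /=.
  by rewrite /G /variance_kernel /= !clamped_id// !expr2; field.
rewrite int_square.
- transitivity (int01 (fun x => 2^-1 * (phi1 x * phi1 x) * d x + 2^-1 * kernel_op D phi2 x)).
    apply: eq_int01 => x _; rewrite -opD_ae.
    rewrite /G int01D; [|exact: i1|exact: i3].
    have e1 := int01_scale (2^-1 * (phi1 x * phi1 x)) (iD1 x).
    exact: (congr2 (fun a b : R => a + b) e1 (int01_scale 2^-1 (iDp x))).
  have mphi := continuous_measurable01 cphi; have md := continuous_measurable01 cd.
  have mk := continuous_measurable01 ckphi2.
  have m1 : measurable_fun I01 phi1 by exact: measurable_funTS.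
  transitivity (int01 (fun x => 2^-1 * (phi2 x * d x) + 2^-1 * kernel_op D phi2 x)).
    apply: eq_int01_ae.
    - by apply: measurable_funD; do 3 apply: measurable_funM => //.
    - by apply: measurable_funD; do 3 apply: measurable_funM => //.
    - have := smooth_eigenfunction_ae; rewrite /ae01; apply: filterS => y hy /hy ->.
      by rewrite -[in LHS](mulrA 2^-1).
  have iA := integrable_continuousM cphi2 (continuous_integrable01 cd).
  have iB := continuous_integrable01 ckphi2.
  transitivity (2^-1 * int01 (fun x => phi2 x * d x) + 2^-1 * int01 (kernel_op D phi2)).
    rewrite (int01D (integrable01Z 2^-1 iA) (integrable01Z 2^-1 iB)).
    exact: (congr2 (fun a b : R => a + b) (int01_scale 2^-1 iA) (int01_scale 2^-1 iB)).
  by rewrite kernel_op_swap; lra.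
- by apply: measurable_funD; do 3 apply: measurable_funM => //.
- move=> z; rewrite /G mulr1; apply: addr_ge0.
    by apply: mulr_ge0; [apply: mulr_ge0; [|exact: sq0]|exact: D0].
  by apply: mulr_ge0 => //; apply: mulr_ge0; [exact: D0|exact: sq0].
- by move=> x; have := integrableD _ (i1 x) (i3 x); apply.
Qed.

End GraphonKernel.

(** * Equidistribution from frequencies *)

Section Frequencies.
Context {R : realType}.
Local Notation leb := (@lebesgue_measure R).
Local Notation I01 := (`[0, 1]%classic : set R).

(** Offending pairs at distance at most 1/(n+1) would converge along an ultrafilter to a common
    point, where continuity fails. *)
Lemma uniform_continuity01 (f : R -> R) (e : R) : continuous f -> 0 < e ->
  exists N : nat, forall x y, 0 <= x <= 1 -> 0 <= y <= 1 ->
    `|x - y| <= N.+1%:R^-1 -> `|f x - f y| <= e.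
Proof.
move=> cf e0; apply: contrapT => /forallNP nf.
have H N : exists xy : R * R, [/\ 0 <= xy.1 <= 1, 0 <= xy.2 <= 1,
    `|xy.1 - xy.2| <= N.+1%:R^-1 & e < `|f xy.1 - f xy.2|].
  apply: contrapT => nxy; apply: (nf N) => x y x01 y01 xy; rewrite leNgt.
  by apply/negP => h; apply: nxy; exists (x, y).
have [xy hxy] := choice H.
have [F [FU Foo]] := ultraFilterLemma (eventually_filter).
have FF : ProperFilter F by exact: ultra_proper.
have [l xl] : exists l : R, (xy n).1 @[n --> F] --> l.
  apply: (@ultra_cvg_bounded _ _ _ 1); near=> n; have [/andP[a b] _ _ _] := hxy n.
  by rewrite ger0_norm.
have yl : (xy n).2 @[n --> F] --> l.
  have d0 : (xy n).1 - (xy n).2 @[n --> F] --> (0 : R).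
    apply: (@cvg_trans _ ((xy n).1 - (xy n).2 @[n --> \oo])); first exact: cvg_app Foo.
    apply/norm_cvg0P; apply: (@squeeze_cvgr _ _ _ _ (fun=> 0) (fun n => n.+1%:R^-1)).
    - by near=> n; have [_ _ -> _] := hxy n; rewrite normr_ge0.
    - exact: cvg_cst.
    - exact: cvg_harmonic.
  have -> : (fun n => (xy n).2) = (fun n => (xy n).1 - ((xy n).1 - (xy n).2)).
    by apply/funext => n; rewrite opprB addrC subrK.
  by rewrite -[l]subr0; exact: cvgB.
have fx : f (xy n).1 @[n --> F] --> f l by apply: continuous_cvg => //; exact: cf.
have fy : f (xy n).2 @[n --> F] --> f l by apply: continuous_cvg => //; exact: cf.
have d : `|f (xy n).1 - f (xy n).2| @[n --> F] --> `|f l - f l|.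
  by apply: cvg_norm; exact: cvgB.
have : e <= `|f l - f l|.
  rewrite -(cvg_lim _ d)//; apply: limr_ge; first by apply/cvg_ex; eexists; exact: d.
  by near=> n; have [_ _ _ /ltW] := hxy n.
by rewrite subrr normr0 leNgt e0.
Unshelve. all: by end_near. Qed.

Definition freq (u : nat -> R) (q : R) n : R := mean (fun i : 'I_n => (u i < q)%R%:R).

Lemma integrable_lt (q : R) : leb.-integrable I01 (EFin \o (fun x => (x < q)%R%:R)).
Proof.
have -> : (fun x : R => (x < q)%R%:R : R) = \1_(`]-oo, q[%classic).
  by apply/funext => x; rewrite indicE mem_setE in_itv.
have c1 : leb.-integrable I01 (EFin \o (fun=> 1 : R)).
  by apply: continuous_integrable01 => x; exact: cvg_cst.
apply: (le_integrable _ _ _ c1) => //.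
  by apply/measurable_EFinP; exact: measurable_indic.
by move=> x _ /=; rewrite lee_fin normr1 ger0_norm indicE ?ler0n// lern1 leq_b1.
Qed.

Lemma lebesgue_lt01 (q : R) : 0 <= q ->
  leb (`]-oo, q[%classic `&` I01) = (Num.min 1 q)%:E.
Proof.
move=> q0; case: (leP 1 q) => q1.
  have [<-|q1'] := eqVneq 1 q.
    rewrite (_ : _ `&` _ = `[0, 1[%classic); last first.
      apply/seteqP; split => x /=; rewrite !in_itv /=.
        by move=> [-> /andP[-> _]].
      by move=> /andP[-> h]; rewrite h (ltW h).
    by rewrite lebesgue_measure_itv /= lte_fin ltr01 -EFinD subr0.
  rewrite (_ : _ `&` _ = `[0, 1]%classic); last first.
    apply/seteqP; split => x /=; rewrite !in_itv /=; first by move=> [].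
    by move=> /andP[-> h]; rewrite h (le_lt_trans h)// lt_neqAle q1' q1.
  by rewrite lebesgue_measure_itv /= lte_fin ltr01 -EFinD subr0.
rewrite (_ : _ `&` _ = `[0, q[%classic); last first.
  apply/seteqP; split => x /=; rewrite !in_itv /=; first by move=> [-> /andP[-> _]].
  by move=> /andP[-> h]; rewrite h (ltW (lt_trans h q1)).
rewrite lebesgue_measure_itv /= lte_fin; case: ltP => //=; first by rewrite -EFinD subr0.
by move=> qle; congr EFin; apply/eqP; rewrite eq_le q0 qle.
Qed.

Lemma int01_lt (q : R) : 0 <= q -> int01 (fun x => (x < q)%R%:R) = Num.min 1 q.
Proof.
move=> q0; rewrite /int01 /Rintegral -[RHS]/(fine (Num.min 1 q)%:E) -lebesgue_lt01//.
rewrite -(integral_indic leb (D := I01))//; congr fine; apply: eq_integral => x _.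
by rewrite indicE mem_setE in_itv.
Qed.

Lemma int01_sum (J : Type) (r : seq J) (F : J -> R -> R) :
  (forall j, leb.-integrable I01 (EFin \o F j)) ->
  leb.-integrable I01 (EFin \o (fun x => \sum_(j <- r) F j x)) /\
  int01 (fun x => \sum_(j <- r) F j x) = \sum_(j <- r) int01 (F j).
Proof.
move=> Fi; elim: r => [|j r [ih1 ih2]].
  have E : (fun x : R => \sum_(j <- [::]) F j x) = (fun=> 0).
    by apply/funext => x; rewrite big_nil.
  rewrite E big_nil int01_cst; split => //.
  by apply: continuous_integrable01 => x; exact: cvg_cst.
have E : (fun x : R => \sum_(i <- j :: r) F i x) = (fun x => F j x + \sum_(i <- r) F i x).
  by apply/funext => x; rewrite big_cons.
rewrite E big_cons int01D// ih2; split => //.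
by have := integrableD _ (Fi j) ih1; apply.
Qed.

(* Compare f with the step function x |-> f (floor (N x) / N), whose averages
   and integral are combinations of frequencies and interval lengths. *)
Lemma equidistributed (u : nat -> R) : (forall i, 0 <= u i <= 1) ->
  (forall q : rat, 0 <= (ratr q : R) ->
    freq u (ratr q) n @[n --> \oo] --> Num.min 1 (ratr q : R)) ->
  forall f : R -> R, continuous f -> mean (fun i : 'I_n => f (u i)) @[n --> \oo] --> int01 f.
Proof.
move=> u01 fq f cf; apply/cvgrPdist_le => e e0.
have e3 : 0 < e / 3 by rewrite divr_gt0.
have [M hM] := uniform_continuity01 cf e3.
have [N NM] : exists N : R, N = M.+1%:R by eexists.
have N0 : 0 < N by rewrite NM.
pose q (j : nat) : R := j%:R / N.
have qE j : q j = ratr (j%:R / M.+1%:R) by rewrite fmorph_div /= !ratr_nat /q NM.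
have q0 j : 0 <= q j by rewrite divr_ge0// ltW.
(* There is one cell more than the N = M + 1 cells of [0, 1): the last one takes the point x = 1,
   where the floor of N x is N. *)
pose b (j : 'I_M.+2) (x : R) : R := (x < q j.+1)%R%:R - (x < q j)%R%:R.
pose S x := \sum_(j < M.+2) f (q j) * b j x.
have bE x (j : 'I_M.+2) : 0 <= x -> b j x = (Num.truncn (x * N) == j :> nat)%:R.
  move=> x0; rewrite truncn_eq ?mulr_ge0 ?(ltW N0)// /b /q !ltr_pdivlMr//.
  case: (ltP (x * N) j%:R) => h /=; last by rewrite subr0.
  by rewrite (lt_le_trans h) ?ler_nat// subrr.
have SE x : 0 <= x <= 1 -> S x = f (q (Num.truncn (x * N))).
  move=> /andP[x0 x1]; have jN : (Num.truncn (x * N) < M.+2)%N.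
    rewrite ltnS -(ler_nat R) -NM; apply: le_trans (_ : x * N <= _).
      by rewrite truncn_le mulr_ge0// ltW.
    by rewrite ler_piMl// ltW.
  rewrite /S (bigD1 (Ordinal jN))//= big1 ?addr0; first by rewrite bE// eqxx mulr1.
  move=> j ji; rewrite bE//; case: eqP => [h|_]; last by rewrite mulr0.
  by move: ji; rewrite -val_eqE /= h eqxx.
have fS x : 0 <= x <= 1 -> `|f x - S x| <= e / 3.
  move=> x01; rewrite SE//; move: (x01) => /andP[x0 x1].
  have xN0 : 0 <= x * N by rewrite mulr_ge0// ltW.
  have /andP[t1 t2] := truncn_itv xN0.
  have qx : q (Num.truncn (x * N)) <= x by rewrite ler_pdivrMr.
  apply: hM => //; first by rewrite q0 (le_trans qx).
  rewrite ger0_norm ?subr_ge0// -NM lerBlDr -(ler_pM2r N0) mulrDl mulVf ?gt_eqF//.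
  by rewrite /q mulfVK ?gt_eqF// addrC natr1 ltW.
have bi j : leb.-integrable I01 (EFin \o b j).
  by have := integrableB _ (integrable_lt (q j.+1)) (integrable_lt (q j)); apply.
have [Si intS] := int01_sum (index_enum 'I_M.+2) (fun j => integrable01Z (f (q j)) (bi j)).
have h1 : `|int01 f - int01 S| <= e / 3.
  have fi := continuous_integrable01 cf.
  rewrite /int01 -RintegralB//; apply: (le_trans (le_normr_Rintegral _ _)) => //.
    by have := integrableB _ fi Si; apply.
  rewrite -[leRHS]int01_cst; apply: le_Rintegral => //.
  - by apply: integrable_norm; have := integrableB _ fi Si; apply.
  - by apply: continuous_integrable01 => x; exact: cvg_cst.
have mS : mean (fun i : 'I_n => S (u i)) @[n --> \oo] --> int01 S.
  rewrite /S intS.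
  have -> : (fun n => mean (fun i : 'I_n => \sum_(j < M.+2) f (q j) * b j (u i))) =
     (fun n => \sum_(j < M.+2) f (q j) * (freq u (q j.+1) n - freq u (q j) n)).
    apply/funext => n; rewrite /mean exchange_big /= mulr_sumr; apply: eq_bigr => j _.
    by rewrite -mulr_sumr mulrCA sumrB mulrBr.
  apply: cvg_sumr => j _; rewrite int01_scale//.
  apply: cvgM; first exact: cvg_cst.
  have -> : int01 (b j) = Num.min 1 (q j.+1) - Num.min 1 (q j).
    rewrite -!int01_lt//; exact: (RintegralB (mu := leb) _ (integrable_lt _) (integrable_lt _)).
  by apply: cvgB; rewrite qE; apply: fq; rewrite -qE.
move/cvgrPdist_le : mS => /(_ _ e3) mS; near=> n.
have h2 : `|int01 S - mean (fun i : 'I_n => S (u i))| <= e / 3 by near: n.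
have h3 : `|mean (fun i : 'I_n => f (u i)) - mean (fun i : 'I_n => S (u i))| <= e / 3.
  by apply: mean_dist; [exact: ltW|move=> i; exact: fS].
have LL (a c d g : R) : `|a - c| <= e / 3 -> `|c - d| <= e / 3 -> `|g - d| <= e / 3 ->
  `|a - g| <= e by rewrite !ler_norml; lra.
exact: LL h1 h2 h3.
Unshelve. all: by end_near. Qed.

End Frequencies.

(** * Almost sure convergence of frequencies *)

Section FinitePartition.
Context d (T : measurableType d) (R : realType) (P : probability T R).

Lemma probability_fin_partition (I : finType) (X : T -> I) (A : set T) :
  measurable A -> (forall a, measurable (X @^-1` [set a])) ->
  P A = (\sum_(a : I) P (A `&` X @^-1` [set a]))%E.
Proof.
move=> mA mX; rewrite -[in LHS](setIT A).
have -> : [set: T] = \bigcup_(a in [set: I]) X @^-1` [set a].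
  by apply/seteqP; split => // w _; exists (X w).
rewrite setI_bigcupr measure_fin_bigcup//.
- have -> : [set: I] = [set` index_enum I].
    by apply/seteqP; split => // a _ /=; rewrite mem_index_enum.
  by rewrite -fsbig_seq ?index_enum_uniq.
- exact: finite_finset.
- apply/trivIsetP => a b _ _ /eqP ab; apply/seteqP; split => // w [[_ /= h1] [_ /= h2]].
  by apply: ab; rewrite -h1 -h2.
- by move=> a _; exact: measurableI.
Qed.

End FinitePartition.

Section EmpiricalFrequencies.
Context {R : realType} d {T : measurableType d} {P : probability T R}.
Variable U : nat -> {RV P >-> measurableTypeR R}.
Hypothesis iidU : iid_uniform U.

Lemma uniform_lt (q : R) i : 0 <= q -> P (U i @^-1` `]-oo, q[%classic) = (Num.min 1 q)%:E.
Proof.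
move=> q0; have [_ _ /(_ i `]-oo, q[%classic)] := iidU.
rewrite /distribution /pushforward => ->; last exact: measurable_itv.
rewrite -lebesgue_lt01// setIC -(integral_indic lebesgue_measure (D := `]-oo, q[%classic))//.
rewrite /uniform_prob; apply: eq_integral => x _.
by rewrite /uniform_pdf subr0 invr1 indicE mem_setE in_itv /=; case: ifP.
Qed.

Definition below (q : R) n (w : T) : {ffun 'I_n -> bool} := [ffun i => U (val i) w < q].

(** Transfers the indicators of [U i < q] to the finite Bernoulli calculus, where the fourth moment
    bound was proved. Indices beyond n receive the full set. *)
Lemma below_law (q : R) n (a : {ffun 'I_n -> bool}) : 0 <= q ->
  P (below q n @^-1` [set a]) = (bern_wt (fun _ : 'I_n => Num.min 1 q) a)%:E.
Proof.
move=> q0; pose ray : set (measurableTypeR R) := `]-oo, q[%classic.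
pose B (i : nat) := if insub i is Some j then (if a j then ray else ~` ray) else setT.
have mray : measurable ray by exact: measurable_itv.
have mB i : measurable (B i).
  by rewrite /B; case: insubP => // j _ _; case: (a j) => //; exact: measurableC.
have [_ /(_ (iota 0 n) B (iota_uniq _ _) mB) indU _] := iidU.
have BE (i : 'I_n) : B i = if a i then ray else ~` ray by rewrite /B valK.
have -> : below q n @^-1` [set a] = [set w | forall i, i \in iota 0 n -> B i (U i w)].
  apply/seteqP; split => w /=.
    move=> e i; rewrite mem_iota /= add0n => lti; rewrite (BE (Ordinal lti)) -e ffunE /=.
    by rewrite /ray; case: ifP => h /=; rewrite in_itv /= h.
  move=> h; apply/ffunP => i; have := h i; rewrite mem_iota /= add0n ltn_ord => /(_ isT).
  rewrite BE ffunE /ray; case: (a i) => /=; rewrite in_itv /= => //.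
  by move=> /negP/negbTE.
rewrite indU -[iota 0 n](_ : index_iota 0 n = _); last by rewrite /index_iota subn0.
rewrite big_mkord /bern_wt -prodEFin; apply: eq_bigr => i _; rewrite BE.
case: (a i); first exact: uniform_lt.
rewrite preimage_setC probability_setC ?uniform_lt//.
exact: (measurable_funPTI (U i) mray).
Qed.

Lemma measurable_below (q : R) n a : measurable (below q n @^-1` [set a]).
Proof.
rewrite (_ : _ @^-1` _ = \bigcap_(i in [set: 'I_n]) [set w | (U (val i) w < q) = a i]); last first.
  apply/seteqP; split => w /=; first by move=> <- i _; rewrite ffunE.
  by move=> h; apply/ffunP => i; rewrite ffunE h.
apply: fin_bigcap_measurable; first exact: finite_finset.
move=> i _; have mU : measurable [set w | U (val i) w < q].
  exact: (lt_set_measurable q (measurable_funPT (U (val i)))).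
case: (a i).
  by rewrite (_ : [set w | _] = [set w | U (val i) w < q])//; apply/seteqP; split.
rewrite (_ : [set w | _] = ~` [set w | U (val i) w < q]); first exact: measurableC.
by apply/seteqP; split => w /=; [move=> ->|move=> /negP/negbTE].
Qed.

Lemma freq_below (q : R) n w :
  freq (fun i => U i w) q n = mean (fun i : 'I_n => (below q n w i)%:R).
Proof. by rewrite /freq; congr (_ * _); apply: eq_bigr => i _; rewrite ffunE. Qed.

Definition freq_deviation (q e : R) n : set T :=
  [set w | e < `|freq (fun i => U i w) q n - Num.min 1 q|].

Lemma freq_deviationE (q e : R) n w : freq_deviation q e n w =
  (e < `|mean (fun i : 'I_n => (below q n w i)%:R) - Num.min 1 q|) :> Prop.
Proof. by rewrite /freq_deviation /= freq_below. Qed.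

Lemma measurable_freq_deviation (q e : R) n : measurable (freq_deviation q e n).
Proof.
rewrite (_ : freq_deviation q e n = \bigcup_(a in [set a : {ffun 'I_n -> bool} |
    e < `|mean (fun i : 'I_n => (a i)%:R) - Num.min 1 q|]) below q n @^-1` [set a]).
  by apply: fin_bigcup_measurable; [exact: finite_finset|move=> a _; exact: measurable_below].
apply/seteqP; split => w; rewrite freq_deviationE.
  by move=> h; exists (below q n w).
by move=> [a /= h ->].
Qed.

(* The fourth moment of a sum of n centered Bernoulli variables is O(n^2). *)
Lemma freq_deviation_le (q e : R) n : 0 <= q -> 0 < e -> (0 < n)%N ->
  (P (freq_deviation q e n) <= (3 / e ^+ 4 / n%:R ^+ 2)%:E)%E.
Proof.
move=> q0 e0 n0; pose p (_ : 'I_n) : R := Num.min 1 q.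
have p01 i : 0 <= p i <= 1 by rewrite /p le_min ler01 q0 ge_min lexx.
have nR : 0 < n%:R :> R by rewrite ltr0n.
rewrite (probability_fin_partition P (@measurable_freq_deviation q e n) (@measurable_below q n)).
have B := bexp_sum4 p01; rewrite card_ord in B.
have M := bexp_markov p01 (a := (n%:R * e) ^+ 4) (f := fun w => (\sum_i eps p i w) ^+ 4).
apply: (@le_trans _ _ (bexp p (fun a => ((n%:R * e) ^+ 4 < (\sum_i eps p i a) ^+ 4)%R%:R))%:E).
  rewrite /bexp -sumEFin; apply: lee_sum => a _.
  case: (boolP ((n%:R * e) ^+ 4 < (\sum_i eps p i a) ^+ 4)) => h.
    rewrite mulr1 -below_law//; apply: le_measure; rewrite ?inE.
    - by apply: measurableI; [exact: measurable_freq_deviation|exact: measurable_below].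
    - exact: measurable_below.
    - exact: subIsetr.
  rewrite mulr0 (_ : _ `&` _ = set0) ?measure0//; apply/seteqP; split => // w [].
  rewrite freq_deviationE /= => hd aE; move: hd; rewrite aE => hd; case/negP: h.
  have -> : \sum_i eps p i a = n%:R * (mean (fun i : 'I_n => (a i)%:R) - Num.min 1 q).
    rewrite /mean mulrBr mulVKf ?gt_eqF// /eps sumrB; congr (_ - _).
    by rewrite sumr_const card_ord mulr_natl.
  rewrite -[ltRHS]ger0_norm; last by rewrite -[4%N]/(2 * 2)%N exprM sqr_ge0.
  rewrite normrX normrM (gtr0_norm nR) ltrXn2r// ?nnegrE ?mulr_ge0 ?(ltW e0)//.
  by rewrite ltr_pM2l.
rewrite lee_fin; apply: le_trans (M _ _) _.
- by rewrite exprn_gt0// mulr_gt0.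
- by move=> w; rewrite -[4%N]/(2 * 2)%N exprM sqr_ge0.
- apply: (@le_trans _ _ (3 * n%:R ^+ 2 / (n%:R * e) ^+ 4)).
    by apply: ler_wpM2r => //; rewrite invr_ge0 exprn_ge0// mulr_ge0 ?(ltW e0).
  rewrite le_eqVlt; apply/orP; left; apply/eqP; field.
  by rewrite !gt_eqF.
Qed.

(** The partial sums are at most 2 C (1 - 1/(n+1)), by telescoping. *)
Lemma sum_inv_sqr_lty (C : R) : 0 <= C ->
  (\sum_(n <oo) (C / n.+1%:R ^+ 2)%:E < +oo)%E.
Proof.
move=> C0; apply: (@le_lt_trans _ _ (2 * C)%:E); last exact: ltry.
apply: lime_le; first by apply: is_cvg_nneseries => n _ _; rewrite lee_fin divr_ge0// exprn_ge0.
apply: nearW => n; rewrite sumEFin lee_fin.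
have h : \sum_(0 <= i < n) C / i.+1%:R ^+ 2 <= 2 * C * (1 - n.+1%:R^-1).
  elim: n => [|n IH]; first by rewrite big_nil invr1 subrr mulr0.
  rewrite big_nat_recr//=; apply: (le_trans (lerD IH (lexx _))).
  have x0 : 0 < n.+1%:R :> R by [].
  have -> : n.+2%:R = n.+1%:R + 1 :> R by rewrite -natr1.
  have x1 : (1 : R) <= n.+1%:R by rewrite ler1n.
  have L (x : R) : 1 <= x -> 2 * C * (1 - x^-1) + C / x ^+ 2 <= 2 * C * (1 - (x + 1)^-1).
    move=> x1'; have x0' : 0 < x by exact: lt_le_trans x1'.
    rewrite -subr_ge0.
    have -> : 2 * C * (1 - (x + 1)^-1) - (2 * C * (1 - x^-1) + C / x ^+ 2) =
      C * (x - 1) / (x ^+ 2 * (x + 1)) by field; rewrite !gt_eqF ?addr_gt0.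
    by rewrite divr_ge0 ?mulr_ge0 ?exprn_ge0 ?subr_ge0 ?addr_ge0// ?(ltW x0').
  exact: L.
apply: (le_trans h); rewrite ler_piMr ?mulr_ge0//.
Qed.

Definition freq_good (q e : R) : set (nat -> R) :=
  [set u | exists N : nat, forall n, (N <= n)%N ->
     `|freq u q n - Num.min 1 q| <= e].

Lemma freq_good_ae (q e : R) : 0 <= q -> 0 < e ->
  measurable [set w | freq_good q e (fun i => U i w)] /\
  P [set w | freq_good q e (fun i => U i w)] = 1%E.
Proof.
move=> q0 e0; pose F n := freq_deviation q e n.+1.
have E : [set w | freq_good q e (fun i => U i w)] = ~` lim_sup_set F.
  apply/seteqP; split => w /=.
    move=> [N hN] h; have [k /= Nk] := h N I; rewrite /F /freq_deviation /=.
    by apply/negP; rewrite -leNgt; apply: hN; exact: leqW.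
  move=> h; apply: contrapT => hg; apply: h => N _; apply: contrapT => hN; apply: hg.
  exists N.+1 => -[//|n] Nn; rewrite leNgt; apply/negP => hd; apply: hN.
  by exists n.
have mF k : measurable (F k) by exact: measurable_freq_deviation.
have mL : measurable (lim_sup_set F).
  by apply: bigcap_measurable => // n _; apply: bigcup_measurable.
rewrite E; split; first exact: measurableC.
rewrite probability_setC// lim_sup_set_cvg0 ?sube0//.
apply: le_lt_trans (sum_inv_sqr_lty (_ : 0 <= 3 / e ^+ 4)); last by rewrite divr_ge0// exprn_ge0// ltW.
by apply: lee_nneseries => // n _ ; exact: freq_deviation_le.
Qed.

End EmpiricalFrequencies.

(** * The conditional law of the random graph *)

Section LambdaMaxMeasurable.
Context d (T : measurableType d) (R : realType).

Lemma rational_approx n (g : 'rV[R]_n -> R) (z : 'rV[R]_n) : continuous g -> 0 < g z ->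
  exists q : {ffun 'I_n -> rat}, 0 < g (\row_i ratr (q i)).
Proof.
move=> cg gz; have ngz : \forall t \near nbhs z, 0 < g t by exact: (cvgr_gt _ (cg z)).
move: ngz => /nbhs_ballP[e /= e0 he].
have H i : exists q : rat, z 0 i < ratr q < z 0 i + e.
  have ze : z 0 i < z 0 i + e by rewrite ltrDl.
  by have [q] := rat_in_itvoo ze; rewrite in_itv /=; exists q.
have [q hq] := choice H; exists [ffun i => q i]; apply: he; split => // i j.
rewrite !ord1 !mxE ffunE /ball /=; have /andP[h1 h2] := hq j.
by rewrite ltr_norml; lra.
Qed.

(** The Rayleigh quotient exceeds [c] on an open set of vectors, hence at a rational one; the event
    becomes a countable union of conditions polynomial in the entries. *)
Lemma lambda_max_gt n (M : 'M[R]_n) (c : R) : (0 < n)%N -> M^T = M ->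
  (c < lambda_max M) =
  `[< exists q : {ffun 'I_n -> rat}, let x := \row_i ratr (q i) in
      0 < dot (x *m M) x - c * dot x x >].
Proof.
move=> n0 sM; have [m [x topx]] := ex_top_eigenpair_gt0 n0 sM.
have [x1 xM xtop] := topx; rewrite (lambda_max_eq topx).
apply/idP/asboolP => [cm|[q /=]].
  apply: (@rational_approx n (fun z => dot (z *m M) z - c * dot z z) x); last first.
    by rewrite xM dotZl x1 !mulr1 subr_gt0.
  have cx i : continuous (fun z : 'rV[R]_n => z 0 i) by exact: coord_continuous.
  have cxM i : continuous (fun z : 'rV[R]_n => (z *m M) 0 i).
    move=> z; under eq_fun do rewrite mxE.
    apply: (@cvg_sumr _ _ _ (nbhs z)) => j _.
    by apply: cvgM; [exact: cx|exact: cvg_cst].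
  have c1 : continuous (fun z : 'rV[R]_n => dot (z *m M) z).
    exact: (@dot_continuous _ _ (fun z => z *m M) id cxM cx).
  have c2 : continuous (fun z : 'rV[R]_n => dot z z).
    exact: (@dot_continuous _ _ id id cx cx).
  move=> z; apply: (cvgB (F := nbhs z)); first exact: (c1 z).
  by apply: (cvgM (F := nbhs z)); [exact: cvg_cst|exact: (c2 z)].
set z := \row_i _; have := xtop z => h1 h2; rewrite ltNge; apply/negP => mc.
have : m * dot z z <= c * dot z z by apply: ler_wpM2r => //; exact: dot_ge0.
by move: h1 h2; lra.
Qed.

Lemma measurable_lambda_max n (M : T -> 'M[R]_n) :
  (forall x, (M x)^T = M x) -> (forall i j, measurable_fun setT (fun x => M x i j)) ->
  measurable_fun setT (fun x => lambda_max (M x)).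
Proof.
move=> sM mM; case: (posnP n) => [n0|n0].
  subst n; have -> : (fun x => lambda_max (M x)) = cst (lambda_max (0 : 'M[R]_0)).
    by apply/funext => x; rewrite /= [M x]flatmx0.
  exact: measurable_cst.
(* Measurability is tested on sets f < c, whereas [lambda_max_gt] describes sets c < f; hence the
   change of sign. *)
have -> : (fun x => lambda_max (M x)) = (fun x => - (- lambda_max (M x))).
  by apply/funext => x; rewrite opprK.
apply: measurableT_comp => //; apply: measurable_fun_lt_set => c.
rewrite (_ : [set x | _] = \bigcup_(q : {ffun 'I_n -> rat})
    [set x | 0 < dot (\row_i ratr (q i) *m M x) (\row_i ratr (q i))
                 - - c * dot (\row_(i < n) (ratr (q i) : R)) (\row_i ratr (q i))]); last first.
  apply/seteqP; split => x /=; rewrite ltrNl lambda_max_gt//.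
    by move=> /asboolP[q hq]; exists q.
  by move=> [q _ hq]; apply/asboolP; exists q.
apply: countable_bigcupT_measurable; first exact: countableP.
move=> q; set z := \row_i _.
rewrite (_ : [set x | _] = [set x | - (dot (z *m M x) z - - c * dot z z) < 0]); last first.
  by apply/seteqP; split => x /=; rewrite oppr_lt0.
apply: lt_set_measurable; apply: measurableT_comp => //; apply: measurable_funB => //.
under eq_fun do rewrite dot_mulmx.
apply: measurable_sum => i; apply: measurable_sum => j.
by do 2 apply: measurable_funM => //.
Qed.

End LambdaMaxMeasurable.

Lemma bernoulli_prob_set1 (R : realType) (p : R) (b : bool) : 0 <= p <= 1 ->
  bernoulli_prob p [set b] = (if b then p else 1 - p)%:E.
Proof.
move=> p01; rewrite bernoulli_probE// !diracE; case: b.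
  by rewrite mem_set// memNset//= mule1 mule0 adde0.
by rewrite memNset// mem_set//= mule1 mule0 add0e.
Qed.

Section GraphLawMeasurable.
Context {R : realType} (L : R) (K : R -> R -> R).
Hypotheses (lK : lipschitz_kernel L K) (K01 : forall x y, 0 <= K x y <= 1).
Variable n : nat.
Local Notation tupR := (n.-tuple (measurableTypeR R)).

Lemma measurable_kernel_matrix i j :
  measurable_fun setT (fun y : tupR => kernel_matrix K y i j).
Proof.
under eq_fun do rewrite mxE; case: eqP => _; first exact: measurable_cst.
apply: (measurable_lipschitz_kernel (k := L)); try exact: measurable_tnth.
- by move=> x; apply: continuous_measurable_fun; exact: lipschitz_kernel_continuous lK.
- by case: lK.
Qed.

Lemma kernel_matrix_sym (y : tupR) : (kernel_matrix K y)^T = kernel_matrix K y.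
Proof.
by apply/matrixP => i j; rewrite !mxE eq_sym; case: eqP => // _; case: lK => ->.
Qed.

Lemma measurable_lambda_max_kernel :
  measurable_fun setT (fun y : tupR => lambda_max (kernel_matrix K y)).
Proof.
by apply: measurable_lambda_max; [exact: kernel_matrix_sym|exact: measurable_kernel_matrix].
Qed.

Lemma measurable_graph_wt a :
  measurable_fun setT (fun y : tupR => bern_wt (edge_prob (kernel_matrix K y)) a).
Proof.
apply: measurable_prod => e _; rewrite /edge_prob.
case: (a e); case: (e.1 < e.2)%N; try exact: measurable_cst.
  exact: measurable_kernel_matrix.
by apply: measurable_funB => //; exact: measurable_kernel_matrix.
Qed.

Definition graph_shift (a : {ffun 'I_n * 'I_n -> bool}) (y : tupR) : R :=
  lambda_max (graph_mx a) - lambda_max (kernel_matrix K y).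

Lemma measurable_graph_shift_lt a (q : R) : measurable [set y | graph_shift a y < q].
Proof.
apply: lt_set_measurable; apply: measurable_funB => //.
exact: measurable_lambda_max_kernel.
Qed.

Definition graph_cdf (q : R) (y : tupR) : R :=
  law_exp (graph_law (kernel_matrix K y)) (fun x => (x < q)%R%:R).

Lemma graph_cdfE q y : graph_cdf q y = \sum_(a : {ffun 'I_n * 'I_n -> bool})
  bern_wt (edge_prob (kernel_matrix K y)) a * \1_[set y | graph_shift a y < q] y.
Proof.
rewrite /graph_cdf graph_law_exp; apply: eq_bigr => a _; congr (_ * _).
rewrite indicE (_ : (y \in _) = (graph_shift a y < q))//.
by apply/idP/idP; rewrite inE.
Qed.

Lemma kernel_matrix01 (y : tupR) i j : 0 <= kernel_matrix K y i j <= 1.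
Proof. by rewrite mxE; case: eqP => _; rewrite ?lexx ?ler01 ?K01. Qed.

Lemma graph_cdf01 q y : 0 <= graph_cdf q y <= 1.
Proof.
rewrite /graph_cdf graph_law_exp; have p01 := edge_prob01 (kernel_matrix01 y).
apply/andP; split; first by apply: bexp_ge0.
rewrite -[leRHS](bexp_cst (edge_prob (kernel_matrix K y))).
by apply: ler_bexp => // w; rewrite lern1 leq_b1.
Qed.

Lemma measurable_graph_cdf q : measurable_fun setT (graph_cdf q).
Proof.
rewrite (_ : graph_cdf q = fun y => \sum_(a : {ffun 'I_n * 'I_n -> bool})
  bern_wt (edge_prob (kernel_matrix K y)) a * \1_[set y | graph_shift a y < q] y); last first.
  by apply/funext => y; exact: graph_cdfE.
apply: measurable_sum => a; apply: measurable_funM; first exact: measurable_graph_wt.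
by apply: measurable_indic; exact: measurable_graph_shift_lt.
Qed.

Context d (T : measurableType d) (P : probability T R).
Variables (Y : T -> tupR) (A : 'I_n -> 'I_n -> {RV P >-> bool}).
Hypothesis mY : measurable_fun setT Y.
Hypothesis graphA : cond_random_graph K Y A.

(** Pairs that are not increasing are set to false, in agreement with their probability 0 in
    [edge_prob]. *)
Definition config (w : T) : {ffun 'I_n * 'I_n -> bool} :=
  [ffun e : 'I_n * 'I_n => if (e.1 < e.2)%N then A e.1 e.2 w else false].

Lemma graph_mx_config w : graph_mx (config w) = adjacency_matrix A w.
Proof.
have [symA diagA _] := graphA; apply/matrixP => i j; rewrite !mxE.
case: eqP => [->|/eqP ij]; first by rewrite diagA.
rewrite /edge_of ffunE; case: (ltnP i j) => h /=; first by rewrite h.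
by rewrite ltn_neqAle [_ == _ :> nat]eq_sym ij h /= symA.
Qed.

Lemma measurable_config a : measurable (config @^-1` [set a]).
Proof.
rewrite (_ : _ @^-1` _ = \bigcap_(e in [set: 'I_n * 'I_n])
  [set w | (if (e.1 < e.2)%N then A e.1 e.2 w else false) = a e]); last first.
  apply/seteqP; split => w /=; first by move=> <- e _; rewrite ffunE.
  by move=> h; apply/ffunP => e; rewrite ffunE h.
apply: fin_bigcap_measurable; first exact: finite_finset.
move=> e _; case: (e.1 < e.2)%N.
  have m1 : measurable [set a e] by [].
  exact: (measurable_funPTI (A e.1 e.2) m1).
case: (a e); last by rewrite (_ : [set w | _] = setT)//; apply/seteqP.
by rewrite (_ : [set w | _] = set0)//; apply/seteqP; split.
Qed.

Let yw a (y : tupR) := bern_wt (edge_prob (kernel_matrix K y)) a.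

(** If [a] is true at some pair that is not increasing, both sides vanish; otherwise the weight is
    the product of the Bernoulli masses over increasing pairs. *)
Lemma config_law (B : set tupR) a : measurable B ->
  P (Y @^-1` B `&` config @^-1` [set a]) = (\int[P]_(w in Y @^-1` B) (yw a (Y w))%:E)%E.
Proof.
move=> mB; have [_ _ law] := graphA.
case: (boolP [forall e : 'I_n * 'I_n, (e.1 < e.2)%N || ~~ a e]) => [/forallP ha|].
  pose S i j : set bool := [set a (i, j)].
  have -> : config @^-1` [set a] = [set w | forall i j : 'I_n, (i < j)%N -> S i j (A i j w)].
    apply/seteqP; split => w /=; first by move=> e i j ij; rewrite /S -e /= ffunE /= ij.
    move=> h; apply/ffunP => -[i j]; rewrite ffunE /=; case: ifP => ij; first exact: h.
    by have := ha (i, j); rewrite /= ij /= => /negbTE ->.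
  rewrite law//; apply: eq_integral => w _.
  have E i j : bernoulli_prob (K (tnth (Y w) i) (tnth (Y w) j)) (S i j) =
    (if a (i, j) then K (tnth (Y w) i) (tnth (Y w) j) else 1 - K (tnth (Y w) i) (tnth (Y w) j))%:E.
    by rewrite /S bernoulli_prob_set1.
  under eq_bigr => i _ do [under eq_bigr => j _ do rewrite E; rewrite prodEFin].
  rewrite prodEFin; congr EFin; rewrite pair_big_dep /= /yw /bern_wt [RHS](bigID (fun e : 'I_n * 'I_n => (e.1 < e.2)%N)) /=.
  rewrite [X in _ = _ * X]big1 ?mulr1; last first.
    move=> e /negbTE ne; have := ha e; rewrite ne /= => /negbTE ->.
    by rewrite /edge_prob ne subr0.
  apply: eq_bigr => -[i j] /= ij; rewrite /edge_prob /= ij mxE.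
  by case: eqP ij => [->|//]; rewrite ltnn.
rewrite negb_forall => /existsP[e]; rewrite negb_or negbK => /andP[/negbTE ne ae].
rewrite (_ : _ `&` _ = set0); last first.
  apply/seteqP; split => // w [_ /= h]; move: ae; rewrite -h ffunE ne.
  by [].
rewrite measure0 (eq_integral (fun=> 0%E)) ?integral0// => w _.
by rewrite /yw /bern_wt (bigD1 e)//= ae /edge_prob ne mul0r.
Qed.

(** On each value of [config] the event depends on the sample alone and can be merged into [B];
    [config_law] then applies term by term. *)
Lemma shift_law (B : set tupR) (q : R) : measurable B ->
  P (Y @^-1` B `&` [set w | lambda_max (adjacency_matrix A w)
                            - lambda_max (kernel_matrix K (Y w)) < q]) =
  (\int[P]_(w in Y @^-1` B) (graph_cdf q (Y w))%:E)%E.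
Proof.
move=> mB; have mYB : measurable (Y @^-1` B) by rewrite -[X in measurable X]setTI; exact: mY.
pose X := [set w | lambda_max (adjacency_matrix A w) - lambda_max (kernel_matrix K (Y w)) < q].
have XE a : Y @^-1` B `&` X `&` config @^-1` [set a] =
    Y @^-1` (B `&` [set y | graph_shift a y < q]) `&` config @^-1` [set a].
  apply/seteqP; split => w /= [].
    by move=> [Bw]; rewrite /X /= -graph_mx_config => h e; rewrite -[in X in X < q]e.
  move=> [Bw h] e; split; last exact: e.
  by split; [exact: Bw|rewrite /X /= -graph_mx_config e; exact: h].
have mBa a : measurable (B `&` [set y | graph_shift a y < q]).
  by apply: measurableI => //; exact: measurable_graph_shift_lt.
have mpre a : measurable (Y @^-1` (B `&` [set y | graph_shift a y < q])).
  by rewrite -[X in measurable X]setTI; exact: mY.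
have mX : measurable (Y @^-1` B `&` X).
  have -> : Y @^-1` B `&` X = \bigcup_(a in [set: {ffun 'I_n * 'I_n -> bool}])
      (Y @^-1` B `&` X `&` config @^-1` [set a]).
    by apply/seteqP; split => [w h|w [a _ []]//]; exists (config w).
  apply: fin_bigcup_measurable; first exact: finite_finset.
  by move=> a _; rewrite XE; apply: measurableI => //; exact: measurable_config.
rewrite -/X (probability_fin_partition P mX measurable_config).
have mcomp (f : tupR -> R) : measurable_fun setT f ->
    measurable_fun (Y @^-1` B) (fun w => (f (Y w))%:E).
  by move=> mf; apply/measurable_EFinP; apply: measurable_funTS; exact: (measurableT_comp mf mY).
have mem_preY (C : set tupR) w : (w \in Y @^-1` C) = (Y w \in C).
  by apply/idP/idP; rewrite !inE.
transitivity (\sum_a \int[P]_(w in Y @^-1` B)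
    (yw a (Y w) * \1_[set y | graph_shift a y < q] (Y w))%:E)%E.
  apply: eq_bigr => a _; rewrite XE (config_law _ (mBa a)) preimage_setI integral_mkcondr.
  apply: eq_integral => w _; rewrite /patch indicE.
  rewrite mem_preY.
  by case: (_ \in _); rewrite ?mulr1 ?mulr0.
rewrite -ge0_integral_sum//.
- by apply: eq_integral => w _; rewrite sumEFin graph_cdfE.
- move=> a; apply: (mcomp (fun y => yw a y * \1_[set y | graph_shift a y < q] y)).
  apply: measurable_funM; first exact: measurable_graph_wt.
  by apply: measurable_indic; exact: measurable_graph_shift_lt.
- move=> a w _; rewrite lee_fin mulr_ge0// ?indicE//.
  by apply: bern_wt_ge0; exact: edge_prob01 (kernel_matrix01 _).
Qed.

Variable kappa : R.-pker tupR ~> (measurableTypeR R).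
Hypothesis cond : cond_distribution (P := P) (T2 := measurableTypeR R)
  (fun w => lambda_max (adjacency_matrix A w) - lambda_max (kernel_matrix K (Y w))) Y kappa.

(** Both sides have the same integral over every measurable set of tuples under the law of [Y]. The
    exceptional set consists of tuples, so that it can be expressed through the sequence of sample
    points. *)
Lemma kernel_cdf_ae (q : R) : exists N : set tupR,
  [/\ measurable N, P (Y @^-1` N) = 0%E &
     forall y, ~ N y -> kappa y `]-oo, q[%classic = (graph_cdf q y)%:E].
Proof.
have mray : measurable (`]-oo, q[%classic : set (measurableTypeR R)) by exact: measurable_itv.
have [Yf YE] : exists Yf : {mfun T >-> tupR}, Yf = Y :> (T -> tupR).
  by exists (mfun_Sub (mem_set mY : Y \in mfun)).
pose mu : probability tupR R := distribution P Yf.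
have kge y : (0 <= kappa y `]-oo, q[%classic)%E by exact: measure_ge0.
have mk := measurable_kernel kappa _ mray.
have mg : measurable_fun setT (fun y : tupR => (graph_cdf q y)%:E).
  by apply/measurable_EFinP; exact: measurable_graph_cdf.
have k1 y : (kappa y `]-oo, q[%classic <= 1)%E.
  by rewrite -(@prob_kernel _ _ _ _ _ kappa y); apply: le_measure => //; rewrite inE.
have muT : mu setT = 1%E by exact: probability_setT.
have ki : mu.-integrable setT (fun y => kappa y `]-oo, q[%classic).
  apply/integrableP; split => //; apply: (@le_lt_trans _ _ (\int[mu]_y (cst 1 y))%E).
    apply: ge0_le_integral => //; first exact: measurableT_comp.
    by move=> y _; rewrite gee0_abs.
  by rewrite integral_cst// mul1e -[X in (X < _)%E]/(mu setT) muT ltry.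
have [|N [mN N0 hN]] := integral_ae_eq measurableT ki mg.
  move=> E _ mE; rewrite !ge0_integral_pushforward//.
  - rewrite YE /comp -(shift_law q mE) -cond//.
  - by apply: measurable_funTS.
  - by move=> y _; rewrite lee_fin; have /andP[] := graph_cdf01 q y.
  - by apply: measurable_funTS.
exists N; split => //; first by have := N0; rewrite -[LHS]/(P (Yf @^-1` N)) YE.
by move=> y Ny; apply: contrapT => h; apply: Ny; apply: hN => /= /(_ I).
Qed.

End GraphLawMeasurable.

(** * Identification of finite laws *)

Section DiscreteLaw.
Context {R : realType}.
Local Notation mR := (measurableTypeR R).

(** The null set of [kernel_cdf_ae] depends on the ray, so a countable family of generators is
    required. *)
Lemma measurable_rational_rays :
  @measurable _ mR = <<s [set A : set mR | exists q : rat, A = `]-oo, ratr q[%classic] >>.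
Proof.
apply/seteqP; split; last first.
  apply: smallest_sub; first exact: sigma_algebra_measurable.
  by move=> _ [q ->]; exact: measurable_itv.
rewrite [X in X `<=` _]RGenInftyO.measurableE.
apply: smallest_sub; first exact: smallest_sigma_algebra.
move=> _ [x ->].
pose G := [set A : set mR | exists q : rat, A = `]-oo, ratr q[%classic].
rewrite (_ : `]-oo, x[%classic =
    \bigcup_(q in [set q : rat | ratr q < x]) `]-oo, ratr q[%classic); last first.
  apply/seteqP; split => y /=; rewrite in_itv /=.
    move=> /rat_in_itvoo[q]; rewrite in_itv /= => /andP[yq qx].
    by exists q => //=; rewrite in_itv.
  by move=> [q /= qx]; rewrite in_itv /= => /lt_trans; apply.
have h (F : rat -> set (g_sigma_algebraType G)) (D : set rat) : (forall q, measurable (F q)) ->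
    measurable (\bigcup_(q in D) F q).
  move=> mF; rewrite bigcup_mkcond; apply: bigcupT_measurable_rat => q.
  by case: ifP => _.
by apply: (h (fun q => `]-oo, ratr q[%classic)) => q; apply: sub_sigma_algebra; exists q.
Qed.

Variable s : seq (R * R).
Hypothesis law_s : is_law s.

Let wt (i : nat) : {nonneg R} := NngNum (normr_ge0 (nth (0, 0) s i).1).
Let pt (i : nat) : mR := (nth (0, 0) s i).2.
Let nu : {measure set mR -> \bar R} := msum (fun i => mscale (wt i) (\d_(pt i))) (size s).

Let law_sum (f : R -> R) : law_exp s f = \sum_(i < size s) (wt i)%:num * f (pt i).
Proof.
rewrite /law_exp (big_nth (0, 0)) big_mkord; apply: eq_bigr => i _ /=.
rewrite ger0_norm//; have /andP[/allP h _] := law_s.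
exact: (h _ (mem_nth _ (ltn_ord i))).
Qed.

Let nuE (A : set mR) : nu A = (law_exp s (\1_A))%:E.
Proof.
rewrite law_sum /nu /= /msum -sumEFin; apply: eq_bigr => i _.
by rewrite EFinM.
Qed.

Let nu_integral (f : mR -> R) : measurable_fun setT f -> (forall x, 0 <= f x) ->
  (\int[nu]_x (f x)%:E = (law_exp s f)%:E)%E.
Proof.
move=> mf f0; have mEf : measurable_fun setT (EFin \o f) by exact/measurable_EFinP.
have Ef0 x : [set: mR] x -> (0 <= (EFin \o f) x)%E by rewrite lee_fin.
rewrite ge0_integral_measure_sum// law_sum -sumEFin; apply: eq_bigr => i _.
by rewrite ge0_integral_mscale// integral_dirac// diracT mul1e EFinM.
Qed.

(** The rational rays are stable under intersection, generate the Borel sets and cover the line, so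
    the measure is the finite sum of point masses; the integral is then a finite sum. *)
Lemma law_integral (m : {measure set mR -> \bar R}) :
  (forall q : rat, m `]-oo, ratr q[%classic = (law_exp s (fun x => (x < ratr q)%R%:R))%:E) ->
  forall f : R -> R, continuous f -> \int[m]_x f x = law_exp s f.
Proof.
move=> mq f cf.
pose G := [set A : set mR | exists q : rat, A = `]-oo, ratr q[%classic].
pose g (n : nat) : set mR := `]-oo, ratr (n%:R : rat)[%classic.
have mG : G `<=` @measurable _ mR by move=> _ [q ->]; exact: measurable_itv.
have Gg n : G (g n) by exists n%:R.
have gT : \bigcup_n g n = [set: mR].
  apply/seteqP; split => // x _; exists (Num.truncn x).+1 => //=.
  by rewrite /g /= in_itv /= ratr_nat truncnS_gt.
have GI : setI_closed G.
  move=> _ _ [p ->] [q ->]; exists (Num.min p q).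
  apply/seteqP; split => x /=; rewrite !in_itv /=.
    by move=> [xp xq]; rewrite minElt; case: ifP.
  rewrite minElt; case: ifPn => pq h; split => //.
    by rewrite (lt_trans h)// ltr_rat.
  by rewrite (lt_le_trans h)// ler_rat leNgt.
have mnuG A : G A -> m A = nu A.
  move=> [q ->]; rewrite mq nuE; congr (law_exp _ _)%:E.
  by apply/funext => x; rewrite indicE mem_setE in_itv.
have mfin n : (m (g n) < +oo)%E by rewrite mq ltry.
have mnu A : measurable A -> m A = nu A.
  have -> : measurable A = <<s G >> A by rewrite -measurable_rational_rays.
  by have := g_sigma_algebra_measure_unique G mG g Gg gT m nu GI mnuG mfin A; exact.
have mf : measurable_fun setT (f : mR -> R) by exact: continuous_measurable_fun.
rewrite /Rintegral (eq_measure_integral nu); last by move=> A mA _; exact: mnu.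
rewrite integralE.
have pE : (EFin \o f)^\+%E = (fun x : mR => (Num.max (f x) 0)%:E).
  by apply/funext => x; rewrite funeposE /= EFin_max.
have nE : (EFin \o f)^\-%E = (fun x : mR => (Num.max (- f x) 0)%:E).
  by apply/funext => x; rewrite funenegE /= EFin_max.
rewrite pE nE !nu_integral; last 4 first.
- by apply: measurable_maxr => //; exact: measurableT_comp.
- by move=> x; rewrite le_max lexx orbT.
- exact: measurable_maxr.
- by move=> x; rewrite le_max lexx orbT.
rewrite -EFinB /= /law_exp -sumrB; apply: eq_bigr => j _; rewrite -mulrBr; congr (_ * _).
by case: (leP (f j.2) 0) => h; [rewrite max_l ?oppr_ge0// sub0r opprK|rewrite max_r ?subr0// oppr_le0 ltW].
Qed.

End DiscreteLaw.

Lemma probability_bigcap1 d (T : measurableType d) (R : realType) (P : probability T R)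
    (I : countType) (F : I -> set T) :
  (forall i, measurable (F i) /\ P (F i) = 1%E) ->
  measurable (\bigcap_i F i) /\ P (\bigcap_i F i) = 1%E.
Proof.
move=> hF; have mU : measurable (\bigcup_i ~` F i).
  apply: countable_bigcupT_measurable; first exact: countableP.
  by move=> i; apply: measurableC; have [] := hF i.
have E : \bigcap_i F i = ~` (\bigcup_i ~` F i).
  by rewrite setC_bigcup; apply: eq_bigcapr => i _; rewrite setCK.
rewrite E; split; first exact: measurableC.
have -> : \bigcup_i ~` F i = \bigcup_n (if unpickle n is Some i then ~` F i else set0).
  apply/seteqP; split => [w [i _ h]|w [n _]]; first by exists (pickle i); rewrite ?pickleK.
  by case: unpickle => // i h; exists i.
rewrite probability_setC; last first.
  apply: bigcupT_measurable => n; case: unpickle => // i.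
  by apply: measurableC; have [] := hF i.
have : P.-negligible (\bigcup_n (if @unpickle I n is Some i then ~` F i else set0)).
  apply: negligible_bigcup => n; case: unpickle => [i|]; last exact: negligible_set0.
  have [mFi PFi] := hF i; apply/negligibleP; first exact: measurableC.
  by have := probability_setC P mFi; rewrite PFi subee.
move/negligibleP => ->; rewrite ?sube0//.
apply: bigcupT_measurable => n; case: unpickle => // i.
by apply: measurableC; have [] := hF i.
Qed.

(** * The almost sure set of samples and the conclusion *)

Theorem proposition4p5 (R : realType) (W : R -> R -> R) (L : R)
    (lam : nat -> R) (phi1 : R -> R)
    (d : measure_display) (T : measurableType d) (P : probability T R)
    (U : nat -> {RV P >-> measurableTypeR R})
    (A : forall n, 'I_n -> 'I_n -> {RV P >-> bool})
    (kappa : forall n,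
       R.-pker (n.-tuple (measurableTypeR R)) ~> (measurableTypeR R)) :
  graphon W ->
  0 < L -> graphon_lipschitz L W ->
  nonneg_eigenvalues W lam ->
  0 < `|lam 0%N - lam 1%N| ->
  normalized_eigenfunction W (lam 0%N) phi1 ->
  iid_uniform U ->
  (forall n, cond_random_graph W (sample U n) (@A n)) ->
  (forall n, cond_distribution (P := P) (T2 := measurableTypeR R)
     (fun w => lambda_max (adjacency_matrix (@A n) w)
               - lambda_max (kernel_matrix W (sample U n w)))
     (sample U n) (kappa n)) ->
  exists calA : set (nat -> R),
    [/\ measurable [set w : T | calA (fun i => U i w)],
        P [set w : T | calA (fun i => U i w)] = 1%E &
        forall u, calA u ->
          weak_cvg (fun n => kappa n (initial_segment u n))
            (gaussian (limit_mean W (lam 0%N) phi1) (limit_var W phi1))].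
Proof.
move=> gW L0 lW eig gap nphi1 iidU graphA cond.
pose K := clamped W.
have lK : lipschitz_kernel L K := clamped_lipschitz gW lW L0.
have K01 : forall x y, 0 <= K x y <= 1 := clamped01 gW.
have U01 i w : 0 <= U i w <= 1 by have [/(_ i w)/unit_itvP] := iidU.
have WK n w : kernel_matrix W (sample U n w) = kernel_matrix K (sample U n w).
  apply/matrixP => i j; rewrite !mxE; case: eqP => // _.
  by rewrite /K clamped_id// tnth_mktuple.
have graphAK n : cond_random_graph K (sample U n) (@A n).
  have [h1 h2 h3] := graphA n; split => // B S mB; rewrite h3//.
  apply: eq_integral => w _; apply: eq_bigr => i _; apply: eq_bigr => j _.
  by rewrite /K clamped_id// tnth_mktuple.
have condK n : cond_distribution (P := P) (T2 := measurableTypeR R)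
     (fun w => lambda_max (adjacency_matrix (@A n) w)
               - lambda_max (kernel_matrix K (sample U n w))) (sample U n) (kappa n).
  have -> : (fun w => lambda_max (adjacency_matrix (@A n) w)
                      - lambda_max (kernel_matrix K (sample U n w))) =
            (fun w => lambda_max (adjacency_matrix (@A n) w)
                      - lambda_max (kernel_matrix W (sample U n w))).
    by apply/funext => w; rewrite WK.
  exact: cond.
have mY n : measurable_fun setT (sample U n).
  apply/measurable_fun_tnthP => i.
  rewrite (_ : _ \o _ = U (val i)); first exact: measurable_funPT.
  by apply/funext => w /=; rewrite tnth_mktuple.
have hN (nq : nat * rat) : exists N : set (nq.1.-tuple (measurableTypeR R)),
    [/\ measurable N, P (sample U nq.1 @^-1` N) = 0%E &
     forall y, ~ N y -> kappa nq.1 y `]-oo, ratr nq.2[%classic =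
       (graph_cdf K (ratr nq.2) y)%:E].
  exact: (kernel_cdf_ae lK K01 (mY nq.1) (graphAK nq.1) (condK nq.1)).
pose N nq := sval (cid (hN nq)).
have NE nq : [/\ measurable (N nq), P (sample U nq.1 @^-1` (N nq)) = 0%E &
    forall y, ~ (N nq) y -> kappa nq.1 y `]-oo, ratr nq.2[%classic =
       (graph_cdf K (ratr nq.2) y)%:E] := svalP (cid (hN nq)).
(* [A1] avoids the null sets chosen for each n and rational ray, [A2] asks for convergence of
   rational frequencies with tolerances 1/(k+1): countably many conditions in all. The premise in
   [A2] makes negative rationals trivial, [freq_good_ae] being stated for q >= 0. *)
pose A1 := [set u : nat -> R | forall nq : nat * rat, ~ N nq (initial_segment u nq.1)].
pose A2 := [set u : nat -> R | forall qk : rat * nat, 0 <= (ratr qk.1 : R) ->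
  freq_good (ratr qk.1) (qk.2.+1%:R^-1) u].
pose A0 := [set u : nat -> R | forall i, 0 <= u i <= 1].
pose F (i : (nat * rat) + (rat * nat)) : set T := match i with
  | inl nq => ~` (sample U nq.1 @^-1` (N nq))
  | inr qk => [set w | 0 <= (ratr qk.1 : R) ->
                 freq_good (ratr qk.1) (qk.2.+1%:R^-1) (fun i => U i w)]
  end.
have hF i : measurable (F i) /\ P (F i) = 1%E.
  case: i => [nq|[q k]] /=.
    have [mN PN _] := NE nq.
    have mp : measurable (sample U nq.1 @^-1` (N nq)).
      by rewrite -[X in measurable X]setTI; exact: mY.
    by split; [exact: measurableC|rewrite probability_setC// PN sube0].
  have [q0|q0] := leP 0 (ratr q : R).
    rewrite (_ : [set w | _] = [set w | freq_good (ratr q) (k.+1%:R^-1) (fun i => U i w)]).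
      by apply: freq_good_ae => //; rewrite invr_gt0.
    by apply/seteqP; split => w /=; [apply|].
  rewrite (_ : [set w | _] = setT); first by rewrite probability_setT.
  by apply/seteqP; split.
have E : [set w : T | (A0 `&` A1 `&` A2) (fun i => U i w)] = \bigcap_i F i.
  apply/seteqP; split => w /=.
    by move=> [[_ h1] h2] [nq|qk] _ /=; [exact: h1|exact: h2].
  move=> h; split; first split; first by move=> i; exact: U01.
    by move=> nq; exact: (h (inl nq) I).
  by move=> qk; exact: (h (inr qk) I).
have [mF PF] := probability_bigcap1 hF.
exists (A0 `&` A1 `&` A2); split; [by rewrite E|by rewrite E|].
move=> u [[u01 uN] ufreq] f cf bf.
have equi := equidistributed u01.
have {}equi : forall f : R -> R, continuous f ->
    mean (fun i : 'I_n => f (u i)) @[n --> \oo] --> int01 f.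
  apply: equi => q q0; apply/cvgrPdist_le => e e0.
  have [k ke] : exists k : nat, k.+1%:R^-1 <= e.
    exists (Num.truncn e^-1); rewrite -[e in leRHS]invrK lef_pV2 ?posrE ?invr_gt0//.
    by rewrite ltW// truncnS_gt.
  have [M hM] := ufreq (q, k) q0; exists M => // n Mn /=.
  by rewrite distrC; apply: le_trans ke; exact: hM.
(* On the chosen set [kappa] is no longer an arbitrary version: it agrees with the explicit finite
   law on rational rays, hence on all integrals of continuous functions. *)
have lawE n : \int[kappa n (initial_segment u n)]_x f x =
    law_exp (graph_law (sampled_kernel u K n)) f.
  apply: law_integral => //.
    by apply: graph_law_is_law => i j; exact: kernel_matrix01.
  by move=> q; have [_ _ /(_ _ (uN (n, q)))] := NE (n, q).
under eq_fun do rewrite lawE.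
rewrite (limit_meanE gW lW eig gap nphi1 L0) (limit_varE gW lW eig gap nphi1 L0).
apply: (graph_law_cvg u01 equi lK K01 (second_eig_ge0 eig) (eig_gap eig gap)) => //.
- exact: (smooth_eigenfunction_eig gW lW eig gap nphi1 L0).
- by move=> mu g mu0; exact: (lipschitz_eigenvalue eig mu0).
- by move=> g; exact: (lipschitz_eigenfunction_unique gW lW eig gap nphi1 L0).
Qed.
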